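(* The $1$-BHS problem can be solved by $6$ agents starting from a rooted initial configuration (all agents co-located at one safe node) in $O(|E|^2)$ rounds, where each agent has $O(\log n)$ bits of memory. Furthermore, each node requires only $O(\log n)$ bits of whiteboard storage.
   Context: A time-varying graph (TVG) is $\mathcal{G}=(V,E,\mathbb{T},\rho)$ with discrete rounds $\mathbb{T}=\mathbb{Z}^+$ and $\rho:E\times\mathbb{T}\to\{0,1\}$ indicating whether an edge is present in a round. Its footprint $G=(V,E)$ is an undirected, unweighted, connected graph with $n=|V|$ anonymous nodes; edges at a node $v$ of degree $\delta_v$ carry locally unique port numbers $0,\dots,\delta_v-1$. Each node has a whiteboard which visiting agents can read, write and erase. One node of $G$ is a black hole, which destroys any agent entering it without a trace; other nodes are safe. In $1$-BHS, in each round an adversary may remove at most one edge of $G$, provided the graph remains connected in every round. Agents have distinct IDs from $[1,n^c]$ ($c>1$ constant unknown to them), know their own ID, and have no knowledge of the number of agents, $n$, the maximum degree, the degree of the black hole, the black hole or missing edges. Execution is synchronous; in each round each agent at a safe node performs Look (reads the whiteboard, sees co-located agents and their parameters, learns whether its previous move attempt succeeded), Compute (chooses a port, may write on the whiteboard), Move (attempts to traverse the port; succeeds iff the edge is present in that round, otherwise stays). An agent knows the degree of its current node and its entry port, but cannot detect a missing incident edge except by trying to traverse it; agents crossing an edge do not see each other. $1$-BHS is solved when at least one agent survives, learns at least one edge (port) leading to the black hole, and terminates; time is the number of rounds until this happens. *)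

(* Defs.v *)
From Stdlib Require Import Bool Arith List Lia.
Import ListNotations.

(* Nodes are 0 .. gn-1 (names invisible to agents).  At node v, port p < deg v
   leads to node nb v p, arriving through port bp v p of that node. *)
Record Graph := mkGraph {
  gn  : nat;
  deg : nat -> nat;
  nb  : nat -> nat -> nat;
  bp  : nat -> nat -> nat }.

Definition wf_graph (G : Graph) : Prop :=
  (forall v p, v < gn G -> p < deg G v ->
     nb G v p < gn G /\ nb G v p <> v /\
     bp G v p < deg G (nb G v p) /\
     nb G (nb G v p) (bp G v p) = v /\
     bp G (nb G v p) (bp G v p) = p) /\
  (forall v p q, v < gn G -> p < deg G v -> q < deg G v ->
     nb G v p = nb G v q -> p = q).

Inductive reach (G : Graph) (ok : nat -> nat -> Prop) (u : nat) : nat -> Prop :=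
| reach_refl : reach G ok u u
| reach_step : forall w p, reach G ok u w -> p < deg G w -> ok w p ->
    reach G ok u (nb G w p).

Definition connected_by (G : Graph) (ok : nat -> nat -> Prop) : Prop :=
  forall u w, u < gn G -> w < gn G -> reach G ok u w.

Definition num_edges (G : Graph) : nat :=
  list_sum (map (deg G) (seq 0 (gn G))) / 2.

(* missing t = Some (w,q): the edge through port q of node w is absent in round t *)
Definition schedule := nat -> option (nat * nat).

Definition present (G : Graph) (m : schedule) (t v p : nat) : bool :=
  match m t with
  | None => true
  | Some (w, q) =>
      negb (((w =? v) && (q =? p)) || ((v =? nb G w q) && (p =? bp G w q)))
  end.

Definition valid_schedule (G : Graph) (m : schedule) : Prop :=
  forall t,
    (match m t with None => True | Some (w, q) => w < gn G /\ q < deg G w end) /\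
    connected_by G (fun v p => present G m t v p = true).

Inductive action := Stay | Move (p : nat) | Halt (answer : option nat).
(* Halt (Some p): the agent terminates claiming that port p of its current node
   leads to the black hole; Halt None: it just terminates. *)

(* One Look-Compute step.  Inputs: own ID, own memory (bit string), degree of the
   current node, entry port (None before the first move), whether the previous
   move attempt succeeded, current whiteboard contents, the (ID, memory) of the
   other live agents co-located at the start of the round.
   Outputs: new memory, new whiteboard contents, action. *)
Record algorithm := mkAlg {
  step : nat -> list bool -> nat -> option nat -> bool -> list bool ->
         list (nat * list bool) -> list bool * list bool * action }.

Record agent := mkAgent {
  pos : nat; alive : bool; mem : list bool; entry : option nat;
  succ : bool; halted : option (option nat) }.

Record config := mkConfig { ag : nat -> agent; wb : nat -> list bool }.

Definition nagents := 6.

Definition active (a : agent) : bool :=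
  alive a && match halted a with None => true | Some _ => false end.

Definition colocated (ids : nat -> nat) (snap : nat -> agent) (k : nat)
  : list (nat * list bool) :=
  map (fun j => (ids j, mem (snap j)))
    (filter (fun j => negb (j =? k) && alive (snap j) && (pos (snap j) =? pos (snap k)))
            (seq 0 nagents)).

(* Compute phase: co-located agents access the whiteboard one after another,
   in increasing order of index (= increasing ID, see the theorem). *)
Definition compute_one (alg : algorithm) (G : Graph) (ids : nat -> nat)
  (snap : nat -> agent)
  (acc : (nat -> agent) * (nat -> list bool) * (nat -> option action)) (k : nat)
  : (nat -> agent) * (nat -> list bool) * (nat -> option action) :=
  let '(A, W, Act) := acc in
  let a := A k in
  if active a then
    let '(s', w', act) :=
      step alg (ids k) (mem a) (deg G (pos a)) (entry a) (succ a) (W (pos a))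
           (colocated ids snap k) in
    (fun j => if j =? k then mkAgent (pos a) (alive a) s' (entry a) (succ a) (halted a)
              else A j,
     fun v => if v =? pos a then w' else W v,
     fun j => if j =? k then Some act else Act j)
  else acc.

Definition move_one (G : Graph) (bh : nat) (m : schedule) (t : nat)
  (a : agent) (act : option action) : agent :=
  match act with
  | None => a
  | Some Stay => mkAgent (pos a) (alive a) (mem a) (entry a) true (halted a)
  | Some (Halt o) => mkAgent (pos a) (alive a) (mem a) (entry a) (succ a) (Some o)
  | Some (Move p) =>
      if (p <? deg G (pos a)) && present G m t (pos a) p then
        let w := nb G (pos a) p in
        mkAgent w (negb (w =? bh)) (mem a) (Some (bp G (pos a) p)) true (halted a)
      else mkAgent (pos a) (alive a) (mem a) (entry a) false (halted a)
  end.

Definition round (alg : algorithm) (G : Graph) (bh : nat) (m : schedule)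
  (ids : nat -> nat) (t : nat) (c : config) : config :=
  let '(A, W, Act) :=
    fold_left (compute_one alg G ids (ag c)) (seq 0 nagents)
              (ag c, wb c, fun _ => None) in
  mkConfig (fun k => move_one G bh m t (A k) (Act k)) W.

Definition init_config (s : nat) : config :=
  mkConfig (fun _ => mkAgent s true [] None true None) (fun _ => []).

Fixpoint exec (alg : algorithm) (G : Graph) (bh : nat) (m : schedule)
  (ids : nat -> nat) (s : nat) (t : nat) : config :=
  match t with
  | 0 => init_config s
  | S t' => round alg G bh m ids t' (exec alg G bh m ids s t')
  end.

Definition correct_claim (G : Graph) (bh : nat) (a : agent) (p : nat) : Prop :=
  p < deg G (pos a) /\ nb G (pos a) p = bh.

Definition solved (G : Graph) (bh : nat) (c : config) : Prop :=
  exists k p, k < nagents /\ alive (ag c k) = true /\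
    halted (ag c k) = Some (Some p) /\ correct_claim G bh (ag c k) p.

(* Main.v *)
(* The six agents form two groups, each made of a leader L and two scouts X and Y, which walk
   cautiously: to cross an edge, X goes first; then X comes back while Y goes; then L and X
   follow.  At the black hole X and then Y are lost, and a leader left alone knows that its
   current port leads there.

   Both groups explore by depth-first search with marks on the whiteboards.  The worker is patient:
   it waits for its edge to come back, and its search would reach every node.  The other group,
   the runner, skips a blocked forward port, and starts a new search with a new label when its way
   back is blocked.  As one edge at most is missing, while the worker is held up the runner moves;
   when the two meet on the worker's edge the runner is separated across it, and takes the search
   over from there.  A search of the runner that is fresh and skips only the worker's edge cannot
   end while that edge is missing, since the network stays connected without it.

   Labels wrap around at twice the number of marked nodes.  A potential combining the steps left to
   the worker (weight of the order of |E|), the number of labels that may still be in the way, and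
   the steps left in the current search of the runner decreases in every round until a group is
   destroyed; it is initially of the order of |E|^2. *)

Require Import Defs.
From Stdlib Require Import Bool Arith List Lia PArith.
Import ListNotations.

(** The difficulty is two groups on one edge. Nobody can tell which edge a lone scout stands across
    until its entry port is published, so a group about to choose waits one round for it. With this
    rule both groups are separated on a common edge only when they launched X in the same round from
    opposite ends; the two X scouts then cross each other and exchange groups. Memories are seen as
    they were at the start of the round, so an order given by the leader would come one round late.
    Instead every member recomputes the verdict of its group from a view common to all members at
    the node. The execution is abstracted into a deterministic transition on two group records and
    decoded whiteboards, where all invariants and potentials live. The searches use separate fields
    of a whiteboard, so the order of access shows only in the note. The search invariant has as
    parameters the ports that may be skipped and those that may have been walked. A run that reuses
    a label keeps only the weak form, enough to bound its length but not to find the black hole;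
    such runs are affordable because each of them lowers the potential of the labels. *)

(** * Self-delimiting bit codes for lists of numbers *)

Fixpoint pos_bits (p : positive) : list bool :=
  match p with
  | xH => [false]
  | xO p => true :: false :: pos_bits p
  | xI p => true :: true :: pos_bits p
  end.

Fixpoint pos_read (s : list bool) : positive * list bool :=
  match s with
  | true :: b :: s => let (p, r) := pos_read s in (if b then xI p else xO p, r)
  | _ :: s => (xH, s)
  | [] => (xH, [])
  end.

Definition nats_bits (l : list nat) : list bool :=
  flat_map (fun n => pos_bits (Pos.of_succ_nat n)) l.

Fixpoint nats_read (k : nat) (s : list bool) : list nat :=
  match k with
  | 0 => []
  | S k => let (p, r) := pos_read s in pred (Pos.to_nat p) :: nats_read k r
  end.

Lemma pos_read_bits p s : pos_read (pos_bits p ++ s) = (p, s).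
Proof. induction p; simpl; try rewrite IHp; reflexivity. Qed.

Lemma nats_read_bits l : nats_read (length l) (nats_bits l) = l.
Proof.
  induction l as [|n l IH]; [reflexivity|].
  unfold nats_bits in *. cbn [length nats_read flat_map].
  rewrite pos_read_bits, SuccNat2Pos.id_succ, IH. reflexivity.
Qed.

(** Each binary digit below the leading one costs two bits, a continuation bit and the digit; the
    leading one is the stop bit. *)
Lemma pos_bits_length p :
  exists k, length (pos_bits p) = 2 * k + 1 /\ 2 ^ k <= Pos.to_nat p.
Proof.
  induction p as [p [k [E H]]|p [k [E H]]|].
  - exists (S k). simpl length. rewrite Pos2Nat.inj_xI, Nat.pow_succ_r'. lia.
  - exists (S k). simpl length. rewrite Pos2Nat.inj_xO, Nat.pow_succ_r'. lia.
  - exists 0. simpl. lia.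
Qed.

Lemma nats_bits_length l b : (forall x, In x l -> x <= b) ->
  length (nats_bits l) <= length l * (2 * Nat.log2 (S b) + 1).
Proof.
  induction l as [|n l IH]; intros H; [simpl; lia|].
  unfold nats_bits in *. cbn [length flat_map]. rewrite length_app.
  assert (length (flat_map (fun n => pos_bits (Pos.of_succ_nat n)) l)
          <= length l * (2 * Nat.log2 (S b) + 1)) by (apply IH; intros; apply H; right; assumption).
  destruct (pos_bits_length (Pos.of_succ_nat n)) as [k [E P]].
  rewrite SuccNat2Pos.id_succ in P.
  assert (k <= Nat.log2 (S b)).
  { rewrite <- (Nat.log2_pow2 k) by lia. apply Nat.log2_le_mono.
    specialize (H n (or_introl eq_refl)). lia. }
  rewrite E. lia.
Qed.

Definition opt_nat (o : option nat) : nat := match o with None => 0 | Some n => S n end.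
Definition nat_opt (n : nat) : option nat := match n with 0 => None | S n => Some n end.
Definition nat_bool (n : nat) : bool := n =? 1.

Lemma nat_opt_nat o : nat_opt (opt_nat o) = o.
Proof. destruct o; reflexivity. Qed.
Lemma nat_bool_b2n b : nat_bool (Nat.b2n b) = b.
Proof. destruct b; reflexivity. Qed.

(** * The algorithm *)

(* A mark: the label of the last search that visited the node, the port to the parent in its tree
   and the next port to try.  A whiteboard has one mark for the worker and one for each group as a
   runner, and a note (mode, port) that hands the worker's search over to a group separated on
   that port. *)
Record mark := Mk { lab : nat; par : option nat; ptr : nat }.

Record board := Bd { mW : mark; mA : mark; mB : mark; nt : option (bool * nat) }.

Definition mR (g : bool) (w : board) : mark := if g then mB w else mA w.
Definition set_mR (g : bool) (w : board) (m : mark) : board :=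
  if g then Bd (mW w) (mA w) m (nt w) else Bd (mW w) m (mB w) (nt w).
Definition set_mW (w : board) (m : mark) : board := Bd m (mA w) (mB w) (nt w).
Definition set_nt (w : board) (o : option (bool * nat)) : board := Bd (mW w) (mA w) (mB w) o.

(* Leader: group, whether it is the worker, direction (forwards or backwards), phase, port, label
   of the current run, number of nodes marked by the group.  The phase is 0 when the port has just
   been chosen, 1 once X has tried to cross, 2 once the leader has seen X gone, and 3 once it has
   seen Y gone; a group that has just arrived is still in phase 3.  Scout: group, whether it is Y,
   entry port published while it is alone, and whether it has been told to take the worker's
   search over. *)
Record ldr := Ld { lg : bool; lr : bool; lm : bool; lp : nat; lt : nat; ll : nat; lc : nat }.
Record drn := Dr { dg : bool; dy : bool; de : option nat; df : bool }.
Inductive amem := ML (l : ldr) | MD (d : drn).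

Definition mark_nats (m : mark) : list nat := [lab m; opt_nat (par m); ptr m].
Definition board_nats (w : board) : list nat :=
  mark_nats (mW w) ++ mark_nats (mA w) ++ mark_nats (mB w) ++
  match nt w with None => [0; 0; 0] | Some (m, q) => [1; Nat.b2n m; q] end.
Definition enc_board (w : board) : list bool := nats_bits (board_nats w).

(** Label 0 stands for unmarked: the searches themselves use labels from 1 on. *)
Definition no_mark := Mk 0 None 0.
Definition empty_board := Bd no_mark no_mark no_mark None.

(** The empty string is a whiteboard never written; an encoded board is never empty, so the two
    cannot be confused. *)
Definition dec_board (s : list bool) : board :=
  match s with
  | [] => empty_board
  | _ =>
    match nats_read 12 s with
    | [a0; a1; a2; b0; b1; b2; c0; c1; c2; n0; n1; n2] =>
        Bd (Mk a0 (nat_opt a1) a2) (Mk b0 (nat_opt b1) b2) (Mk c0 (nat_opt c1) c2)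
           (if nat_bool n0 then Some (nat_bool n1, n2) else None)
    | _ => empty_board
    end
  end.

(** Scouts are padded to eight numbers, so that both kinds of memory are read alike and the leading
    number tells them apart. *)
Definition amem_nats (a : amem) : list nat :=
  match a with
  | ML l => [0; Nat.b2n (lg l); Nat.b2n (lr l); Nat.b2n (lm l); lp l; lt l; ll l; lc l]
  | MD d => [1; Nat.b2n (dg d); Nat.b2n (dy d); opt_nat (de d); Nat.b2n (df d); 0; 0; 0]
  end.
Definition enc_mem (a : amem) : list bool := nats_bits (amem_nats a).
Definition dec_mem (s : list bool) : amem :=
  match nats_read 8 s with
  | [k; a; b; c; d; e; f; h] =>
      if k =? 0 then ML (Ld (nat_bool a) (nat_bool b) (nat_bool c) d e f h)
      else MD (Dr (nat_bool a) (nat_bool b) (nat_opt c) (nat_bool d))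
  | _ => MD (Dr false false None false)
  end.

Lemma dec_enc_mem a : dec_mem (enc_mem a) = a.
Proof.
  unfold dec_mem, enc_mem. 
  replace 8 with (length (amem_nats a)) by (destruct a; reflexivity).
  rewrite nats_read_bits. destruct a as [[]|[]]; cbn;
    rewrite ?nat_bool_b2n, ?nat_opt_nat; reflexivity.
Qed.

(** The empty memory is thereby reserved for agents that have not taken their role yet. *)
Lemma enc_mem_nonnil a : enc_mem a <> [].
Proof. destruct a; discriminate. Qed.

Lemma dec_enc_board w : dec_board (enc_board w) = w.
Proof.
  unfold dec_board, enc_board.
  replace 12 with (length (board_nats w)) by (destruct w as [? ? ? [[? ?]|]]; reflexivity).
  destruct (nats_bits (board_nats w)) eqn:E.
  - exfalso. unfold nats_bits, board_nats, mark_nats in E.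
    cbn [app flat_map] in E. destruct (Pos.of_succ_nat (lab (mW w))); discriminate.
  - rewrite <- E, nats_read_bits. destruct w as [[] [] [] [[? ?]|]]; cbn;
      rewrite ?nat_bool_b2n, ?nat_opt_nat; reflexivity.
Qed.

(* What a member of group g sees at its node: o* describe the other group, m* its own;
   oE is the entry port published by a member of the other group separated from its leader. *)
Record view := Vw { oL : option ldr; oX : bool; oY : bool; oE : option nat;
                    mL : option ldr; mX : bool; mY : bool; mF : bool }.

Definition is_L (g : bool) (a : amem) : bool :=
  match a with ML l => eqb (lg l) g | MD _ => false end.
Definition is_D (g y : bool) (a : amem) : bool :=
  match a with MD d => eqb (dg d) g && eqb (dy d) y | ML _ => false end.
Definition get_L (g : bool) (s : list amem) : option ldr :=
  match find (is_L g) s with Some (ML l) => Some l | _ => None end.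
Definition get_D (g y : bool) (s : list amem) : option drn :=
  match find (is_D g y) s with Some (MD d) => Some d | _ => None end.
Definition is_some {A} (o : option A) : bool := match o with Some _ => true | None => false end.

Definition mk_view (g : bool) (s : list amem) : view :=
  let l := get_L (negb g) s in
  let x := get_D (negb g) false s in
  let y := get_D (negb g) true s in
  Vw l (is_some x) (is_some y)
     (match l, x, y with
      | None, Some d, _ => de d
      | None, None, Some d => de d
      | _, _, _ => None
      end)
     (get_L g s) (is_some (get_D g false s)) (is_some (get_D g true s))
     (match get_D g true s with Some d => df d | None => false end).

(** * Situations of the other group, and the verdict on the chosen port *)

Definition opt_eqb (a b : option nat) : bool :=
  match a, b with
  | Some x, Some y => x =? y
  | None, None => true
  | _, _ => false
  end.

Definition lone_here (V : view) : bool := negb (is_some (oL V)) && (oX V || oY V).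
(** Such a scout may stand across any port of the node, so no port can be judged until it has
    published. *)
Definition fresh (V : view) : bool := lone_here V && negb (is_some (oE V)).
Definition loneon (V : view) (p : nat) : bool := lone_here V && opt_eqb (oE V) (Some p).
Definition pairon (V : view) (p : nat) : bool :=
  match oL V with Some o => (lt o =? p) && negb (oX V && oY V) | None => false end.
Definition trio (V : view) : bool := is_some (oL V) && oX V && oY V.
(** Two whole groups aiming at one port: the runner must give way, or both would send X along the
    edge from the same end. *)
Definition unsepon (V : view) (p : nat) : bool :=
  match oL V with Some o => (lt o =? p) && trio V && negb (lp o =? 3) | None => false end.
(** In phase 3 the recorded port still belongs to the previous node, so it says nothing about what
    the group will do here. *)
Definition arriving (V : view) : bool :=
  match oL V with Some o => trio V && (lp o =? 3) | None => false end.
Definition worker_on (V : view) (p : option nat) : bool :=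
  match oL V with
  | Some o => lr o && trio V && negb (lp o =? 3) && opt_eqb p (Some (lt o))
  | None => false
  end.

(* [SwapP] and [SwapL]: the runner is separated on the worker's edge and becomes the worker; the
   message reaches the pair here, or is left here as a note for the scout now on its own. *)
Inductive verdict := Wait | Give | SwapP | SwapL | Try.

Definition judge (V : view) (l : ldr) : verdict :=
  if fresh V then Wait
  else if lr l then
    if pairon V (lt l) then SwapP else if loneon V (lt l) then SwapL else Try
  else if arriving V then Wait
  else if negb (lp l =? 0) || pairon V (lt l) || loneon V (lt l) || unsepon V (lt l)
  then Give else Try.

(** The worker seen here on the same port gives its search away in this very round, by [SwapP]. The
    pair can therefore adopt its direction without any message; the port is already common. *)
Definition take_role (V : view) (l : ldr) (p : nat) : ldr :=
  match oL V with
  | Some o =>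
      if negb (lr l) && worker_on V (Some (lt l))
      then Ld (lg l) true (lm o) p (lt l) (ll l) (lc l)
      else Ld (lg l) (lr l) (lm l) p (lt l) (ll l) (lc l)
  | None => Ld (lg l) (lr l) (lm l) p (lt l) (ll l) (lc l)
  end.

(** * Marks, labels and the choice of the next port *)

Definition cur_mark (l : ldr) (w : board) : mark := if lr l then mW w else mR (lg l) w.
Definition set_mark (l : ldr) (w : board) (m : mark) : board :=
  if lr l then set_mW w m else set_mR (lg l) w m.
Definition cur_lab (l : ldr) : nat := if lr l then 1 else ll l.

Definition next_lab (l : ldr) : nat := if 2 * lc l + 2 <=? ll l then 1 else S (ll l).
Definition bump_count (m : mark) (c : nat) : nat := if lab m =? 0 then S c else c.

(** Also the fate of a worker that has just handed its search over: it comes out as a runner. *)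
Definition new_run (l : ldr) (w : board) : ldr * board :=
  (Ld (lg l) false true 0 0 (next_lab l) (bump_count (mR (lg l) w) (lc l)),
   set_mR (lg l) w (Mk (next_lab l) None 0)).

Definition nx (d : nat) (m : mark) : option (bool * nat) :=
  if ptr m <? d then Some (true, ptr m)
  else match par m with Some i => Some (false, i) | None => None end.

Definition point (l : ldr) (a : bool * nat) : ldr :=
  Ld (lg l) (lr l) (fst a) 0 (snd a) (ll l) (lc l).

Definition proceed (d : nat) (l : ldr) (w : board) (m : mark) : ldr * board :=
  match nx d m with
  | Some a => (point l a, set_mark l w m)
  (* For a worker this case never occurs: its search, which skips nothing, would have visited the
     black hole. *)
  | None => if lr l then (l, w) else new_run l (set_mark l w m)
  end.

(** The cap at [d] bounds the pointer whatever the mark was, so the storage bound needs no invariant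
    of the search. *)
Definition advance (d : nat) (m : mark) : mark :=
  Mk (lab m) (par m) (if ptr m <? d then S (ptr m) else d).

Definition arrive (d : nat) (en : option nat) (fl : bool) (l : ldr) (w : board) : ldr * board :=
  let i := match en with Some i => i | None => 0 end in
  let m := cur_mark l w in
  (* A flagged group has entered by the very port through which the worker wanted to leave, so it
     takes its entry port as the current one, in phase 1 because X leaves in this round. The note is
     there whenever this happens; the default direction only completes the function. *)
  if fl then
    (Ld (lg l) true (match nt w with Some (md, _) => md | None => true end) 1 i (ll l) (lc l),
     set_nt w None)
  else if lm l then
    if lab m =? cur_lab l then (point l (false, i), w)
    else proceed d (Ld (lg l) (lr l) (lm l) (lp l) (lt l) (ll l)
                       (if lr l then lc l else bump_count m (lc l)))
                 w (Mk (cur_lab l) en 0)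
  else proceed d l w (advance d m).

(** A way back cannot be skipped, since the rest of the search is reached only through it; hence the
    new run. *)
Definition abandon (d : nat) (l : ldr) (w : board) : ldr * board :=
  if lm l then proceed d l w (advance d (cur_mark l w)) else new_run l w.

(** * The step of a leader and of a scout *)

Definition leader_step (V : view) (d : nat) (en : option nat) (l : ldr) (w : board)
  : ldr * board * action :=
  if mX V then
    if mY V then
      if lp l =? 3 then (arrive d en (mF V) l w, Stay)
      else match judge V l with
           | Wait => (l, w, Stay)
           | Give => (abandon d l w, Stay)
           | SwapP => (new_run l w, Stay)
           | SwapL => (new_run l (set_nt w (Some (lm l, lt l))), Stay)
           | Try => (Ld (lg l) (lr l) (lm l) 1 (lt l) (ll l) (lc l), w, Stay)
           end
    (* The old phase is tested: leader and X leave one round after Y was seen gone, which gives Y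
       the time to publish its entry port. *)
    else (take_role V l 3, w, if lp l =? 3 then Move (lt l) else Stay)
  else if mY V then (take_role V l 2, w, Stay)
  else (l, w, Halt (Some (lt l))).

(** The group seen here has its own X across the edge by which this X came: the two scouts have
    crossed each other, and each joins the group it finds. *)
Definition opposite (V : view) (en : option nat) : bool :=
  match oL V with
  | Some o => oY V && negb (oX V) && opt_eqb en (Some (lt o))
  | None => false
  end.

(** Y may access the whiteboard before the worker writes its note in the same round, so it also
    flags itself on seeing a worker about to write one. The worker does so only for a scout that has
    already published, hence the test on [pub]. *)
Definition flagged (V : view) (pub en : option nat) (w : board) : bool :=
  match nt w with Some (_, q) => opt_eqb en (Some q) | None => false end
  || is_some pub && worker_on V en.

(** X leaves in the round of the decision, so it recomputes the decision of the leader. In phase 3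
    only a flagged group moves: it turns back at once through its entry port. *)
Definition try_port (V : view) (l : ldr) (en : option nat) : option nat :=
  if lp l =? 3 then if mF V then en else None
  else match judge V l with Try => Some (lt l) | _ => None end.

Definition drone_step (V : view) (en : option nat) (d : drn) (w : board) : drn * action :=
  match mL V with
  | Some l =>
      (Dr (dg d) (dy d) None false,
       if dy d then
         if mX V then Stay else if lp l =? 2 then Move (lt l) else Stay
       else if mY V then match try_port V l en with Some q => Move q | None => Stay end
       else if lp l =? 3 then Move (lt l) else Stay)
  | None =>
      if dy d then (Dr (dg d) true en (flagged V (de d) en w), Stay)
      else if opposite V en then (Dr (negb (dg d)) false None false, Stay)
      else match de d with
           | None => (Dr (dg d) false en false, Stay)
           (* X attempts to return exactly in the rounds in which Y attempts to leave, along the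
              same edge: both succeed or both fail. *)
           | Some i => (d, Move i)
           end
  end.

(** [k] is the rank of the ID among the agents. Group [false] starts as the worker and has marked
    nothing as a runner, so its label and count are 0. *)
Definition setup (k : nat) (w : board) : amem * board :=
  match k with
  | 0 => (ML (Ld false true true 0 0 0 0), set_mW w (Mk 1 None 0))
  | 1 => (MD (Dr false false None false), w)
  | 2 => (MD (Dr false true None false), w)
  | 3 => (ML (Ld true false true 0 0 1 1), set_mR true w (Mk 1 None 0))
  | 4 => (MD (Dr true false None false), w)
  | _ => (MD (Dr true true None false), w)
  end.

Definition bhs_step (id : nat) (s : list bool) (d : nat) (en : option nat) (ok : bool)
  (w : list bool) (col : list (nat * list bool)) : list bool * list bool * action :=
  match s with
  | [] =>
      let '(a, b) := setup (length (filter (fun x => fst x <? id) col)) (dec_board w) in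
      (enc_mem a, enc_board b, Stay)
  | _ =>
      let all := dec_mem s :: map (fun x => dec_mem (snd x)) col in
      match dec_mem s with
      | ML l =>
          let '(l', b, a) := leader_step (mk_view (lg l) all) d en l (dec_board w) in
          (enc_mem (ML l'), enc_board b, a)
      | MD m =>
          let '(m', a) := drone_step (mk_view (dg m) all) en m (dec_board w) in
          (enc_mem (MD m'), w, a)
      end
  end.

Definition bhs : algorithm := mkAlg bhs_step.

(** * Abstract group states *)

(* Where the three members of a group are, v being the node of the leader and u the other end of
   its current port: [All] all at v; [Out] the X member alone at u (destroyed if u is the black
   hole); [Back] the Y member alone at u; [Lost] only the leader is left; [Done] it has stopped. *)
Inductive shape := All | Out | Back | Lost | Done.

(** [ge], [xn] and [yn] are the entry ports which the model records for the leader, X and Y; [xe]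
    and [ye] are the ports published by the scouts, and [yf] is the flag of Y. *)
Record grp := Gp { gl : ldr; gv : nat; ge : option nat; gs : shape;
                   xe : option nat; xn : option nat;
                   ye : option nat; yn : option nat; yf : bool }.

Section Abstract.
Variables (G : Graph) (bh : nat).

Definition far (g : grp) : nat := nb G (gv g) (lt (gl g)).
Definition xat (g : grp) (v : nat) : bool :=
  match gs g with All | Back => gv g =? v | Out => far g =? v | _ => false end.
Definition yat (g : grp) (v : nat) : bool :=
  match gs g with All | Out => gv g =? v | Back => far g =? v | _ => false end.

Definition aview (me ot : grp) (v : nat) : view :=
  let at_ (g : grp) := if gv g =? v then Some (gl g) else None in
  Vw (at_ ot) (xat ot v) (yat ot v)
     (if gv ot =? v then None else if xat ot v then xe ot else if yat ot v then ye ot else None)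
     (at_ me) (xat me v) (yat me v) (yat me v && yf me).

Definition lead (me ot : grp) (w : board) : ldr * board * action :=
  leader_step (aview me ot (gv me)) (deg G (gv me)) (ge me) (gl me) w.
Definition lead_l me ot w := fst (fst (lead me ot w)).
Definition lead_w me ot w := snd (fst (lead me ot w)).

(** [w] is the whiteboard read by the leader and [wy] the one read by Y at the far end. When the far
    end is the black hole, the fields of X are kept only formally. *)
Definition gnext (pr : nat -> nat -> bool) (me ot : grp) (w wy : board) : grp :=
  let l := gl me in let v := gv me in let p := lt l in let u := far me in
  let b := bp G v p in let l' := lead_l me ot w in
  match gs me with
  | Done => me
  | Lost => Gp l v (ge me) Done (xe me) (xn me) (ye me) (yn me) (yf me)
  | All =>
      match try_port (aview me ot v) l (xn me) with
      | Some q =>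
          if pr v q then Gp l' v (ge me) Out None (Some (bp G v q)) None (yn me) false
          else Gp l' v (ge me) All None (xn me) None (yn me) false
      | None => Gp l' v (ge me) All None (xn me) None (yn me) false
      end
  | Out =>
      (* The X scouts exchange groups, so the entry port of X is taken from the other record. *)
      if opposite (aview me ot u) (xn me)
      then Gp l' v (ge me) All None (xn ot) None (yn me) false
      else if (lp l =? 2) && pr v p
      then Gp l' v (ge me) (if u =? bh then Lost else Back) (xe me) (Some p) None (Some b) false
      else Gp l' v (ge me) Out (match xe me with None => xn me | e => e end) (xn me)
              None (yn me) false
  | Back =>
      if (lp l =? 3) && pr v p
      then Gp l' u (Some b) All None (Some b) (yn me) (yn me)
              (flagged (aview me ot u) (ye me) (yn me) wy)
      else Gp l' v (ge me) Back None (xn me) (yn me) (yn me)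
              (flagged (aview me ot u) (ye me) (yn me) wy)
  end.

Definition upd (W : nat -> board) (v : nat) (w : board) : nat -> board :=
  fun z => if z =? v then w else W z.

Definition lead_upd (me ot : grp) (W : nat -> board) : nat -> board :=
  match gs me with
  | Done => W
  | _ => upd W (gv me) (lead_w me ot (W (gv me)))
  end.

Record state := St { gr : bool -> grp; wbs : nat -> board }.

(** Group [false] has the smaller IDs, so its leader writes before the other one. *)
Definition mid_wbs (s : state) : nat -> board := lead_upd (gr s false) (gr s true) (wbs s).
Definition rd_wbs (s : state) (g : bool) : nat -> board := if g then mid_wbs s else wbs s.

Definition next (pr : nat -> nat -> bool) (s : state) : state :=
  St (fun g => let me := gr s g in let ot := gr s (negb g) in
               gnext pr me ot (rd_wbs s g (gv me)) (mid_wbs s (far me)))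
     (lead_upd (gr s true) (gr s false) (mid_wbs s)).

Definition group_ok (g : bool) (me : grp) : Prop :=
  lg (gl me) = g /\ gv me < gn G /\ gv me <> bh /\
  match gs me with
  | All => lp (gl me) = 3 -> xn me = ge me
  | Out => lt (gl me) < deg G (gv me) /\ (lp (gl me) = 1 \/ lp (gl me) = 2) /\
           (far me <> bh -> xn me = Some (bp G (gv me) (lt (gl me))) /\
                            xe me = if lp (gl me) =? 1 then None else xn me)
  | Back => lt (gl me) < deg G (gv me) /\ (lp (gl me) = 2 \/ lp (gl me) = 3) /\ far me <> bh /\
            yn me = Some (bp G (gv me) (lt (gl me)))
  | _ => lt (gl me) < deg G (gv me) /\ far me = bh
  end.

Definition opposed (a b : grp) : Prop :=
  gs a = Out /\ gs b = Out /\ gv b = far a /\ lt (gl b) = bp G (gv a) (lt (gl a)).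

(** In phase 1 Y does not move; so when the X scouts are exchanged, both groups end the round
    whole. *)
Definition opposed_fresh (s : state) : Prop :=
  forall g, opposed (gr s g) (gr s (negb g)) -> lp (gl (gr s g)) = 1.

Definition iL (g : bool) := if g then 3 else 0.
(** [sw] is the parity of the number of exchanges of the X scouts so far. *)
Definition iX (sw g : bool) := if xorb sw g then 4 else 1.
Definition iY (g : bool) := if g then 5 else 2.

Definition rel_grp (c : config) (sw g : bool) (me : grp) : Prop :=
  (exists ok, ag c (iL g) =
     mkAgent (gv me) true (enc_mem (ML (gl me))) (ge me) ok
       (match gs me with Done => Some (Some (lt (gl me))) | _ => None end)) /\
  match gs me with
  | Lost | Done => alive (ag c (iX sw g)) = false /\ alive (ag c (iY g)) = false
  | _ =>
      (let u := match gs me with Out => far me | _ => gv me end in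
       alive (ag c (iX sw g)) = negb (u =? bh) /\
       (u <> bh -> exists ok, ag c (iX sw g) =
          mkAgent u true (enc_mem (MD (Dr g false (xe me) false))) (xn me) ok None)) /\
      (exists ok, ag c (iY g) =
        mkAgent (match gs me with Back => far me | _ => gv me end) true
          (enc_mem (MD (Dr g true (ye me) (yf me)))) (yn me) ok None)
  end.

(** Boards are compared after decoding; the last clause, that the raw string is canonical, is what
    lets a bound on the decoded numbers bound the bits. *)
Definition rel (c : config) (s : state) : Prop :=
  exists sw, (forall g, rel_grp c sw g (gr s g)) /\
    (forall v, dec_board (wb c v) = wbs s v) /\
    (forall v, wb c v = [] \/ exists w, wb c v = enc_board w).

End Abstract.

(** * Refinement of the abstract states *)

Section Round.
Variables (alg : algorithm) (G : Graph) (bh : nat) (m : schedule) (ids : nat -> nat)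
          (t : nat) (c : config).

Definition out (w : list bool) (k : nat) : list bool * list bool * action :=
  let a := ag c k in
  step alg (ids k) (mem a) (deg G (pos a)) (entry a) (succ a) w (colocated ids (ag c) k).

Fixpoint boards (k : nat) : nat -> list bool :=
  match k with
  | 0 => wb c
  | S k =>
      if active (ag c k) then
        fun v => if v =? pos (ag c k)
                 then snd (fst (out (boards k (pos (ag c k))) k)) else boards k v
      else boards k
  end.

Definition out_at (k : nat) := out (boards k (pos (ag c k))) k.

Definition computed (k : nat) : agent :=
  let a := ag c k in
  if active a then
    mkAgent (pos a) (alive a) (fst (fst (out_at k))) (entry a) (succ a) (halted a)
  else a.

Definition chosen (k : nat) : option action :=
  if active (ag c k) then Some (snd (out_at k)) else None.

(** A turn changes the memory of its own agent only, so each agent still has its memory of the start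
    of the round when its turn comes; only the whiteboards are threaded through the turns. *)
Lemma compute_fold n :
  let '(A, W, Act) :=
    fold_left (compute_one alg G ids (ag c)) (seq 0 n) (ag c, wb c, fun _ => None) in
  (forall j, A j = if j <? n then computed j else ag c j) /\
  (forall v, W v = boards n v) /\
  (forall j, Act j = if j <? n then chosen j else None).
Proof.
  induction n as [|n IH]; [simpl; auto|].
  rewrite seq_S, fold_left_app. cbn [fold_left plus].
  destruct (fold_left _ _ _) as [[A W] Act]. destruct IH as (HA & HW & HAct).
  unfold compute_one.
  assert (EA : A n = ag c n) by (rewrite HA, Nat.ltb_irrefl; reflexivity).
  rewrite EA. destruct (active (ag c n)) eqn:E.
  - rewrite HW. destruct (step _ _ _ _ _ _ _ _) as [[s' w'] act] eqn:ES.
    repeat split; intro j.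
    + destruct (Nat.eqb_spec j n) as [->|N].
      * rewrite (proj2 (Nat.ltb_lt n (S n))) by lia.
        unfold computed. rewrite E. unfold out_at, out. rewrite ES. reflexivity.
      * rewrite HA. destruct (Nat.ltb_spec j n), (Nat.ltb_spec j (S n)); try lia; reflexivity.
    + simpl boards. rewrite E. destruct (j =? pos (ag c n)); [|apply HW].
      unfold out. rewrite ES. reflexivity.
    + destruct (Nat.eqb_spec j n) as [->|N].
      * rewrite (proj2 (Nat.ltb_lt n (S n))) by lia.
        unfold chosen. rewrite E. unfold out_at, out. rewrite ES. reflexivity.
      * rewrite HAct. destruct (Nat.ltb_spec j n), (Nat.ltb_spec j (S n)); try lia; reflexivity.
  - repeat split; intro j.
    + rewrite HA. destruct (Nat.ltb_spec j n), (Nat.ltb_spec j (S n)); try lia; try reflexivity.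
      replace j with n by lia. unfold computed. rewrite E. reflexivity.
    + simpl boards. rewrite E. apply HW.
    + rewrite HAct. destruct (Nat.ltb_spec j n), (Nat.ltb_spec j (S n)); try lia; try reflexivity.
      replace j with n by lia. unfold chosen. rewrite E. reflexivity.
Qed.

Lemma round_agent k : k < nagents ->
  ag (round alg G bh m ids t c) k = move_one G bh m t (computed k) (chosen k).
Proof.
  intro H. unfold round. pose proof (compute_fold nagents) as F.
  destruct (fold_left _ _ _) as [[A W] Act]. destruct F as (HA & _ & HAct). simpl ag.
  rewrite HA, HAct. apply Nat.ltb_lt in H. rewrite H. reflexivity.
Qed.

Lemma round_board v : wb (round alg G bh m ids t c) v = boards nagents v.
Proof.
  unfold round. pose proof (compute_fold nagents) as F.
  destruct (fold_left _ _ _) as [[A W] Act]. destruct F as (_ & HW & _). apply HW.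
Qed.

End Round.

Lemma find_unique {T} (f : T -> bool) (s : list T) (a : T) :
  In a s -> f a = true -> (forall b, In b s -> f b = true -> b = a) -> find f s = Some a.
Proof.
  intros I F U. destruct (find f s) as [b|] eqn:E.
  - apply find_some in E. f_equal. apply U; tauto.
  - rewrite (find_none _ _ E _ I) in F. discriminate.
Qed.

(** * What an agent sees, in terms of the abstract state *)

Section Seen.
Variables (c : config) (ids : nat -> nat) (k : nat).

Definition seen : list amem :=
  dec_mem (mem (ag c k)) :: map (fun x => dec_mem (snd x)) (colocated ids (ag c) k).

Lemma in_seen a : k < nagents -> alive (ag c k) = true ->
  In a seen <-> exists j, j < nagents /\ alive (ag c j) = true /\
                          pos (ag c j) = pos (ag c k) /\ dec_mem (mem (ag c j)) = a.
Proof.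
  intros Hk Ak. unfold seen, colocated. rewrite map_map. cbn [In snd].
  split.
  - intros [H|H]; [exists k; auto|].
    apply in_map_iff in H. destruct H as (j & E & H). apply filter_In in H.
    destruct H as [H F]. apply in_seq in H. apply andb_prop in F. destruct F as [F P].
    apply andb_prop in F. destruct F as [_ F]. apply Nat.eqb_eq in P.
    exists j. repeat split; auto; lia.
  - intros (j & Hj & Aj & P & E).
    destruct (Nat.eq_dec j k) as [->|N]; [left; assumption|right].
    apply in_map_iff. exists j. split; [assumption|]. apply filter_In. split.
    + apply in_seq. lia.
    + apply Nat.eqb_neq in N. rewrite N, Aj, P, Nat.eqb_refl. reflexivity.
Qed.

(** The test [f] recognizes agent [j] by its memory alone, so searching the visible memories only
    asks whether [j] is alive and here. *)
Lemma find_seen f j : k < nagents -> alive (ag c k) = true -> j < nagents ->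
  (forall i, i < nagents -> i <> j -> alive (ag c i) = true -> f (dec_mem (mem (ag c i))) = false) ->
  (alive (ag c j) = true -> f (dec_mem (mem (ag c j))) = true) ->
  find f seen = if alive (ag c j) && (pos (ag c j) =? pos (ag c k))
                then Some (dec_mem (mem (ag c j))) else None.
Proof.
  intros Hk Ak Hj U F.
  destruct (alive (ag c j)) eqn:Aj; [destruct (Nat.eqb_spec (pos (ag c j)) (pos (ag c k))) as [P|P]|].
  - apply find_unique; [| |].
    + apply in_seen; auto. exists j. auto.
    + auto.
    + intros b I Fb. apply in_seen in I; auto. destruct I as (i & Hi & Ai & Pi & <-).
      destruct (Nat.eq_dec i j) as [->|N]; [reflexivity|].
      rewrite U in Fb by auto. discriminate.
  - destruct (find f seen) as [b|] eqn:E; [|reflexivity]. exfalso.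
    apply find_some in E. destruct E as [I Fb]. apply in_seen in I; auto.
    destruct I as (i & Hi & Ai & Pi & <-). destruct (Nat.eq_dec i j) as [->|N]; [congruence|].
    rewrite U in Fb by auto. discriminate.
  - destruct (find f seen) as [b|] eqn:E; [|reflexivity]. exfalso.
    apply find_some in E. destruct E as [I Fb]. apply in_seen in I; auto.
    destruct I as (i & Hi & Ai & Pi & <-). destruct (Nat.eq_dec i j) as [->|N]; [congruence|].
    rewrite U in Fb by auto. discriminate.
Qed.

End Seen.

Lemma member_cases sw i : i < nagents -> exists h, i = iL h \/ i = iX sw h \/ i = iY h.
Proof.
  unfold nagents, iL, iX, iY. intro H.
  destruct i as [|[|[|[|[|[|i]]]]]]; [exists false|exists sw|exists false|exists true|exists (negb sw)|exists true|lia];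
  destruct sw; simpl; auto.
Qed.

Lemma iL_lt h : iL h < nagents. Proof. destruct h; unfold nagents; simpl; lia. Qed.
Lemma iX_lt sw h : iX sw h < nagents.
Proof. unfold iX, nagents. destruct (xorb sw h); lia. Qed.
Lemma iY_lt h : iY h < nagents. Proof. destruct h; unfold nagents; simpl; lia. Qed.
Section View.
Variables (G : Graph) (bh : nat) (ids : nat -> nat) (c : config) (s : state) (sw : bool).
Hypothesis wfG : wf_graph G.
Hypothesis R : forall g, rel_grp G bh c sw g (gr s g).
Hypothesis OK : forall g, group_ok G bh g (gr s g).

Lemma mem_L h : dec_mem (mem (ag c (iL h))) = ML (gl (gr s h)).
Proof. destruct (R h) as [[ok E0] _]; rewrite E0. apply dec_enc_mem. Qed.

Lemma mem_X h : alive (ag c (iX sw h)) = true ->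
  dec_mem (mem (ag c (iX sw h))) = MD (Dr h false (xe (gr s h)) false).
Proof.
  intro A. destruct (R h) as [_ H].
  destruct (gs (gr s h)); try (destruct H; congruence);
  destruct H as [[A' H] _]; rewrite A in A'; symmetry in A'; apply negb_true_iff, Nat.eqb_neq in A';
  destruct (H A') as [ok E0]; rewrite E0; apply dec_enc_mem.
Qed.

Lemma mem_Y h : alive (ag c (iY h)) = true ->
  dec_mem (mem (ag c (iY h))) = MD (Dr h true (ye (gr s h)) (yf (gr s h))).
Proof.
  intro A. destruct (R h) as [_ H].
  destruct (gs (gr s h)); try (destruct H; congruence);
  destruct H as [_ [ok E0]]; rewrite E0; apply dec_enc_mem.
Qed.

Variables (k v : nat).
Hypothesis Hk : k < nagents.
Hypothesis Ak : alive (ag c k) = true.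
Hypothesis Pk : pos (ag c k) = v.
Hypothesis vbh : v <> bh.

Lemma get_L_seen h :
  get_L h (seen c ids k) = if gv (gr s h) =? v then Some (gl (gr s h)) else None.
Proof.
  unfold get_L. rewrite (find_seen c ids k (is_L h) (iL h)); auto using iL_lt.
  - rewrite mem_L, Pk. destruct (R h) as [[ok E0] _]; rewrite E0. simpl. destruct (_ =? v); reflexivity.
  - intros i Hi N Ai. destruct (member_cases sw i Hi) as [h' [-> | [-> | ->] ] ].
    + rewrite mem_L. simpl. rewrite (proj1 (OK h')). destruct h, h'; congruence || reflexivity.
    + rewrite mem_X by assumption. reflexivity.
    + rewrite mem_Y by assumption. reflexivity.
  - rewrite mem_L. simpl. rewrite (proj1 (OK h)). destruct h; reflexivity.
Qed.

Lemma get_X_seen h :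
  get_D h false (seen c ids k) =
  if xat G (gr s h) v then Some (Dr h false (xe (gr s h)) false) else None.
Proof.
  unfold get_D. rewrite (find_seen c ids k (is_D h false) (iX sw h)); auto using iX_lt.
  - rewrite Pk. destruct (alive (ag c (iX sw h))) eqn:A.
    + rewrite mem_X by assumption. destruct (R h) as [_ H]. unfold xat.
      destruct (gs (gr s h)); try (destruct H; congruence);
      destruct H as [[A' H] _]; rewrite A in A'; symmetry in A'; apply negb_true_iff, Nat.eqb_neq in A';
      destruct (H A') as [ok E0]; rewrite E0; simpl; destruct (_ =? v); reflexivity.
    + destruct (R h) as [_ H]. unfold xat. simpl.
      destruct (gs (gr s h)); auto;
      destruct H as [[A' _] _]; rewrite A in A'; symmetry in A'; apply negb_false_iff, Nat.eqb_eq in A';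
      destruct (Nat.eqb_spec (gv (gr s h)) v), (Nat.eqb_spec (far G (gr s h)) v); congruence.
  - intros i Hi N Ai. destruct (member_cases sw i Hi) as [h' [-> | [-> | ->] ] ].
    + rewrite mem_L. reflexivity.
    + rewrite mem_X by assumption. simpl. destruct h, h'; congruence || reflexivity.
    + rewrite mem_Y by assumption. simpl. destruct h, h'; reflexivity.
  - intro A. rewrite mem_X by assumption. simpl. destruct h; reflexivity.
Qed.

Lemma get_Y_seen h :
  get_D h true (seen c ids k) =
  if yat G (gr s h) v then Some (Dr h true (ye (gr s h)) (yf (gr s h))) else None.
Proof.
  unfold get_D. rewrite (find_seen c ids k (is_D h true) (iY h)); auto using iY_lt.
  - rewrite Pk. destruct (alive (ag c (iY h))) eqn:A.
    + rewrite mem_Y by assumption. destruct (R h) as [_ H]. unfold yat.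
      destruct (gs (gr s h)); try (destruct H; congruence);
      destruct H as [_ [ok E0]]; rewrite E0; simpl; destruct (_ =? v); reflexivity.
    + destruct (R h) as [_ H]. unfold yat. simpl.
      destruct (gs (gr s h)); auto; destruct H as [_ [ok E]]; rewrite E in A; discriminate.
  - intros i Hi N Ai. destruct (member_cases sw i Hi) as [h' [-> | [-> | ->] ] ].
    + rewrite mem_L. reflexivity.
    + rewrite mem_X by assumption. simpl. destruct h, h'; reflexivity.
    + rewrite mem_Y by assumption. simpl. destruct h, h'; congruence || reflexivity.
  - intro A. rewrite mem_Y by assumption. simpl. destruct h; reflexivity.
Qed.

(** The right-hand side depends on the node and the group but not on the agent [k] that looks. This
    is why a leader and its scouts at one node reach the same verdict. *)
Lemma mk_view_seen g :
  mk_view g (seen c ids k) = aview G (gr s g) (gr s (negb g)) v.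
Proof.
  unfold mk_view, aview. rewrite !get_L_seen, !get_X_seen, !get_Y_seen.
  destruct (gv (gr s (negb g)) =? v), (xat G (gr s (negb g)) v), (yat G (gr s (negb g)) v),
    (xat G (gr s g) v), (yat G (gr s g) v); reflexivity.
Qed.

End View.

Section Edges.
Variables (G : Graph) (m : schedule).
Hypothesis wfG : wf_graph G.
Hypothesis vm : valid_schedule G m.

Definition avail (t v p : nat) : bool := (p <? deg G v) && present G m t v p.

Lemma present_sym t v p : v < gn G -> p < deg G v ->
  present G m t (nb G v p) (bp G v p) = present G m t v p.
Proof.
  intros Hv Hp. unfold present. pose proof (proj1 (vm t)) as Hm.
  destruct (m t) as [[w q]|]; [|reflexivity]. destruct Hm as [Hw Hq].
  destruct (proj1 wfG v p Hv Hp) as (_ & _ & _ & N & B).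
  destruct (proj1 wfG w q Hw Hq) as (_ & _ & _ & N' & B').
  f_equal. apply eq_iff_eq_true.
  rewrite !orb_true_iff, !andb_true_iff, !Nat.eqb_eq. split; intros [[E1 E2]|[E1 E2]].
  - right. rewrite E1, E2. auto.
  - left. rewrite E1, E2 in *. rewrite N' in N. rewrite B' in B. auto.
  - right. rewrite E1, E2. auto.
  - left. rewrite E1, E2. auto.
Qed.

Lemma avail_sym t v p : v < gn G -> p < deg G v ->
  avail t (nb G v p) (bp G v p) = avail t v p.
Proof.
  intros Hv Hp. unfold avail. rewrite present_sym by assumption.
  destruct (proj1 wfG v p Hv Hp) as (_ & _ & B & _).
  apply Nat.ltb_lt in B, Hp. rewrite B, Hp. reflexivity.
Qed.

End Edges.

(** * One concrete step of each agent *)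

Section Refine.
Variables (G : Graph) (bh : nat) (m : schedule) (ids : nat -> nat) (t : nat)
          (c : config) (s : state) (sw : bool).
Hypothesis wfG : wf_graph G.
Hypothesis vm : valid_schedule G m.
Hypothesis R : forall g, rel_grp G bh c sw g (gr s g).
Hypothesis RW : forall v, dec_board (wb c v) = wbs s v.
Hypothesis OK : forall g, group_ok G bh g (gr s g).

Notation rd := (round bhs G bh m ids t c).
Notation brd := (boards bhs G ids c).
Notation me g := (gr s g).
Notation ot g := (gr s (negb g)).

Lemma bhs_step_nonnil id l d en ok w col : l <> [] ->
  bhs_step id l d en ok w col =
  let all := dec_mem l :: map (fun x => dec_mem (snd x)) col in
  match dec_mem l with
  | ML l =>
      let '(l', b, a) := leader_step (mk_view (lg l) all) d en l (dec_board w) in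
      (enc_mem (ML l'), enc_board b, a)
  | MD m =>
      let '(m', a) := drone_step (mk_view (dg m) all) en m (dec_board w) in
      (enc_mem (MD m'), w, a)
  end.
Proof. destruct l; [congruence|reflexivity]. Qed.

Lemma out_L w g : out bhs G ids c w (iL g) =
  let '(l', b, a) := lead G (me g) (ot g) (dec_board w) in
  (enc_mem (ML l'), enc_board b, a).
Proof.
  destruct (R g) as [[ok E] _]. unfold out. rewrite E. change (step bhs) with bhs_step. cbn [mem pos entry succ].
  rewrite bhs_step_nonnil by apply enc_mem_nonnil.
  assert (V : mk_view g (seen c ids (iL g)) = aview G (me g) (ot g) (gv (me g))).
  { apply (mk_view_seen G bh ids c s sw R OK).
    - apply iL_lt.
    - rewrite E; reflexivity.
    - rewrite E; reflexivity.
    - apply (OK g). }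
  unfold seen in V. rewrite E in V. simpl mem in V. cbv zeta.
  rewrite dec_enc_mem in *. rewrite (proj1 (OK g)), V. reflexivity.
Qed.

Lemma out_X w g u ok : u <> bh ->
  ag c (iX sw g) = mkAgent u true (enc_mem (MD (Dr g false (xe (me g)) false))) (xn (me g)) ok None ->
  out bhs G ids c w (iX sw g) =
  let '(d, a) := drone_step (aview G (me g) (ot g) u) (xn (me g))
                   (Dr g false (xe (me g)) false) (dec_board w) in
  (enc_mem (MD d), w, a).
Proof.
  intros N E. unfold out. rewrite E. change (step bhs) with bhs_step. cbn [mem pos entry succ].
  rewrite bhs_step_nonnil by apply enc_mem_nonnil.
  assert (V : mk_view g (seen c ids (iX sw g)) = aview G (me g) (ot g) u).
  { apply (mk_view_seen G bh ids c s sw R OK); try (rewrite E; reflexivity); auto using iX_lt. }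
  unfold seen in V. rewrite E in V. simpl mem in V. cbv zeta.
  rewrite dec_enc_mem in *. simpl dg. rewrite V. reflexivity.
Qed.

Lemma out_Y w g u ok : u <> bh ->
  ag c (iY g) =
    mkAgent u true (enc_mem (MD (Dr g true (ye (me g)) (yf (me g))))) (yn (me g)) ok None ->
  out bhs G ids c w (iY g) =
  let '(d, a) := drone_step (aview G (me g) (ot g) u) (yn (me g))
                   (Dr g true (ye (me g)) (yf (me g))) (dec_board w) in
  (enc_mem (MD d), w, a).
Proof.
  intros N E. unfold out. rewrite E. change (step bhs) with bhs_step. cbn [mem pos entry succ].
  rewrite bhs_step_nonnil by apply enc_mem_nonnil.
  assert (V : mk_view g (seen c ids (iY g)) = aview G (me g) (ot g) u).
  { apply (mk_view_seen G bh ids c s sw R OK); try (rewrite E; reflexivity); auto using iY_lt. }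
  unfold seen in V. rewrite E in V. simpl mem in V. cbv zeta.
  rewrite dec_enc_mem in *. simpl dg. rewrite V. reflexivity.
Qed.

Lemma drone_X_cases g : active (ag c (iX sw g)) = true ->
  exists u ok, u <> bh /\ u = (match gs (me g) with Out => far G (me g) | _ => gv (me g) end) /\
  ag c (iX sw g) = mkAgent u true (enc_mem (MD (Dr g false (xe (me g)) false))) (xn (me g)) ok None.
Proof.
  intro A. unfold active in A. apply andb_prop in A. destruct A as [A _].
  destruct (R g) as [_ H]. destruct (gs (me g)); try (destruct H; congruence);
  destruct H as [[A' H] _]; rewrite A in A'; symmetry in A'; apply negb_true_iff, Nat.eqb_neq in A';
  destruct (H A') as [ok E]; eauto.
Qed.

Lemma drone_Y_cases g : active (ag c (iY g)) = true ->
  exists u ok, u <> bh /\ u = (match gs (me g) with Back => far G (me g) | _ => gv (me g) end) /\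
  ag c (iY g) =
    mkAgent u true (enc_mem (MD (Dr g true (ye (me g)) (yf (me g))))) (yn (me g)) ok None.
Proof.
  intro A. unfold active in A. apply andb_prop in A. destruct A as [A _].
  destruct (R g) as [_ H]. destruct (OK g) as (_ & _ & N & K).
  destruct (gs (me g)); try (destruct H; congruence); destruct H as [_ [ok E]];
  eexists; exists ok; (split; [|split; [reflexivity|exact E]]); tauto.
Qed.

(** Scouts return the whiteboard unchanged, so only the turns of agents 0 and 3 matter for the
    boards of a round. *)
Lemma boards_drone k n v : (forall g, k <> iL g) -> k < nagents -> n = S k -> brd n v = brd k v.
Proof.
  intros N H ->.
  change (brd (S k) v) with
    ((if active (ag c k) then
        fun v => if v =? pos (ag c k)
                 then snd (fst (out bhs G ids c (brd k (pos (ag c k))) k))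
                 else brd k v
      else brd k) v).
  destruct (active (ag c k)) eqn:A; [|reflexivity].
  destruct (Nat.eqb_spec v (pos (ag c k))) as [->|]; [|reflexivity].
  destruct (member_cases sw k H) as [h [E | [E | E]]].
  - destruct (N h E).
  - rewrite E in *. destruct (drone_X_cases h A) as (u & ok & Hu & _ & E').
    rewrite (out_X _ h u ok Hu E'). destruct (drone_step _ _ _ _). reflexivity.
  - rewrite E in *. destruct (drone_Y_cases h A) as (u & ok & Hu & _ & E').
    rewrite (out_Y _ h u ok Hu E'). destruct (drone_step _ _ _ _). reflexivity.
Qed.

Lemma boards_leader g W v : (forall z, dec_board (brd (iL g) z) = W z) ->
  dec_board (brd (S (iL g)) v) = lead_upd G (me g) (ot g) W v.
Proof.
  intro H. destruct (R g) as [[ok E] _]. unfold lead_upd.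
  change (brd (S (iL g))) with
    (if active (ag c (iL g)) then
        fun v => if v =? pos (ag c (iL g))
                 then snd (fst (out bhs G ids c (brd (iL g) (pos (ag c (iL g)))) (iL g)))
                 else brd (iL g) v
      else brd (iL g)).
  unfold active. rewrite out_L. rewrite E. simpl alive. simpl halted. simpl pos.
  rewrite H. unfold lead_w.
  destruct (gs (me g)); simpl; auto; unfold upd; destruct (v =? gv (me g)); auto;
  destruct (lead _ _ _ _) as [[l' b] a]; simpl; apply dec_enc_board.
Qed.

Lemma boards1 v : dec_board (brd 1 v) = mid_wbs G s v.
Proof. apply (boards_leader false). exact RW. Qed.

Ltac not_leader := intros []; discriminate.

Lemma boards_mid k v : 1 <= k <= 3 -> brd k v = brd 1 v.
Proof.
  intro H. assert (k = 1 \/ k = 2 \/ k = 3) as [->| [->| ->]] by lia; [reflexivity| |];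
  rewrite ?(boards_drone 2 3), ?(boards_drone 1 2); auto; try not_leader; unfold nagents; lia.
Qed.

Lemma boards_end k v : 4 <= k <= 6 ->
  dec_board (brd k v) = lead_upd G (gr s true) (gr s false) (mid_wbs G s) v.
Proof.
  intro H. assert (brd k v = brd 4 v) as ->.
  { assert (k = 4 \/ k = 5 \/ k = 6) as [->| [->| ->]] by lia; [reflexivity| |];
    rewrite ?(boards_drone 5 6), ?(boards_drone 4 5); auto; try not_leader; unfold nagents; lia. }
  apply (boards_leader true). intro z. simpl iL. rewrite boards_mid by lia. apply boards1.
Qed.

Lemma step_dead k : k < nagents -> active (ag c k) = false -> ag rd k = ag c k.
Proof.
  intros H A. rewrite round_agent by assumption. unfold computed, chosen. rewrite A. reflexivity.
Qed.

Lemma step_L g : gs (me g) <> Done -> exists ok, ag rd (iL g) =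
  let r := lead G (me g) (ot g) (rd_wbs G s g (gv (me g))) in
  move_one G bh m t
    (mkAgent (gv (me g)) true (enc_mem (ML (fst (fst r)))) (ge (me g)) ok None)
    (Some (snd r)).
Proof.
  intro N. destruct (R g) as [[ok E] _]. exists ok. rewrite round_agent by apply iL_lt.
  assert (A : active (ag c (iL g)) = true).
  { unfold active. rewrite E. destruct (gs (me g)); reflexivity || congruence. }
  unfold computed, chosen, out_at. rewrite A, out_L.
  replace (dec_board (brd (iL g) (pos (ag c (iL g))))) with (rd_wbs G s g (gv (me g))).
  - rewrite E. destruct (lead _ _ _ _) as [[l b] a]. simpl.
    destruct (gs (me g)); reflexivity || congruence.
  - rewrite E. simpl pos. unfold rd_wbs. destruct g; simpl iL.
    + rewrite boards_mid by lia. symmetry. apply boards1.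
    + symmetry. apply RW.
Qed.

Lemma step_X g u : u = (match gs (me g) with Out => far G (me g) | _ => gv (me g) end) ->
  u <> bh -> gs (me g) <> Lost -> gs (me g) <> Done ->
  exists w ok, ag rd (iX sw g) =
  let r := drone_step (aview G (me g) (ot g) u) (xn (me g)) (Dr g false (xe (me g)) false) w in
  move_one G bh m t (mkAgent u true (enc_mem (MD (fst r))) (xn (me g)) ok None) (Some (snd r)).
Proof.
  intros -> N N1 N2.
  assert (exists ok, ag c (iX sw g) =
    mkAgent (match gs (me g) with Out => far G (me g) | _ => gv (me g) end) true
       (enc_mem (MD (Dr g false (xe (me g)) false))) (xn (me g)) ok None) as [ok E].
  { destruct (R g) as [_ H]. destruct (gs (me g)); try congruence; apply H; auto. }
  exists (dec_board (brd (iX sw g) (pos (ag c (iX sw g))))), ok.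
  rewrite round_agent by apply iX_lt.
  assert (A : active (ag c (iX sw g)) = true) by (rewrite E; reflexivity).
  unfold computed, chosen, out_at. rewrite A, (out_X _ g _ ok N E), E.
  destruct (drone_step _ _ _ _). reflexivity.
Qed.

(** The board read by Y is identified only when Y is away from its leader; beside the leader its
    step does not depend on it. *)
Lemma step_Y g u : u = (match gs (me g) with Back => far G (me g) | _ => gv (me g) end) ->
  gs (me g) <> Lost -> gs (me g) <> Done ->
  exists w ok, (gv (me g) <> u -> w = mid_wbs G s u) /\ ag rd (iY g) =
  let r := drone_step (aview G (me g) (ot g) u) (yn (me g))
             (Dr g true (ye (me g)) (yf (me g))) w in
  move_one G bh m t (mkAgent u true (enc_mem (MD (fst r))) (yn (me g)) ok None) (Some (snd r)).
Proof.
  intros -> N1 N2.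
  assert (exists ok, ag c (iY g) =
    mkAgent (match gs (me g) with Back => far G (me g) | _ => gv (me g) end) true
      (enc_mem (MD (Dr g true (ye (me g)) (yf (me g))))) (yn (me g)) ok None) as [ok E].
  { destruct (R g) as [_ H]. destruct (gs (me g)); try congruence; apply H; auto. }
  assert (A : active (ag c (iY g)) = true) by (rewrite E; reflexivity).
  destruct (drone_Y_cases g A) as (u & ok' & Hu & Eu & E').
  exists (dec_board (brd (iY g) u)), ok'. rewrite <- Eu. split.
  - intro NE. destruct g; simpl iY.
    + rewrite boards_end by lia. unfold lead_upd.
      apply Nat.eqb_neq in NE. rewrite Nat.eqb_sym in NE.
      destruct (gs (gr s true)); unfold upd; rewrite ?NE; reflexivity.
    + rewrite boards_mid by lia. apply boards1.
  - rewrite round_agent by apply iY_lt.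
    unfold computed, chosen, out_at. rewrite A, (out_Y _ g _ ok' Hu E'), E'.
    destruct (drone_step _ _ _ _). reflexivity.
Qed.

End Refine.

(** * Invariants of a single group *)

Section Facts.
Variables (G : Graph) (bh : nat).
Hypothesis wfG : wf_graph G.

Lemma far_ok v p : v < gn G -> p < deg G v ->
  nb G v p < gn G /\ nb G v p <> v /\ bp G v p < deg G (nb G v p) /\
  nb G (nb G v p) (bp G v p) = v /\ bp G (nb G v p) (bp G v p) = p.
Proof. apply (proj1 wfG). Qed.

Definition opposed_b (me ot : grp) : bool :=
  match gs me with Out => opposite (aview G me ot (far G me)) (xn me) | _ => false end.

(** The X of a group leaves only through the current port of its leader, so a leader and Y without
    X, on the port by which the observer entered, locate the missing scout. *)
Lemma opposed_b_iff g a b : group_ok G bh g a -> group_ok G bh (negb g) b ->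
  opposed_b a b = true <-> opposed G a b.
Proof.
  intros (_ & Ha & Na & Sa) (_ & Hb & Nb & Sb). unfold opposed_b, opposed.
  destruct (gs a) eqn:Ea; try (split; [discriminate|intros [E _]; discriminate E]).
  destruct Sa as (Pa & _ & Xa). unfold opposite, aview. simpl.
  destruct (Nat.eqb_spec (gv b) (far G a)) as [E|E].
  - unfold xat, yat.
    destruct (gs b) eqn:Eb; rewrite ?E, ?Nat.eqb_refl; simpl;
      try (split; [discriminate|intros (_ & F & _); discriminate F]).
    + destruct Sb as (Pb & _ & _). destruct (far_ok (gv b) (lt (gl b)) Hb Pb) as (_ & N & _).
      fold (far G b) in N. rewrite E in N. apply Nat.eqb_neq in N. rewrite N. simpl.
      destruct Xa as [Xa _]; [congruence|].
      rewrite Xa. simpl. rewrite Nat.eqb_eq. split; [auto|intros (_ & _ & _ & H); auto].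
    + destruct Sb as (Pb & _ & Fb & _). destruct (far_ok (gv b) (lt (gl b)) Hb Pb) as (_ & N & _).
      fold (far G b) in N. rewrite E in N. apply Nat.eqb_neq in N. rewrite N. simpl.
      split; [discriminate|intros (_ & F & _); discriminate F].
  - split; [discriminate|]. intros (_ & _ & F & _). congruence.
Qed.

Lemma opposed_sym g a b : group_ok G bh g a -> group_ok G bh (negb g) b ->
  opposed G a b -> opposed G b a.
Proof.
  intros (_ & Ha & Na & Sa) _ (E1 & E2 & E3 & E4). unfold opposed. rewrite E1, E2, E3, E4.
  rewrite E1 in Sa. destruct Sa as (Pa & _).
  destruct (far_ok _ _ Ha Pa) as (_ & _ & _ & N & B).
  unfold far. rewrite E3, E4. auto.
Qed.

Lemma aview_All me ot : gs me = All ->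
  mL (aview G me ot (gv me)) = Some (gl me) /\ mX (aview G me ot (gv me)) = true /\
  mY (aview G me ot (gv me)) = true /\ mF (aview G me ot (gv me)) = yf me.
Proof. intro E. unfold aview, xat, yat. rewrite E. simpl. rewrite Nat.eqb_refl. auto. Qed.

Lemma aview_Out me ot : gs me = Out -> far G me <> gv me ->
  mL (aview G me ot (gv me)) = Some (gl me) /\ mX (aview G me ot (gv me)) = false /\
  mY (aview G me ot (gv me)) = true.
Proof.
  intros E N. unfold aview, xat, yat. rewrite E. simpl. rewrite Nat.eqb_refl.
  apply Nat.eqb_neq in N. auto.
Qed.

Lemma aview_Back me ot : gs me = Back -> far G me <> gv me ->
  mL (aview G me ot (gv me)) = Some (gl me) /\ mX (aview G me ot (gv me)) = true /\
  mY (aview G me ot (gv me)) = false.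
Proof.
  intros E N. unfold aview, xat, yat. rewrite E. simpl. rewrite Nat.eqb_refl.
  apply Nat.eqb_neq in N. auto.
Qed.

Lemma aview_Lost me ot : gs me = Lost ->
  mX (aview G me ot (gv me)) = false /\ mY (aview G me ot (gv me)) = false.
Proof. intros E. unfold aview, xat, yat. rewrite E. auto. Qed.

Lemma aview_far me ot : far G me <> gv me -> mL (aview G me ot (far G me)) = None.
Proof. intro N. unfold aview. simpl. apply not_eq_sym, Nat.eqb_neq in N. rewrite N. reflexivity. Qed.

Lemma lead_Out me ot w : gs me = Out -> far G me <> gv me ->
  lead G me ot w = (take_role (aview G me ot (gv me)) (gl me) 2, w, Stay).
Proof.
  intros E N. destruct (aview_Out me ot E N) as (_ & X & Y). unfold lead, leader_step.
  rewrite X, Y. reflexivity.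
Qed.

Lemma lead_Back me ot w : gs me = Back -> far G me <> gv me ->
  lead G me ot w = (take_role (aview G me ot (gv me)) (gl me) 3, w,
                    if lp (gl me) =? 3 then Move (lt (gl me)) else Stay).
Proof.
  intros E N. destruct (aview_Back me ot E N) as (_ & X & Y). unfold lead, leader_step.
  rewrite X, Y. reflexivity.
Qed.

Lemma lead_Lost me ot w : gs me = Lost ->
  lead G me ot w = (gl me, w, Halt (Some (lt (gl me)))).
Proof.
  intros E. destruct (aview_Lost me ot E) as (X & Y). unfold lead, leader_step.
  rewrite X, Y. reflexivity.
Qed.

Lemma take_role_fix V l p :
  lg (take_role V l p) = lg l /\ lp (take_role V l p) = p /\ lt (take_role V l p) = lt l /\
  ll (take_role V l p) = ll l /\ lc (take_role V l p) = lc l.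
Proof. unfold take_role. destruct (oL V); [destruct (_ && _)|]; auto. Qed.

Lemma proceed_lg d l w mk :
  lg (fst (proceed d l w mk)) = lg l /\
  (lp (fst (proceed d l w mk)) = 3 -> lp l = 3).
Proof.
  unfold proceed. destruct (nx d mk); [|destruct (lr l)]; simpl; auto; split; auto; discriminate.
Qed.

Lemma lead_All me ot w : gs me = All -> exists l' w', lead G me ot w = (l', w', Stay) /\
  lg l' = lg (gl me) /\ (lp l' = 3 -> lp (gl me) = 3).
Proof.
  intros E. destruct (aview_All me ot E) as (_ & X & Y & _). unfold lead, leader_step.
  rewrite X, Y. destruct (Nat.eqb_spec (lp (gl me)) 3) as [P|P].
  - destruct (arrive _ _ _ _ _) as [l' w'] eqn:A. exists l', w'. split; [reflexivity|].
    split; [|auto].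
    replace l' with (fst (arrive (deg G (gv me)) (ge me) (mF (aview G me ot (gv me))) (gl me) w))
      by (rewrite A; reflexivity).
    unfold arrive. destruct (mF _); [reflexivity|].
    destruct (lm (gl me)); [destruct (_ =? _); [reflexivity|]|];
      match goal with |- context [proceed ?a ?b ?c ?d] => apply (proceed_lg a b c d) end.
  - destruct (judge _ _);
      try (eexists _, _; split; [reflexivity|split; simpl; auto; discriminate]).
    destruct (abandon _ _ _) as [l' w'] eqn:A. exists l', w'. split; [reflexivity|].
    replace l' with (fst (abandon (deg G (gv me)) (gl me) w)) by (rewrite A; reflexivity).
    unfold abandon. destruct (lm (gl me)); [|split; simpl; auto; discriminate].
    match goal with |- context [proceed ?a ?b ?c ?d] => apply (proceed_lg a b c d) end.
Qed.

(** Leader and X evaluate the same verdict on the same view. On a flagged arrival each uses its own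
    entry port; these agree because the two crossed together. *)
Lemma lead_try me ot w q : gs me = All -> (lp (gl me) = 3 -> xn me = ge me) ->
  try_port (aview G me ot (gv me)) (gl me) (xn me) = Some q ->
  lt (lead_l G me ot w) = q /\ lp (lead_l G me ot w) = 1.
Proof.
  intros E P. destruct (aview_All me ot E) as (_ & X & Y & F).
  unfold lead_l, lead, leader_step, try_port. rewrite X, Y.
  destruct (Nat.eqb_spec (lp (gl me)) 3) as [H|H].
  - rewrite F. destruct (yf me); [|discriminate]. intro Q. rewrite (P H) in Q.
    unfold arrive. rewrite Q. auto.
  - destruct (judge _ _); try discriminate. intros [= <-]. auto.
Qed.

Variable pr : nat -> nat -> bool.
Hypothesis pr_deg : forall v p, pr v p = true -> p < deg G v.

Lemma group_ok_next g me ot w wy : group_ok G bh g me -> group_ok G bh (negb g) ot ->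
  (opposed G me ot -> lp (gl me) = 1 /\ lp (gl ot) = 1) ->
  group_ok G bh g (gnext G bh pr me ot w wy).
Proof.
  intros (L & Hn & Nb & S) K O. unfold gnext.
  destruct (gs me) eqn:E.
  - destruct (lead_All me ot w E) as (l' & w' & EL & Lg & P3).
    assert (lg (lead_l G me ot w) = g) by (unfold lead_l; rewrite EL; simpl; congruence).
    destruct (try_port _ _ _) as [q|] eqn:T.
    + destruct (lead_try me ot w q E S T) as [T1 T2].
      destruct (pr (gv me) q) eqn:P.
      * repeat split; simpl; auto; try congruence.
        -- rewrite T1. auto.
        -- rewrite T2. reflexivity.
      * repeat split; simpl; auto. rewrite T2. discriminate.
    + repeat split; simpl; auto. unfold lead_l. rewrite EL. simpl. auto.
  - destruct S as (Pd & Hp & Hx). destruct (far_ok _ _ Hn Pd) as (F1 & F2 & F3 & F4 & F5).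
    fold (far G me) in *.
    assert (EL : lead_l G me ot w = take_role (aview G me ot (gv me)) (gl me) 2).
    { unfold lead_l. rewrite lead_Out; auto. }
    rewrite EL. destruct (take_role_fix (aview G me ot (gv me)) (gl me) 2) as (T1 & T2 & T3 & _).
    destruct (opposite _ _) eqn:Op.
    + repeat split; simpl; rewrite ?T1, ?T2; auto. discriminate.
    + destruct ((lp (gl me) =? 2) && pr (gv me) (lt (gl me))) eqn:C.
      * destruct (Nat.eqb_spec (far G me) bh) as [B|B];
          repeat split; simpl; unfold far; simpl; rewrite ?T1, ?T2, ?T3; auto.
      * repeat split; simpl; unfold far; simpl; rewrite ?T1, ?T2, ?T3; auto.
        -- apply Hx. unfold far in *. simpl in *. rewrite T3 in *. assumption.
        -- destruct Hx as [X1 X2]; [unfold far in *; simpl in *; rewrite T3 in *; assumption|]. rewrite X2. simpl.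
           destruct (lp (gl me) =? 1); [reflexivity|]. rewrite X1. reflexivity.
  - destruct S as (Pd & Hp & Hx & Hy). destruct (far_ok _ _ Hn Pd) as (F1 & F2 & F3 & F4 & F5).
    fold (far G me) in *.
    assert (EL : lead_l G me ot w = take_role (aview G me ot (gv me)) (gl me) 3).
    { unfold lead_l. rewrite lead_Back; auto. }
    rewrite EL. destruct (take_role_fix (aview G me ot (gv me)) (gl me) 3) as (T1 & T2 & T3 & _).
    destruct (_ && _);
      repeat split; simpl; unfold far; simpl; rewrite ?T1, ?T2, ?T3; auto.
  - repeat split; simpl; auto; apply S.
  - repeat split; auto. rewrite E. assumption.
Qed.

End Facts.

(** * Simulation of a round by the abstract transition *)

Section RelNext.
Variables (G : Graph) (bh : nat) (m : schedule) (ids : nat -> nat) (t : nat)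
          (c : config) (s : state) (sw : bool).
Hypothesis wfG : wf_graph G.
Hypothesis vm : valid_schedule G m.
Hypothesis R : forall g, rel_grp G bh c sw g (gr s g).
Hypothesis RW : forall v, dec_board (wb c v) = wbs s v.
Hypothesis OK : forall g, group_ok G bh g (gr s g).
Hypothesis OF : opposed_fresh G s.

Notation rd := (round bhs G bh m ids t c).
Notation me g := (gr s g).
Notation ot g := (gr s (negb g)).
Notation pr := (avail G m t).

(** A crossing is noticed at both ends in the same round, so one bit serves both groups. *)
Definition sw_next : bool := if opposed_b G (gr s false) (gr s true) then negb sw else sw.

Lemma opposed_both g : opposed G (me g) (ot g) -> opposed_b G (gr s false) (gr s true) = true.
Proof.
  intro O. apply (opposed_b_iff G bh wfG false); auto. destruct g; [|exact O].
  apply (opposed_sym G bh wfG true); auto.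
Qed.

Lemma opposed_any g : opposed_b G (me g) (ot g) = opposed_b G (gr s false) (gr s true).
Proof.
  destruct g; [|reflexivity]. apply eq_iff_eq_true. split; intro O.
  - apply (opposed_both true). apply (opposed_b_iff G bh wfG true); auto.
  - apply (opposed_b_iff G bh wfG true); auto. apply (opposed_sym G bh wfG false); auto.
    apply (opposed_b_iff G bh wfG false); auto.
Qed.

Lemma move_move v e n ok h p :
  move_one G bh m t (mkAgent v true e n ok h) (Some (Move p)) =
  if pr v p then mkAgent (nb G v p) (negb (nb G v p =? bh)) e (Some (bp G v p)) true h
  else mkAgent v true e n false h.
Proof. reflexivity. Qed.

Lemma rel_grp_All g : gs (me g) = All ->
  rel_grp G bh rd sw_next g (gr (next G bh pr s) g).
Proof.
  intro E. destruct (OK g) as (L & Hn & Nb & S). rewrite E in S.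
  assert (SW : sw_next = sw).
  { unfold sw_next. rewrite <- (opposed_any g). unfold opposed_b. rewrite E. reflexivity. }
  rewrite SW. cbn [next gr]. unfold gnext. rewrite E. cbv zeta.
  destruct (step_L G bh m ids t c s sw R RW OK g) as [okL SL]; [congruence|].
  destruct (step_X G bh m ids t c s sw R OK g (gv (me g))) as (w1 & okX & SX);
    [rewrite E; reflexivity|assumption|congruence|congruence|].
  destruct (step_Y G bh m ids t c s sw R RW OK g (gv (me g))) as (w2 & okY & _ & SY);
    [rewrite E; reflexivity|congruence|congruence|].
  destruct (aview_All G (me g) (ot g) E) as (VL & VX & VY & VF).
  destruct (lead_All G (me g) (ot g) (rd_wbs G s g (gv (me g))) E) as (l' & w' & EL & _).
  assert (DX : drone_step (aview G (me g) (ot g) (gv (me g))) (xn (me g))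
                 (Dr g false (xe (me g)) false) w1 =
               (Dr g false None false,
                match try_port (aview G (me g) (ot g) (gv (me g))) (gl (me g)) (xn (me g)) with
                | Some q => Move q | None => Stay end)).
  { unfold drone_step. rewrite VL, VY. reflexivity. }
  assert (DY : drone_step (aview G (me g) (ot g) (gv (me g))) (yn (me g))
                 (Dr g true (ye (me g)) (yf (me g))) w2 = (Dr g true None false, Stay)).
  { unfold drone_step. rewrite VL, VX. reflexivity. }
  rewrite DX in SX. rewrite DY in SY. cbv zeta in SL, SX, SY. cbn [fst snd] in SX, SY.
  assert (SL' : exists ok, ag rd (iL g) = mkAgent (gv (me g)) true
     (enc_mem (ML (lead_l G (me g) (ot g) (rd_wbs G s g (gv (me g)))))) (ge (me g)) ok None).
  { unfold lead_l. rewrite EL in *. eexists. rewrite SL. simpl. reflexivity. }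
  clear SL. assert (Nb' := Nb). apply Nat.eqb_neq in Nb'.
  destruct (try_port _ _ _) as [q|] eqn:T.
  - destruct (lead_try G (me g) (ot g) (rd_wbs G s g (gv (me g))) q E S T) as [T1 T2].
    rewrite move_move in SX. destruct (pr (gv (me g)) q) eqn:P.
    + unfold rel_grp, far. cbn [gl gv ge gs xe xn ye yn yf]. rewrite T1.
      split; [exact SL'|]. split.
      * rewrite SX. cbn [alive]. split; [reflexivity|]. intro N.
        apply Nat.eqb_neq in N. rewrite N. eexists. reflexivity.
      * rewrite SY. eexists. reflexivity.
    + unfold rel_grp. cbn [gl gv ge gs xe xn ye yn yf].
      split; [exact SL'|]. rewrite SX, SY, Nb'. cbn. split; [split|]; eauto.
  - unfold rel_grp. cbn [gl gv ge gs xe xn ye yn yf].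
    split; [exact SL'|]. rewrite SX, SY, Nb'. cbn. split; [split|]; eauto.
Qed.

Lemma rel_grp_Out g : gs (me g) = Out ->
  rel_grp G bh rd sw_next g (gr (next G bh pr s) g).
Proof.
  intro E. destruct (OK g) as (L & Hn & Nb & S). rewrite E in S. destruct S as (Pd & Hp & Hx).
  destruct (far_ok G wfG _ _ Hn Pd) as (F1 & F2 & F3 & F4 & F5). fold (far G (me g)) in *.
  assert (SW : sw_next = if opposite (aview G (me g) (ot g) (far G (me g))) (xn (me g))
                         then negb sw else sw).
  { unfold sw_next. rewrite <- (opposed_any g). unfold opposed_b. rewrite E. reflexivity. }
  cbn [next gr]. unfold gnext. rewrite E. cbv zeta.
  destruct (step_L G bh m ids t c s sw R RW OK g) as [okL SL]; [congruence|].
  destruct (step_Y G bh m ids t c s sw R RW OK g (gv (me g))) as (w2 & okY & _ & SY);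
    [rewrite E; reflexivity|congruence|congruence|].
  destruct (aview_Out G (me g) (ot g) E F2) as (VL & VX & VY).
  assert (DY : drone_step (aview G (me g) (ot g) (gv (me g))) (yn (me g))
                 (Dr g true (ye (me g)) (yf (me g))) w2 =
               (Dr g true None false,
                if lp (gl (me g)) =? 2 then Move (lt (gl (me g))) else Stay)).
  { unfold drone_step. rewrite VL, VX. reflexivity. }
  rewrite DY in SY. cbv zeta in SL, SY. cbn [fst snd] in SY.
  pose proof (lead_Out G (me g) (ot g) (rd_wbs G s g (gv (me g))) E F2) as EL.
  assert (SL' : exists ok, ag rd (iL g) = mkAgent (gv (me g)) true
     (enc_mem (ML (lead_l G (me g) (ot g) (rd_wbs G s g (gv (me g)))))) (ge (me g)) ok None).
  { unfold lead_l. rewrite EL in *. eexists. rewrite SL. simpl. reflexivity. }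
  assert (LT : lt (lead_l G (me g) (ot g) (rd_wbs G s g (gv (me g)))) = lt (gl (me g))).
  { unfold lead_l. rewrite EL. simpl. apply take_role_fix. }
  clear SL EL. assert (Nb' := Nb). apply Nat.eqb_neq in Nb'.
  destruct (opposite _ _) eqn:Op; rewrite SW.
  - assert (O : opposed G (me g) (ot g)).
    { apply (opposed_b_iff G bh wfG g); auto. unfold opposed_b. rewrite E. exact Op. }
    (* Phase 1 keeps Y with its leader while the X of the other group joins them. *)
    assert (L1 := OF g O). rewrite L1 in SY. simpl in SY.
    assert (O' := opposed_sym G bh wfG g _ _ (OK g) (OK (negb g)) O).
    destruct O' as (E2 & _ & E3 & _).
    destruct (OK (negb g)) as (_ & Hn2 & Nb2 & S2). rewrite E2 in S2. destruct S2 as (Pd2 & _ & _).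
    destruct (far_ok G wfG _ _ Hn2 Pd2) as (_ & F6 & _). fold (far G (ot g)) in F6.
    destruct (step_X G bh m ids t c s sw R OK (negb g) (gv (me g))) as (w1 & okX & SX);
      [rewrite E2; assumption|assumption|congruence|congruence|].
    rewrite negb_involutive in SX.
    assert (O2 : opposed_b G (ot g) (me g) = true).
    { apply (opposed_b_iff G bh wfG (negb g)); rewrite ?negb_involutive; auto.
      apply (opposed_sym G bh wfG g); auto. }
    unfold opposed_b in O2. rewrite E2, <- E3 in O2.
    assert (DX : drone_step (aview G (ot g) (me g) (gv (me g))) (xn (ot g))
                 (Dr (negb g) false (xe (ot g)) false) w1 = (Dr g false None false, Stay)).
    { unfold drone_step.
      replace (mL (aview G (ot g) (me g) (gv (me g)))) with (@None ldr).
      - cbn [dy]. rewrite O2. cbn [dg]. rewrite negb_involutive. reflexivity.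
      - rewrite E3. symmetry. apply aview_far. assumption. }
    rewrite DX in SX. cbv zeta in SX. cbn [fst snd] in SX.
    replace (iX sw (negb g)) with (iX (negb sw) g) in SX by (destruct sw, g; reflexivity).
    unfold rel_grp. cbn [gl gv ge gs xe xn ye yn yf].
    split; [exact SL'|]. rewrite SX, SY, Nb'. cbn. split; [split|]; eauto.
  - assert (SX : far G (me g) <> bh -> exists ok, ag rd (iX sw g) =
       (let r := match xe (me g) with
                | None => (Dr g false (xn (me g)) false, Stay)
                | Some i => (Dr g false (xe (me g)) false, Move i) end in
       move_one G bh m t (mkAgent (far G (me g)) true (enc_mem (MD (fst r))) (xn (me g)) ok None)
         (Some (snd r)))).
    { intro NB. destruct (step_X G bh m ids t c s sw R OK g (far G (me g))) as (w1 & okX & SX);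
        [rewrite E; reflexivity|assumption|congruence|congruence|].
      exists okX. rewrite SX. unfold drone_step. cbn [de dy dg].
      rewrite aview_far, Op by assumption. destruct (xe (me g)); reflexivity. }
    assert (DX : far G (me g) = bh -> alive (ag rd (iX sw g)) = false).
    { intro B. assert (A : alive (ag c (iX sw g)) = false).
      { destruct (R g) as [_ H]. rewrite E in H. destruct H as [[A _] _].
        rewrite A, B, Nat.eqb_refl. reflexivity. }
      rewrite (step_dead G bh m ids t c); auto using iX_lt. unfold active. rewrite A. reflexivity. }
    destruct ((lp (gl (me g)) =? 2) && pr (gv (me g)) (lt (gl (me g)))) eqn:C.
    + apply andb_prop in C. destruct C as [C1 C2]. rewrite C1, move_move, C2 in SY.
      fold (far G (me g)) in SY.
      unfold rel_grp. cbn [gl gv ge gs xe xn ye yn yf].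
      destruct (Nat.eqb_spec (far G (me g)) bh) as [B|B].
      * split; [exact SL'|]. split; [apply DX; assumption|].
        rewrite SY. reflexivity.
      * destruct (Hx B) as [X1 X2]. destruct (SX B) as (ok & SX').
        apply Nat.eqb_eq in C1. rewrite X2, C1, X1 in SX'. cbn [Nat.eqb fst snd] in SX'.
        (* Presence of the edge does not depend on the end, so X comes back in the round in which Y
           leaves. *)
        assert (A := avail_sym G m wfG vm t _ _ Hn Pd). fold (far G (me g)) in A.
        rewrite move_move, A, C2, F4, F5, Nb' in SX'. cbn [negb] in SX'.
        split; [exact SL'|]. rewrite SX', SY, Nb'. unfold far. cbn. rewrite LT.
        rewrite X2, C1, X1. cbn. split; [split|]; eauto.
    + assert (SY' : exists ok, ag rd (iY g) =
         mkAgent (gv (me g)) true (enc_mem (MD (Dr g true None false))) (yn (me g)) ok None).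
      { rewrite SY. destruct (lp (gl (me g)) =? 2).
        - rewrite move_move. simpl in C. rewrite C. eauto.
        - simpl. eauto. }
      unfold rel_grp, far. cbn [gl gv ge gs xe xn ye yn yf]. rewrite LT.
      fold (far G (me g)). split; [exact SL'|]. split; [|exact SY'].
      destruct (Nat.eqb_spec (far G (me g)) bh) as [B|B].
      * split; [apply DX; assumption|congruence].
      * destruct (Hx B) as [X1 X2]. destruct (SX B) as (ok & SX').
        rewrite X2 in *. destruct Hp as [Hp|Hp]; rewrite Hp in *;
          cbn [Nat.eqb fst snd andb] in *.
        -- rewrite SX'. split; [reflexivity|]. intros _. eexists. reflexivity.
        -- rewrite X1 in *. cbn [fst snd] in SX'.
           assert (A := avail_sym G m wfG vm t _ _ Hn Pd). fold (far G (me g)) in A.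
           rewrite move_move, A, C in SX'. rewrite SX'. split; [reflexivity|]. eauto.
Qed.

Lemma rel_grp_Back g : gs (me g) = Back ->
  rel_grp G bh rd sw_next g (gr (next G bh pr s) g).
Proof.
  intro E. destruct (OK g) as (L & Hn & Nb & S). rewrite E in S.
  destruct S as (Pd & Hp & Hx & Hy).
  destruct (far_ok G wfG _ _ Hn Pd) as (F1 & F2 & F3 & F4 & F5). fold (far G (me g)) in *.
  assert (SW : sw_next = sw).
  { unfold sw_next. rewrite <- (opposed_any g). unfold opposed_b. rewrite E. reflexivity. }
  rewrite SW. cbn [next gr]. unfold gnext. rewrite E. cbv zeta.
  destruct (step_L G bh m ids t c s sw R RW OK g) as [okL SL]; [congruence|].
  destruct (step_X G bh m ids t c s sw R OK g (gv (me g))) as (w1 & okX & SX);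
    [rewrite E; reflexivity|assumption|congruence|congruence|].
  destruct (step_Y G bh m ids t c s sw R RW OK g (far G (me g))) as (w2 & okY & W2 & SY);
    [rewrite E; reflexivity|congruence|congruence|].
  rewrite W2 in SY by auto.
  destruct (aview_Back G (me g) (ot g) E F2) as (VL & VX & VY).
  unfold drone_step in SX. rewrite VL, VY in SX. cbn [dy dg fst snd] in SX.
  unfold drone_step in SY. rewrite aview_far in SY by assumption.
  cbn [dy dg fst snd] in SY. cbv zeta in SL, SX, SY. cbn [fst snd] in SX, SY.
  rewrite (lead_Back G (me g) (ot g) (rd_wbs G s g (gv (me g))) E F2) in SL.
  cbn [fst snd] in SL.
  assert (EL : lead_l G (me g) (ot g) (rd_wbs G s g (gv (me g))) =
     take_role (aview G (me g) (ot g) (gv (me g))) (gl (me g)) 3).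
  { unfold lead_l. rewrite lead_Back; auto. }
  rewrite EL. destruct (take_role_fix (aview G (me g) (ot g) (gv (me g))) (gl (me g)) 3)
    as (T1 & T2 & T3 & _).
  simpl in SY. apply Nat.eqb_neq in Nb. apply Nat.eqb_neq in Hx.
  destruct (lp (gl (me g)) =? 3) eqn:P3.
  - rewrite move_move in SL, SX. fold (far G (me g)) in *.
    destruct (pr (gv (me g)) (lt (gl (me g)))) eqn:P; unfold rel_grp, far;
      cbn [gl gv ge gs xe xn ye yn yf andb]; rewrite ?T3; fold (far G (me g));
      rewrite SL, SX, SY, ?Nb, ?Hx; cbn [alive andb negb];
      (split; [|split; [split|]]); eauto.
  - unfold rel_grp, far; cbn [gl gv ge gs xe xn ye yn yf andb]; rewrite ?T3; fold (far G (me g));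
      rewrite SL, SX, SY, ?Nb, ?Hx; simpl;
      (split; [|split; [split|]]); eauto.
Qed.

Lemma rel_grp_end g : gs (me g) = Lost \/ gs (me g) = Done ->
  rel_grp G bh rd sw_next g (gr (next G bh pr s) g).
Proof.
  intro E.
  assert (SW : sw_next = sw).
  { unfold sw_next. rewrite <- (opposed_any g). unfold opposed_b.
    destruct E as [E|E]; rewrite E; reflexivity. }
  assert (D : alive (ag c (iX sw g)) = false /\ alive (ag c (iY g)) = false).
  { destruct (R g) as [_ H]. destruct E as [E|E]; rewrite E in H; exact H. }
  assert (D' : alive (ag rd (iX sw g)) = false /\ alive (ag rd (iY g)) = false).
  { rewrite !step_dead; auto using iX_lt, iY_lt; unfold active; destruct D as [D1 D2];
      rewrite ?D1, ?D2; reflexivity. }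
  rewrite SW. cbn [next gr]. unfold gnext. destruct E as [E|E]; rewrite E.
  - destruct (step_L G bh m ids t c s sw R RW OK g) as [okL SL]; [congruence|].
    rewrite lead_Lost in SL by assumption. simpl in SL.
    unfold rel_grp. cbn [gl gv ge gs]. rewrite SL. split; [eauto|exact D'].
  - unfold rel_grp. rewrite E. split; [|exact D']. destruct (R g) as [[ok H] _]. rewrite E in H.
    rewrite step_dead; eauto using iL_lt. unfold active. rewrite H. reflexivity.
Qed.

End RelNext.

Lemma rel_next G bh m ids t c s : wf_graph G -> valid_schedule G m ->
  rel G bh c s -> (forall g, group_ok G bh g (gr s g)) -> opposed_fresh G s ->
  rel G bh (round bhs G bh m ids t c) (next G bh (avail G m t) s).
Proof.
  intros wfG vm (sw & R & RW & RE) OK OF. exists (sw_next G s sw). split; [|split].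
  - intro g. destruct (gs (gr s g)) eqn:E.
    + apply rel_grp_All; auto.
    + apply rel_grp_Out; auto.
    + apply rel_grp_Back; auto.
    + apply rel_grp_end; auto.
    + apply rel_grp_end; auto.
  - intro v. rewrite round_board. apply (boards_end G bh ids c s sw R RW OK). unfold nagents. lia.
  - intro v. rewrite round_board.
    assert (H : forall n, boards bhs G ids c n v = [] \/
                     exists w, boards bhs G ids c n v = enc_board w); [|apply H].
    induction n as [|n IH]; [apply RE|]. simpl boards.
    destruct (active (ag c n)); [|assumption]. destruct (Nat.eqb_spec v (pos (ag c n))) as [->|]; [|assumption].
    revert IH. generalize (boards bhs G ids c n (pos (ag c n))). intros w IH.
    unfold bhs_step. destruct (mem (ag c n)) as [|x y].
    + destruct (setup _ _) as [a b]. simpl. eauto.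
    + destruct (dec_mem (x :: y)) as [l|d].
      * destruct (leader_step _ _ _ _ _) as [[l' b] a]. simpl. eauto.
      * destruct (drone_step _ _ _ _) as [d' a]. simpl. assumption.
Qed.

(** * Depth-first search *)

Fixpoint sumn (f : nat -> nat) (n : nat) : nat :=
  match n with 0 => 0 | S n => sumn f n + f n end.

Lemma sumn_le f g n : (forall z, z < n -> f z <= g z) -> sumn f n <= sumn g n.
Proof.
  intro H. induction n as [|n IH]; simpl; [lia|].
  specialize (H n) as Hn. assert (sumn f n <= sumn g n) by (apply IH; intros; apply H; lia). lia.
Qed.

Lemma sumn_ext f g n : (forall z, z < n -> f z = g z) -> sumn f n = sumn g n.
Proof.
  intro H. apply Nat.le_antisymm; apply sumn_le; intros z Hz; rewrite H by assumption; lia.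
Qed.

Lemma sumn_upd f g n v : v < n -> (forall z, z < n -> z <> v -> g z = f z) ->
  sumn g n + f v = sumn f n + g v.
Proof.
  intros Hv H. induction n as [|n IH]; simpl; [lia|].
  destruct (Nat.eq_dec v n) as [->|N].
  - rewrite (sumn_ext g f) by (intros; apply H; lia). lia.
  - rewrite (H n) by lia. assert (sumn g n + f v = sumn f n + g v); [|lia].
    apply IH; [lia|]. intros; apply H; lia.
Qed.

Lemma sumn_const k n : sumn (fun _ => k) n = n * k.
Proof. induction n; simpl; lia. Qed.

Section DFS.
Variables (G : Graph) (bh : nat).
Hypothesis wfG : wf_graph G.

Section Marks.
Variables (mk : nat -> mark) (l : nat).

(** The stack exists only in the invariant: parent ports thread it downwards, and the pointer of a
    node below the top stands at the port leading to its successor. *)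
Fixpoint stack (s : list nat) : Prop :=
  match s with
  | [] => False
  | y :: t =>
      match t with
      | [] => par (mk y) = None
      | x :: _ => (exists i, par (mk y) = Some i /\ i < deg G y /\ nb G y i = x /\
                             bp G y i = ptr (mk x)) /\ stack t
      end
  end.

(* Depth-first search with label l and stack s (top first) that has ignored the ports in sk
   and has walked only through ports in tr; if not [full], nodes may carry the label l from
   an older search. *)
Record dfs_ok (full : Prop) (sk tr : nat -> nat -> Prop) (s : list nat) : Prop := {
  dfs_dom : forall z, lab (mk z) = l -> z < gn G /\ z <> bh /\ ptr (mk z) <= deg G z;
  dfs_nodup : NoDup s;
  dfs_in : forall z, In z s -> lab (mk z) = l;
  dfs_stack : stack s;
  dfs_fin : full -> forall z, lab (mk z) = l -> ~ In z s -> ptr (mk z) = deg G z;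
  dfs_closed : forall z p, lab (mk z) = l -> p < ptr (mk z) ->
                 lab (mk (nb G z p)) = l \/ sk z p;
  dfs_tr : forall z i, lab (mk z) = l -> par (mk z) = Some i -> tr z i }.

(* [PF x p] / [PB x i]: about to leave x forwards / backwards through the given port;
   [AF y j] / [AB y j]: just arrived at y through port j, moving forwards / backwards. *)
Inductive dstate := PF (x p : nat) | PB (x i : nat) | AF (y j : nat) | AB (y j : nat).

Definition dfs_inv (full : Prop) (sk tr : nat -> nat -> Prop) (d : dstate) : Prop :=
  exists s, dfs_ok full sk tr s /\
  match d with
  | PF x p => exists t, s = x :: t /\ p = ptr (mk x) /\ p < deg G x
  | PB x i => lab (mk x) = l /\ i < deg G x /\ tr x i /\
              exists t, s = nb G x i :: t /\ bp G x i = ptr (mk (nb G x i))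
  | AF y j => y < gn G /\ j < deg G y /\ tr y j /\
              exists t, s = nb G y j :: t /\ bp G y j = ptr (mk (nb G y j))
  | AB y j => j < deg G y /\ lab (mk (nb G y j)) = l /\ exists t, s = y :: t /\ j = ptr (mk y)
  end.

Definition ready (full : Prop) (sk tr : nat -> nat -> Prop) (x : nat) : Prop :=
  exists t, dfs_ok full sk tr (x :: t).

Lemma dfs_crossF full sk tr x p : dfs_inv full sk tr (PF x p) -> tr (nb G x p) (bp G x p) ->
  dfs_inv full sk tr (AF (nb G x p) (bp G x p)).
Proof.
  intros (s & D & t & -> & Ep & Hp) T. exists (x :: t). split; [assumption|].
  destruct (dfs_dom _ _ _ _ D x) as (Hx & _); [apply (dfs_in _ _ _ _ D); left; reflexivity|].
  destruct (proj1 wfG x p Hx Hp) as (A1 & A2 & A3 & A4 & A5).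
  rewrite A4, A5. repeat split; auto. exists t. auto.
Qed.

Lemma dfs_crossB full sk tr x i : dfs_inv full sk tr (PB x i) ->
  dfs_inv full sk tr (AB (nb G x i) (bp G x i)).
Proof.
  intros (s & D & Lx & Hi & _ & t & -> & Ei). exists (nb G x i :: t). split; [assumption|].
  destruct (dfs_dom _ _ _ _ D x Lx) as (Hx & _).
  destruct (proj1 wfG x i Hx Hi) as (A1 & A2 & A3 & A4 & A5).
  rewrite A4. repeat split; auto. exists t. auto.
Qed.

Lemma dfs_bounce full sk tr y j : dfs_inv full sk tr (AF y j) -> lab (mk y) = l ->
  dfs_inv full sk tr (PB y j).
Proof. intros (s & D & _ & Hj & T & H) L. exists s. auto. Qed.

(** An exhausted top is popped with all its ports tried, as [dfs_fin] asks. If it has no parent it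
    is the whole stack, so every other node of the search is finished. *)
Lemma dfs_next full sk tr x : ready full sk tr x ->
  match nx (deg G x) (mk x) with
  | Some (true, p) => dfs_inv full sk tr (PF x p)
  | Some (false, i) => dfs_inv full sk tr (PB x i)
  | None => full -> forall z, lab (mk z) = l -> ptr (mk z) = deg G z
  end.
Proof.
  intros (t & D). unfold nx.
  assert (Lx : lab (mk x) = l) by (apply (dfs_in _ _ _ _ D); left; reflexivity).
  destruct (dfs_dom _ _ _ _ D x Lx) as (Hx & Bx & Px).
  pose proof (dfs_stack _ _ _ _ D) as S.
  destruct (Nat.ltb_spec (ptr (mk x)) (deg G x)) as [Hp|Hp].
  - exists (x :: t). split; [assumption|]. exists t. auto.
  - assert (Fx : ptr (mk x) = deg G x) by lia.
    destruct t as [|y t].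
    + simpl in S. rewrite S. intros F0 z Lz. destruct (Nat.eq_dec z x) as [->|N]; [assumption|].
      apply (dfs_fin _ _ _ _ D F0 z Lz). intros [E|[]]. congruence.
    + destruct S as [(i & Pi & Hi & N & B) S]. rewrite Pi. exists (y :: t). split.
      * destruct D as [D1 D2 D3 D4 D5 D6 D7]. inversion D2; subst. constructor; auto.
        -- intros z Hz. apply D3. right. assumption.
        -- intros F0 z Lz Nz. destruct (Nat.eq_dec z x) as [->|Nx]; [assumption|].
           apply D5; [assumption|assumption|]. intros [E|E]; [congruence|contradiction].
      * repeat split; auto. apply (dfs_tr _ _ _ _ D); assumption.
        exists t. subst y. auto.
Qed.

(* A search that runs to completion visits everything reachable without the ignored ports,
   hence the black hole: this never happens. *)
Lemma dfs_complete full sk tr x ok : ready full sk tr x ->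
  (forall z, lab (mk z) = l -> ptr (mk z) = deg G z) ->
  connected_by G ok -> bh < gn G -> (forall z p, sk z p -> ~ ok z p) -> False.
Proof.
  intros (t & D) F C B K.
  assert (Lx : lab (mk x) = l) by (apply (dfs_in _ _ _ _ D); left; reflexivity).
  destruct (dfs_dom _ _ _ _ D x Lx) as (Hx & _).
  assert (H : forall w, reach G ok x w -> lab (mk w) = l).
  { intros w Rw. induction Rw as [|w p _ IH Hp Ok]; [assumption|].
    destruct (dfs_closed _ _ _ _ D w p IH) as [?|S]; auto.
    - rewrite F; auto.
    - destruct (K _ _ S Ok). }
  apply (dfs_dom _ _ _ _ D bh); [|reflexivity]. apply H, C; assumption.
Qed.

(** An unvisited node counts one more than its degree, so that visiting it is progress too. *)
Definition rem (z : nat) : nat :=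
  if lab (mk z) =? l then deg G z - ptr (mk z) else S (deg G z).
(** Bouncing off a visited node changes no mark; it is paid for by the direction bit, which weighs
    less than one unit of [rem]. *)
Definition mu (md : bool) : nat := 4 * sumn rem (gn G) + Nat.b2n md.

End Marks.

Lemma stack_change mk mk' s : (forall z, In z s -> mk' z = mk z) -> stack mk s -> stack mk' s.
Proof.
  induction s as [|y s IH]; [auto|]. intros H.
  destruct s as [|x s]; simpl.
  - rewrite H by (left; reflexivity). auto.
  - intros [(i & E) S]. split; [exists i|].
    + rewrite !H by (simpl; auto). assumption.
    + apply IH; [|assumption]. intros z Hz. apply H. right. assumption.
Qed.

Section Update.
Variables (mk mk' : nat -> mark) (l v : nat) (full : Prop) (sk tr : nat -> nat -> Prop).
Hypothesis other : forall z, z <> v -> mk' z = mk z.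

Lemma dfs_enter j : dfs_inv mk l full sk tr (AF v j) -> v <> bh -> lab (mk v) <> l ->
  mk' v = Mk l (Some j) 0 -> ready mk' l full sk tr v.
Proof.
  intros (s & D & Hv & Hj & T & t & -> & Ej) Nb Lv E.
  set (x := nb G v j) in *.
  destruct D as [D1 D2 D3 D4 D5 D6 D7].
  assert (Nin : ~ In v (x :: t)) by (intro I; apply Lv, D3, I).
  assert (Keep : forall z, lab (mk z) = l -> mk' z = mk z) by (intros z Hz; apply other; congruence).
  assert (Lab : forall z, lab (mk z) = l -> lab (mk' z) = l) by (intros z Hz; rewrite Keep; auto).
  exists (x :: t). constructor.
  - intros z Lz. destruct (Nat.eq_dec z v) as [->|N].
    + rewrite E. simpl. repeat split; auto; lia.
    + rewrite other in * by assumption. auto.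
  - constructor; assumption.
  - intros z [<-|Hz]; [rewrite E; reflexivity|]. auto.
  - assert (S : stack mk' (x :: t)) by
      (apply (stack_change mk); [intros z Hz; apply Keep; auto|assumption]).
    split; [|exact S]. exists j. rewrite E, (Keep x) by (apply D3; left; reflexivity). auto.
  - intros F0 z Lz Nz. destruct (Nat.eq_dec z v) as [->|N]; [exfalso; apply Nz; left; reflexivity|].
    rewrite other in * by assumption. apply D5; [assumption|assumption|].
    intro I. apply Nz. right. assumption.
  - intros z p Lz Hp. destruct (Nat.eq_dec z v) as [->|N].
    + rewrite E in Hp. simpl in Hp. lia.
    + rewrite (other z) in * by assumption. destruct (D6 z p Lz Hp); auto.
  - intros z i Lz Hi. destruct (Nat.eq_dec z v) as [->|N].
    + rewrite E in Hi. simpl in Hi. injection Hi as <-. assumption.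
    + rewrite other in * by assumption. auto.
Qed.

(** Shared by a return from a port, whose far node carries the label, and by giving a port up: these
    are the two alternatives of [dfs_closed]. *)
Lemma ready_advance t : dfs_ok mk l full sk tr (v :: t) -> ptr (mk v) < deg G v ->
  lab (mk (nb G v (ptr (mk v)))) = l \/ sk v (ptr (mk v)) ->
  mk' v = advance (deg G v) (mk v) -> ready mk' l full sk tr v.
Proof.
  intros [D1 D2 D3 D4 D5 D6 D7] Hp C E. inversion D2 as [|? ? Nin ND]; subst.
  unfold advance in E. rewrite (proj2 (Nat.ltb_lt _ _) Hp) in E.
  assert (EL : forall z, lab (mk' z) = lab (mk z)).
  { intro z. destruct (Nat.eq_dec z v) as [->|N]; [rewrite E|rewrite other]; auto. }
  exists t. constructor; auto.
  - intros z. rewrite EL. intro Lz. destruct (D1 z Lz) as (A1 & A2 & A3).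
    destruct (Nat.eq_dec z v) as [->|N]; [rewrite E|rewrite other]; auto.
  - intros z. rewrite EL. auto.
  - destruct t as [|x t].
    + simpl in *. rewrite E. assumption.
    + destruct D4 as [(i & A) S]. split.
      * exists i. rewrite E, (other x) by (intros ->; apply Nin; left; reflexivity). exact A.
      * apply (stack_change mk); [|assumption]. intros z Hz. apply other.
        intros ->. contradiction.
  - intros F0 z Lz Nz. assert (z <> v) by (intros ->; apply Nz; left; reflexivity).
    rewrite other in * by assumption. auto.
  - intros z p. rewrite !EL. intros Lz Hq. destruct (Nat.eq_dec z v) as [->|N].
    + rewrite E in Hq. simpl in Hq.
      destruct (Nat.eq_dec p (ptr (mk v))) as [->|]; [assumption|]. apply D6; [assumption|lia].
    + rewrite other in Hq by assumption. auto.
  - intros z i. rewrite EL. intros Lz Hi. destruct (Nat.eq_dec z v) as [->|N].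
    + rewrite E in Hi. auto.
    + rewrite other in Hi by assumption. auto.
Qed.

Lemma dfs_return j : dfs_inv mk l full sk tr (AB v j) -> mk' v = advance (deg G v) (mk v) ->
  ready mk' l full sk tr v.
Proof.
  intros (s & D & Hj & Lj & t & -> & ->) E. apply (ready_advance t); auto.
Qed.

Lemma dfs_skip p : dfs_inv mk l full sk tr (PF v p) -> sk v p ->
  mk' v = advance (deg G v) (mk v) -> ready mk' l full sk tr v.
Proof.
  intros (s & D & t & -> & -> & Hp) S E. apply (ready_advance t); auto.
Qed.

Lemma mu_advance md md' : v < gn G -> lab (mk v) = l -> ptr (mk v) < deg G v ->
  mk' v = advance (deg G v) (mk v) -> mu mk' l md' < mu mk l md.
Proof.
  intros Hv Lv Hp E. unfold mu.
  assert (sumn (rem mk' l) (gn G) + rem mk l v = sumn (rem mk l) (gn G) + rem mk' l v).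
  { apply sumn_upd; auto. intros z _ N. unfold rem. rewrite other by assumption. reflexivity. }
  assert (rem mk' l v + 1 = rem mk l v).
  { unfold rem. rewrite E. unfold advance. rewrite (proj2 (Nat.ltb_lt _ _) Hp). simpl.
    rewrite Lv, Nat.eqb_refl. lia. }
  destruct md, md'; simpl Nat.b2n; lia.
Qed.

Lemma mu_enter o md md' : v < gn G -> lab (mk v) <> l ->
  mk' v = Mk l o 0 -> mu mk' l md' < mu mk l md.
Proof.
  intros Hv Lv E. unfold mu.
  assert (sumn (rem mk' l) (gn G) + rem mk l v = sumn (rem mk l) (gn G) + rem mk' l v).
  { apply sumn_upd; auto. intros z _ N. unfold rem. rewrite other by assumption. reflexivity. }
  assert (rem mk' l v + 1 = rem mk l v).
  { unfold rem. rewrite E. simpl. rewrite Nat.eqb_refl.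
    apply Nat.eqb_neq in Lv. rewrite Lv. lia. }
  destruct md, md'; simpl Nat.b2n; lia.
Qed.

End Update.

Lemma ready_new mk l v full sk tr : v < gn G -> v <> bh -> mk v = Mk l None 0 ->
  (forall z, z <> v -> lab (mk z) <> l) -> ready mk l full sk tr v.
Proof.
  intros Hv Nb E O. exists [].
  assert (U : forall z, lab (mk z) = l -> z = v).
  { intros z Lz. destruct (Nat.eq_dec z v); [assumption|]. destruct (O z); assumption. }
  constructor.
  - intros z Lz. apply U in Lz as ->. rewrite E. simpl. repeat split; auto; lia.
  - repeat constructor. intros [].
  - intros z [<-|[]]. rewrite E. reflexivity.
  - simpl. rewrite E. reflexivity.
  - intros _ z Lz Nz. apply U in Lz as ->. exfalso. apply Nz. left. reflexivity.
  - intros z p Lz Hp. apply U in Lz as ->. rewrite E in Hp. simpl in Hp. lia.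
  - intros z i Lz Hi. apply U in Lz as ->. rewrite E in Hi. discriminate.
Qed.

(** If older nodes carry the label, the run may miss parts of the graph; with [full] false and every
    port skippable, enough remains to walk and to decrease [mu]. *)
Lemma ready_new_weak mk l v : v < gn G -> v <> bh -> mk v = Mk l None 0 ->
  (forall z, lab (mk z) = l -> z < gn G /\ z <> bh /\ ptr (mk z) <= deg G z) ->
  ready mk l False (fun _ _ => True) (fun _ _ => True) v.
Proof.
  intros Hv Nb E O. exists []. constructor; auto.
  - repeat constructor. intros [].
  - intros z [<-|[]]. rewrite E. reflexivity.
  - simpl. rewrite E. reflexivity.
  - intros [].
Qed.

Lemma mu_bound mk l md : mu mk l md <= 4 * (sumn (deg G) (gn G) + gn G) + 1.
Proof.
  unfold mu. assert (sumn (rem mk l) (gn G) <= sumn (fun z => S (deg G z)) (gn G)).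
  { apply sumn_le. intros z _. unfold rem. destruct (_ =? _); lia. }
  assert (forall n, sumn (fun z => S (deg G z)) n = sumn (deg G) n + n) as E
    by (induction n; simpl; lia).
  rewrite E in H. destruct md; simpl Nat.b2n; lia.
Qed.

End DFS.

(** * The joint invariant *)

Section Joint.
Variables (G : Graph) (bh : nat).
Hypothesis wfG : wf_graph G.

Definition sep (g : grp) : Prop := gs g = Out \/ gs g = Back.
Definition live (g : grp) : Prop := gs g <> Lost /\ gs g <> Done.
Definition near (g : grp) : nat := bp G (gv g) (lt (gl g)).
Definition on_edge (g : grp) (v p : nat) : Prop :=
  (gv g = v /\ lt (gl g) = p) \/ (far G g = v /\ near g = p).
(** The lone scout has just crossed and its entry port is not visible yet; in [posted] it is. *)
Definition idle (g : grp) : Prop :=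
  (gs g = Out /\ lp (gl g) = 1) \/ (gs g = Back /\ lp (gl g) = 2).
Definition posted (g : grp) : Prop :=
  (gs g = Out /\ lp (gl g) = 2) \/ (gs g = Back /\ lp (gl g) = 3).
Definition whole (g : grp) (v : nat) : Prop := gs g = All /\ gv g = v.
Definition back_ok (g : grp) : Prop :=
  gs g = Back -> ye g = if lp (gl g) =? 2 then None else yn g.

(** Leader ports and published entry ports, together with the invariants of the other group, locate
    that group exactly. The one ambiguous case, an unpublished lone scout, is absorbed by [Wait]. *)
Lemma judge_spec g me ot v l : v <> bh -> group_ok G bh g ot -> live ot -> back_ok ot ->
  match judge (aview G me ot v) l with
  | Wait => (idle ot /\ far G ot = v) \/ (lr l = false /\ whole ot v /\ lp (gl ot) = 3)
  | Give => lr l = false /\ (lp l <> 0 \/ (sep ot /\ on_edge ot v (lt l)) \/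
              (whole ot v /\ lp (gl ot) <> 3 /\ lt (gl ot) = lt l))
  | SwapP => lr l = true /\ sep ot /\ gv ot = v /\ lt (gl ot) = lt l
  | SwapL => lr l = true /\ posted ot /\ far G ot = v /\ near ot = lt l
  | Try => ~ (sep ot /\ on_edge ot v (lt l)) /\ ~ (idle ot /\ far G ot = v) /\
           (lr l = false -> lp l = 0 /\ ~ (whole ot v /\ (lp (gl ot) = 3 \/ lt (gl ot) = lt l)))
  end.
Proof.
  intros Nb (_ & Hn & Nv & S) (L1 & L2) B.
  unfold judge, fresh, pairon, loneon, unsepon, arriving, lone_here, trio, aview, xat, yat,
    idle, posted, sep, on_edge, whole, near, back_ok in *. simpl.
  destruct (gs ot) eqn:E; try congruence.
  - destruct (Nat.eqb_spec (gv ot) v); simpl.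
    + destruct (lr l); simpl.
      * rewrite andb_false_r. split; [|split]; try (intros [[?|?] _]; discriminate); try discriminate.
        intros [[[? _]|[? _]] _]; discriminate.
      * destruct (Nat.eqb_spec (lp (gl ot)) 3); simpl; [right; auto|].
        rewrite andb_false_r, andb_true_r, !orb_false_r.
        destruct (Nat.eqb_spec (lp l) 0); simpl; [|auto].
        rewrite andb_true_r.
        destruct (Nat.eqb_spec (lt (gl ot)) (lt l)); simpl.
        -- split; [reflexivity|]. right. right. auto.
        -- split; [|split]; [intros [[?|?] _]; discriminate|
             intros [[[? _]|[? _]] _]; discriminate|]. intros _. split; [assumption|].
           intros [_ [?|?]]; congruence.
    + destruct (lr l); simpl.
      * split; [|split]; try (intros [[?|?] _]; discriminate); try discriminate.
        intros [[[? _]|[? _]] _]; discriminate.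
      * rewrite !orb_false_r. destruct (Nat.eqb_spec (lp l) 0); simpl; [|auto].
        split; [|split]; [intros [[?|?] _]; discriminate|
             intros [[[? _]|[? _]] _]; discriminate|]. intros _. split; [assumption|].
        intros [[_ ?] _]. congruence.
  - destruct S as (Pd & Hp & Hx). destruct (far_ok G wfG _ _ Hn Pd) as (_ & F2 & _).
    fold (far G ot) in *.
    destruct (Nat.eqb_spec (gv ot) v) as [Ev|Ev]; simpl.
    + destruct (Nat.eqb_spec (far G ot) v); [congruence|]. simpl. rewrite andb_true_r.
      destruct (lr l); simpl; destruct (Nat.eqb_spec (lt (gl ot)) (lt l)); simpl;
        rewrite ?orb_true_r, ?orb_false_r, ?andb_false_r; simpl; auto 10;
        [|destruct (Nat.eqb_spec (lp l) 0); simpl; [|auto]];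
        (split; [|split]; [intros [_ [[_ ?]|[? _]]]; congruence|intros [_ ?]; congruence|]);
        try discriminate; intros _; split; auto; intros [[? _] _]; discriminate.
    + destruct (Nat.eqb_spec (far G ot) v) as [Ef|Ef]; simpl.
      * rewrite Ef in Hx. destruct (Hx Nb) as [X1 X2]. rewrite X2.
        destruct Hp as [Hp|Hp]; rewrite Hp; simpl; [left; auto|].
        rewrite X1. simpl.
        destruct (Nat.eqb_spec (bp G (gv ot) (lt (gl ot))) (lt l)); simpl;
        destruct (lr l); simpl; rewrite ?orb_true_r; simpl; auto 10;
        [|destruct (Nat.eqb_spec (lp l) 0); simpl; [|auto]];
        (split; [|split]; [intros [_ [[? _]|[_ ?]]]; congruence|
           intros [[[_ ?]|[? _]] _]; congruence|]);
        try discriminate; intros _; split; auto; intros [[? _] _]; discriminate.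
      * destruct (lr l); simpl; [|destruct (Nat.eqb_spec (lp l) 0); simpl; [|auto]];
        (split; [|split]; [intros [_ [[? _]|[? _]]]; congruence|intros [_ ?]; congruence|]);
        try discriminate; intros _; split; auto; intros [[? _] _]; discriminate.
  - destruct S as (Pd & Hp & Hx & Hy). destruct (far_ok G wfG _ _ Hn Pd) as (_ & F2 & _).
    fold (far G ot) in *. specialize (B eq_refl).
    destruct (Nat.eqb_spec (gv ot) v) as [Ev|Ev]; simpl.
    + destruct (Nat.eqb_spec (far G ot) v); [congruence|]. simpl. rewrite andb_true_r.
      destruct (lr l); simpl; destruct (Nat.eqb_spec (lt (gl ot)) (lt l)); simpl;
        rewrite ?orb_true_r, ?orb_false_r, ?andb_false_r; simpl; auto 10;
        [|destruct (Nat.eqb_spec (lp l) 0); simpl; [|auto]];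
        (split; [|split]; [intros [_ [[_ ?]|[? _]]]; congruence|intros [_ ?]; congruence|]);
        try discriminate; intros _; split; auto; intros [[? _] _]; discriminate.
    + destruct (Nat.eqb_spec (far G ot) v) as [Ef|Ef]; simpl.
      * rewrite B.
        destruct Hp as [Hp|Hp]; rewrite Hp; simpl; [left; auto|].
        rewrite Hy. simpl.
        destruct (Nat.eqb_spec (bp G (gv ot) (lt (gl ot))) (lt l)); simpl;
        destruct (lr l); simpl; rewrite ?orb_true_r; simpl; auto 10;
        [|destruct (Nat.eqb_spec (lp l) 0); simpl; [|auto]];
        (split; [|split]; [intros [_ [[? _]|[_ ?]]]; congruence|
           intros [[[? _]|[_ ?]] _]; congruence|]);
        try discriminate; intros _; split; auto; intros [[? _] _]; discriminate.
      * destruct (lr l); simpl; [|destruct (Nat.eqb_spec (lp l) 0); simpl; [|auto]];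
        (split; [|split]; [intros [_ [[? _]|[? _]]]; congruence|intros [_ ?]; congruence|]);
        try discriminate; intros _; split; auto; intros [[? _] _]; discriminate.
Qed.

Lemma worker_on_spec g me ot v p : group_ok G bh g ot -> live ot ->
  worker_on (aview G me ot v) (Some p) = true <->
  lr (gl ot) = true /\ whole ot v /\ lp (gl ot) <> 3 /\ lt (gl ot) = p.
Proof.
  intros (_ & Hn & _ & S) (L1 & L2). unfold worker_on, trio, aview, xat, yat, whole. simpl.
  destruct (Nat.eqb_spec (gv ot) v) as [E|E]; simpl; [|split; [discriminate|tauto]].
  rewrite !andb_true_iff, negb_true_iff, Nat.eqb_neq, Nat.eqb_eq.
  destruct (gs ot) eqn:Es; try congruence; rewrite ?E, ?Nat.eqb_refl.
  - intuition congruence.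
  - destruct S as (Pd & _). destruct (far_ok G wfG _ _ Hn Pd) as (_ & F2 & _).
    fold (far G ot) in F2. rewrite E in F2. apply Nat.eqb_neq in F2. rewrite F2.
    intuition congruence.
  - destruct S as (Pd & _). destruct (far_ok G wfG _ _ Hn Pd) as (_ & F2 & _).
    fold (far G ot) in F2. rewrite E in F2. apply Nat.eqb_neq in F2. rewrite F2.
    intuition congruence.
Qed.

Lemma take_role_id V l p : (lr l = false -> worker_on V (Some (lt l)) = false) ->
  take_role V l p = Ld (lg l) (lr l) (lm l) p (lt l) (ll l) (lc l).
Proof.
  intro H. unfold take_role. destruct (oL V); [|reflexivity].
  destruct (lr l); simpl; [reflexivity|]. rewrite H by reflexivity. reflexivity.
Qed.

End Joint.

(** * Independence of the whiteboard fields of the two groups *)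

Section Frame.
Variable G : Graph.

Lemma mR_set_same g w m : mR g (set_mR g w m) = m.
Proof. destruct g; reflexivity. Qed.
Lemma mR_set_other' g w m : mR g (set_mR (negb g) w m) = mR g w.
Proof. destruct g; reflexivity. Qed.
Lemma mW_set g w m : mW (set_mR g w m) = mW w.
Proof. destruct g; reflexivity. Qed.
Lemma nt_set g w m : nt (set_mR g w m) = nt w.
Proof. destruct g; reflexivity. Qed.
Lemma set_set g w m m' : set_mR g (set_mR g w m) m' = set_mR g w m'.
Proof. destruct g; reflexivity. Qed.
Lemma lead_other me ot w m : let g := lg (gl me) in
  lead_l G me ot (set_mR (negb g) w m) = lead_l G me ot w /\
  lead_w G me ot (set_mR (negb g) w m) = set_mR (negb g) (lead_w G me ot w) m.
Proof.
  cbv zeta. unfold lead_l, lead_w, lead, leader_step. destruct me as [[g r md p t lb c] v e s x1 x2 y1 y2 f].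
  cbn [gl gv ge lg lp lt lr lm ll lc].
  destruct (mX _); [|destruct (mY _); auto]. destruct (mY _); [|auto].
  destruct (p =? 3).
  - unfold arrive, cur_mark, cur_lab, proceed, new_run, set_mark, nx.
    cbn [gl gv ge lg lp lt lr lm ll lc].
    destruct (mF _); [destruct g; auto|].
    destruct r; cbn; destruct md;
    destruct g; cbn;
    repeat match goal with |- context [if ?b then _ else _] => destruct b; cbn; auto
      | |- context [match ?b with Some _ => _ | None => _ end] => destruct b; cbn; auto end; try (split; reflexivity).
  - destruct (judge _ _); cbn; auto; try (destruct g; cbn; auto; fail).
    unfold abandon, cur_mark, cur_lab, proceed, new_run, set_mark, nx.
    cbn [gl gv ge lg lp lt lr lm ll lc].
    destruct r; cbn; destruct md;
    destruct g; cbn;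
    repeat match goal with |- context [if ?b then _ else _] => destruct b; cbn; auto
      | |- context [match ?b with Some _ => _ | None => _ end] => destruct b; cbn; auto end; try (split; reflexivity).
Qed.

(** A runner without a flag works on its own field only: it touches neither the note nor the mark of
    the worker. *)
Lemma lead_runner g me ot w : lg (gl me) = g -> lr (gl me) = false -> yf me = false ->
  (forall w2, mR g w2 = mR g w ->
     lead_l G me ot w2 = lead_l G me ot w /\ mR g (lead_w G me ot w2) = mR g (lead_w G me ot w)) /\
  lead_w G me ot w = set_mR g w (mR g (lead_w G me ot w)).
Proof.
  intros <- Hr Hf.
  assert (F : mF (aview G me ot (gv me)) = false) by (simpl; rewrite Hf, andb_false_r; reflexivity).
  unfold lead_l, lead_w, lead, leader_step. rewrite F.
  destruct me as [[g r md p t lb c] v e s x1 x2 y1 y2 f].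
  cbn [gl gv ge lg lp lt lr lm ll lc] in *. subst r.
  assert (Id : w = set_mR g w (mR g w)) by (destruct w, g; reflexivity).
  destruct (mX _); [|destruct (mY _); cbn; auto]. destruct (mY _); [|cbn; auto].
  destruct (p =? 3).
  - unfold arrive, cur_mark, cur_lab, proceed, new_run, set_mark, nx.
    cbn [gl gv ge lg lp lt lr lm ll lc].
    split; [intros w2 Hw; rewrite ?Hw|];
    repeat match goal with |- context [if ?b then _ else _] => destruct b; cbn; auto
      | |- context [match ?b with Some _ => _ | None => _ end] => destruct b; cbn; auto end;
    rewrite ?mR_set_same, ?set_set, ?mR_set_same, ?Hw; auto.
  - unfold judge; cbn [lr]. destruct (fresh _); [cbn; auto|]. destruct (arriving _); [cbn; auto|].
    destruct (_ || _); [|cbn; auto].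
    unfold abandon, cur_mark, cur_lab, proceed, new_run, set_mark, nx.
    cbn [gl gv ge lg lp lt lr lm ll lc].
    split; [intros w2 Hw; rewrite ?Hw|];
    repeat match goal with |- context [if ?b then _ else _] => destruct b; cbn; auto
      | |- context [match ?b with Some _ => _ | None => _ end] => destruct b; cbn; auto end;
    rewrite ?mR_set_same, ?set_set, ?mR_set_same, ?Hw; auto.
Qed.

End Frame.

(** * The next shape of a group *)

Section Moves.
Variables (G : Graph) (bh : nat) (pr : nat -> nat -> bool).
Hypothesis wfG : wf_graph G.

Notation gnx := (gnext G bh pr).

Lemma next_All me ot b by_ : gs me = All -> (lp (gl me) = 3 -> xn me = ge me) ->
  let me' := gnx me ot b by_ in
  gl me' = lead_l G me ot b /\ gv me' = gv me /\ ge me' = ge me /\ yf me' = false /\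
  match try_port (aview G me ot (gv me)) (gl me) (ge me) with
  | Some q => gs me' = (if pr (gv me) q then Out else All) /\ lt (gl me') = q /\ lp (gl me') = 1
  | None => gs me' = All
  end.
Proof.
  intros E X me'. subst me'. unfold gnext. rewrite E.
  assert (T : try_port (aview G me ot (gv me)) (gl me) (xn me) =
              try_port (aview G me ot (gv me)) (gl me) (ge me)).
  { unfold try_port. destruct (Nat.eqb_spec (lp (gl me)) 3); [rewrite X|]; auto. }
  rewrite <- T. destruct (try_port _ _ _) as [q|] eqn:Q.
  - destruct (lead_try G me ot b q E X Q) as [T1 T2].
    destruct (pr (gv me) q); simpl; auto 10.
  - simpl. auto.
Qed.

Lemma next_Out me ot b by_ : gs me = Out -> far G me <> gv me ->
  (lr (gl me) = false -> worker_on (aview G me ot (gv me)) (Some (lt (gl me))) = false) ->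
  let me' := gnx me ot b by_ in
  gl me' = Ld (lg (gl me)) (lr (gl me)) (lm (gl me)) 2 (lt (gl me)) (ll (gl me)) (lc (gl me)) /\
  gv me' = gv me /\ yf me' = false /\ ye me' = None /\
  gs me' = (if opposed_b G me ot then All else
            if (lp (gl me) =? 2) && pr (gv me) (lt (gl me))
            then if far G me =? bh then Lost else Back else Out).
Proof.
  intros E F T me'. subst me'. unfold gnext, opposed_b. rewrite E. unfold lead_l.
  rewrite lead_Out by assumption. simpl fst. rewrite take_role_id by assumption.
  destruct (opposite _ _); simpl; auto. destruct (_ && _); simpl; auto.
Qed.

Lemma next_Back me ot b by_ : gs me = Back -> far G me <> gv me ->
  (lr (gl me) = false -> worker_on (aview G me ot (gv me)) (Some (lt (gl me))) = false) ->
  let me' := gnx me ot b by_ in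
  gl me' = Ld (lg (gl me)) (lr (gl me)) (lm (gl me)) 3 (lt (gl me)) (ll (gl me)) (lc (gl me)) /\
  yf me' = flagged (aview G me ot (far G me)) (ye me) (yn me) by_ /\
  ye me' = yn me' /\
  if (lp (gl me) =? 3) && pr (gv me) (lt (gl me))
  then gs me' = All /\ gv me' = far G me /\ ge me' = Some (near G me)
  else gs me' = Back /\ gv me' = gv me.
Proof.
  intros E F T me'. subst me'. unfold gnext. rewrite E. unfold lead_l.
  rewrite lead_Back by assumption. simpl fst. rewrite take_role_id by assumption.
  destruct (_ && _); simpl; auto 10.
Qed.

Lemma gnext_cong me ot b b2 by_ : lead_l G me ot b = lead_l G me ot b2 ->
  gnx me ot b by_ = gnx me ot b2 by_.
Proof. intro E. unfold gnext. rewrite E. reflexivity. Qed.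

Lemma back_ok_next g me ot b by_ : group_ok G bh g me -> live me -> back_ok (gnx me ot b by_).
Proof.
  intros (_ & Hn & _ & S) (L1 & L2). unfold back_ok, gnext.
  destruct (gs me) eqn:E; try congruence.
  - destruct (try_port _ _ _); [destruct (pr _ _)|]; simpl; discriminate.
  - destruct S as (Pd & _). destruct (far_ok G wfG _ _ Hn Pd) as (_ & F2 & _).
    unfold lead_l. rewrite lead_Out by assumption. simpl.
    destruct (opposite _ _); simpl; [discriminate|].
    destruct (_ && _); simpl; [|discriminate].
    destruct (_ =? bh); simpl; [discriminate|]. intros _.
    destruct (take_role_fix (aview G me ot (gv me)) (gl me) 2) as (_ & T & _). rewrite T.
    reflexivity.
  - destruct S as (Pd & _). destruct (far_ok G wfG _ _ Hn Pd) as (_ & F2 & _).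
    unfold lead_l. rewrite lead_Back by assumption. simpl.
    destruct (_ && _); simpl; [discriminate|]. intros _.
    destruct (take_role_fix (aview G me ot (gv me)) (gl me) 3) as (_ & T & _). rewrite T.
    reflexivity.
Qed.

End Moves.

(** * Eliminating the order of access within a round *)

Section Boards.
Variables (G : Graph) (bh : nat) (pr : nat -> nat -> bool) (s : state) (w : bool).
Notation W := (gr s w).
Notation R := (gr s (negb w)).
Hypothesis LW : gs W <> Done.
Hypothesis LR : gs R <> Done.
Hypothesis gW : lg (gl W) = w.
Hypothesis gR : lg (gl R) = negb w.
Hypothesis rR : lr (gl R) = false.
Hypothesis fR : yf R = false.

Lemma lead_upd_live me ot B v : gs me <> Done ->
  lead_upd G me ot B v = if v =? gv me then lead_w G me ot (B (gv me)) else B v.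
Proof. unfold lead_upd, upd. destruct (gs me); congruence. Qed.

Lemma lead_W_frame b b2 : (forall m, mR (negb w) b2 = m -> b2 = set_mR (negb w) b m) ->
  lead_l G W R b2 = lead_l G W R b /\
  lead_w G W R b2 = set_mR (negb w) (lead_w G W R b) (mR (negb w) b2).
Proof.
  intro E. rewrite (E _ eq_refl) at 1 2. pose proof (lead_other G W R b (mR (negb w) b2)) as H.
  cbv zeta in H. rewrite gW in H. exact H.
Qed.

Lemma lead_w_W_other b : mR (negb w) (lead_w G W R b) = mR (negb w) b.
Proof.
  assert (b = set_mR (negb w) b (mR (negb w) b)) as E by (destruct b, w; reflexivity).
  destruct (lead_W_frame b b) as [_ H].
  - intros m <-. exact E.
  - rewrite H. apply mR_set_same.
Qed.

Lemma lead_w_R b : lead_w G R W b = set_mR (negb w) b (mR (negb w) (lead_w G R W b)).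
Proof. apply (lead_runner G (negb w)); assumption. Qed.

(** What the earlier leader wrote lies in fields that do not influence the later one, so both may be
    taken to act on the boards of the start of the round. *)
Lemma read_W : lead_l G W R (rd_wbs G s w (gv W)) = lead_l G W R (wbs s (gv W)).
Proof.
  pose proof lead_W_frame as F. pose proof lead_w_R as HR.
  unfold rd_wbs, mid_wbs. destruct w; [|reflexivity]. simpl negb in *. cbv iota.
  rewrite lead_upd_live by assumption.
  destruct (Nat.eqb_spec (gv (gr s true)) (gv (gr s false))) as [E|E]; [|reflexivity].
  rewrite <- E. apply F. intros m <-. apply HR.
Qed.

Lemma read_R : lead_l G R W (rd_wbs G s (negb w) (gv R)) = lead_l G R W (wbs s (gv R)).
Proof.
  pose proof lead_w_W_other as K. pose proof (fun b => lead_runner G (negb w) R W b gR rR fR) as H.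
  unfold rd_wbs, mid_wbs. destruct w; [reflexivity|]. simpl negb in *. cbn [negb]. cbv iota.
  rewrite lead_upd_live by assumption.
  destruct (Nat.eqb_spec (gv (gr s true)) (gv (gr s false))) as [E|E]; [|reflexivity].
  rewrite <- E. apply H. apply K.
Qed.

Notation B' := (wbs (next G bh pr s)).

Lemma board_R z : mR (negb w) (B' z) =
  if z =? gv R then mR (negb w) (lead_w G R W (wbs s z)) else mR (negb w) (wbs s z).
Proof.
  pose proof lead_w_W_other as K. pose proof (fun b => lead_runner G (negb w) R W b gR rR fR) as H.
  unfold next, mid_wbs. cbn [wbs]. destruct w; simpl negb in *;
    rewrite !lead_upd_live by assumption.
  - destruct (Nat.eqb_spec z (gv (gr s true))) as [E|E].
    + rewrite K, ?lead_upd_live by assumption. rewrite <- E.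
      destruct (Nat.eqb_spec z (gv (gr s false))) as [E2|E2]; [rewrite <- E2|]; reflexivity.
    + destruct (Nat.eqb_spec z (gv (gr s false))) as [E2|E2]; [rewrite <- E2|]; reflexivity.
  - destruct (Nat.eqb_spec z (gv (gr s true))) as [E|E].
    + rewrite <- E. apply H. rewrite ?lead_upd_live by assumption.
      destruct (Nat.eqb_spec z (gv (gr s false))) as [E2|E2]; [rewrite <- E2; apply K|reflexivity].
    + destruct (Nat.eqb_spec z (gv (gr s false))) as [E2|E2]; [rewrite <- E2; apply K|reflexivity].
Qed.

Lemma board_W z : exists m, B' z =
  set_mR (negb w) (if z =? gv W then lead_w G W R (wbs s z) else wbs s z) m.
Proof.
  pose proof lead_W_frame as F. pose proof lead_w_R as HR.
  unfold next, mid_wbs. cbn [wbs].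
  assert (Id : forall b, b = set_mR (negb w) b (mR (negb w) b)) by (intros []; destruct w; reflexivity).
  destruct w; simpl negb in *; rewrite !lead_upd_live by assumption.
  - assert (M : exists m, lead_upd G (gr s false) (gr s true) (wbs s) z = set_mR false (wbs s z) m).
    { rewrite lead_upd_live by assumption.
      destruct (Nat.eqb_spec z (gv (gr s false))) as [E2|E2]; [rewrite <- E2|]; eauto. }
    rewrite lead_upd_live in M by assumption.
    destruct (Nat.eqb_spec z (gv (gr s true))) as [E|E]; [|exact M].
    destruct M as [m M]. rewrite <- E, ?lead_upd_live, M by assumption.
    destruct (F (wbs s z) (set_mR false (wbs s z) m)) as [_ K]; [|rewrite K; eauto].
    intros m' <-. destruct (wbs s z); reflexivity.
  - assert (M : (if z =? gv (gr s false)
                 then lead_w G (gr s false) (gr s true) (wbs s (gv (gr s false))) else wbs s z) =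
      if z =? gv (gr s false) then lead_w G (gr s false) (gr s true) (wbs s z) else wbs s z).
    { destruct (Nat.eqb_spec z (gv (gr s false))) as [E2|E2]; [rewrite <- E2|]; reflexivity. }
    destruct (Nat.eqb_spec z (gv (gr s true))) as [E|E].
    + rewrite <- E, ?lead_upd_live, M by assumption. rewrite HR. eauto.
    + rewrite M. eauto.
Qed.

(** The note is where the order of access shows: a lone Y sees a note of the current round only if
    the writer belongs to group [false]. *)
Lemma mid_nt z : nt (mid_wbs G s z) = nt (wbs s z) \/
  (z = gv W /\ nt (mid_wbs G s z) = nt (lead_w G W R (wbs s z))).
Proof.
  pose proof lead_w_R as HR.
  unfold mid_wbs. destruct w; simpl negb in *; rewrite lead_upd_live by assumption.
  - destruct (Nat.eqb_spec z (gv (gr s false))) as [E2|E2]; [rewrite <- E2|auto].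
    rewrite HR. left. apply nt_set.
  - destruct (Nat.eqb_spec z (gv (gr s false))) as [E2|E2]; [rewrite <- E2|auto]. auto.
Qed.

End Boards.

(** * Outcomes of the turn of a leader *)

Section Lead.
Variables (G : Graph).

Lemma proceed_lr d l w m : lr (fst (proceed d l w m)) = lr l /\
  (lp (fst (proceed d l w m)) = lp l \/ lp (fst (proceed d l w m)) = 0) /\
  nt (snd (proceed d l w m)) = nt w.
Proof.
  unfold proceed, set_mark, new_run. destruct (nx d m); [|destruct (lr l) eqn:E]; simpl;
    rewrite ?nt_set; repeat split; auto; destruct (lr l); simpl; rewrite ?nt_set; auto.
Qed.

Lemma lead_plain me ot w : gs me = All -> (lp (gl me) = 3 -> yf me = false) ->
  (lp (gl me) <> 3 -> judge (aview G me ot (gv me)) (gl me) <> SwapP) ->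
  (lp (gl me) <> 3 -> judge (aview G me ot (gv me)) (gl me) <> SwapL) ->
  lr (lead_l G me ot w) = lr (gl me) /\ nt (lead_w G me ot w) = nt w /\
  (lp (gl me) <= 3 -> lp (lead_l G me ot w) <= 3).
Proof.
  intros E F NP NL. destruct (aview_All G me ot E) as (_ & X & Y & FL).
  unfold lead_l, lead_w, lead, leader_step. rewrite X, Y, FL.
  destruct (Nat.eqb_spec (lp (gl me)) 3) as [P|P].
  - rewrite F by assumption. unfold arrive.
    destruct (lm (gl me)) eqn:M; [destruct (_ =? _); [simpl; auto with arith|]|].
    + match goal with |- context [proceed ?a ?b ?c ?d] =>
        destruct (proceed_lr a b c d) as (A1 & A2 & A3) end.
      simpl in *. rewrite A1, A3. repeat split; auto. lia.
    + match goal with |- context [proceed ?a ?b ?c ?d] =>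
        destruct (proceed_lr a b c d) as (A1 & A2 & A3) end.
      simpl in *. rewrite A1, A3. repeat split; auto. lia.
  - specialize (NP P). specialize (NL P). unfold judge in *. destruct (fresh _); [simpl; auto|].
    destruct (lr (gl me)) eqn:Er.
    + destruct (pairon _ _); [congruence|]. destruct (loneon _ _); [congruence|]. simpl. rewrite ?Er; auto with arith.
    + destruct (arriving _); [simpl; auto|]. destruct (_ || _); [|simpl; rewrite ?Er; auto with arith].
      unfold abandon. destruct (lm (gl me)).
      * match goal with |- context [proceed ?a ?b ?c ?d] =>
          destruct (proceed_lr a b c d) as (A1 & A2 & A3) end.
        simpl in *. rewrite A1, A3, ?Er. repeat split; auto. lia.
      * simpl. rewrite nt_set. auto with arith.
Qed.

Lemma lead_wait me ot w : gs me = All -> lp (gl me) <> 3 ->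
  judge (aview G me ot (gv me)) (gl me) = Wait ->
  lead_l G me ot w = gl me /\ lead_w G me ot w = w.
Proof.
  intros E P Jd. destruct (aview_All G me ot E) as (_ & X & Y & _).
  unfold lead_l, lead_w, lead, leader_step. rewrite X, Y, Jd.
  apply Nat.eqb_neq in P. rewrite P. auto.
Qed.

Lemma lead_arrive me ot w : gs me = All -> lp (gl me) = 3 -> yf me = false ->
  lead_l G me ot w = fst (arrive (deg G (gv me)) (ge me) false (gl me) w) /\
  lead_w G me ot w = snd (arrive (deg G (gv me)) (ge me) false (gl me) w).
Proof.
  intros E P F. destruct (aview_All G me ot E) as (_ & X & Y & FL).
  unfold lead_l, lead_w, lead, leader_step. rewrite X, Y, FL, P, F.
  destruct (arrive _ _ _ _ _). auto.
Qed.

Lemma arrive_lp d en l w : lp l = 3 -> lp (fst (arrive d en false l w)) = 3 \/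
  lp (fst (arrive d en false l w)) = 0.
Proof.
  intro P. unfold arrive. destruct (lm l).
  - destruct (_ =? _); [auto|].
    match goal with |- context [proceed ?a ?b ?c ?d] =>
        destruct (proceed_lr a b c d) as (_ & [A|A] & _) end; auto.
    left. rewrite A. assumption.
  - match goal with |- context [proceed ?a ?b ?c ?d] =>
        destruct (proceed_lr a b c d) as (_ & [A|A] & _) end; auto.
    left. rewrite A. assumption.
Qed.

Lemma lead_flagged me ot w : gs me = All -> lp (gl me) = 3 -> yf me = true ->
  lead_l G me ot w =
    Ld (lg (gl me)) true (match nt w with Some (md, _) => md | None => true end) 1
       (match ge me with Some i => i | None => 0 end) (ll (gl me)) (lc (gl me)) /\
  lead_w G me ot w = set_nt w None.
Proof.
  intros E P F. destruct (aview_All G me ot E) as (_ & X & Y & FL).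
  unfold lead_l, lead_w, lead, leader_step. rewrite X, Y, FL, P, F. auto.
Qed.

Lemma lead_swapP me ot w : gs me = All -> lp (gl me) <> 3 ->
  judge (aview G me ot (gv me)) (gl me) = SwapP ->
  lead_l G me ot w = fst (new_run (gl me) w) /\ lead_w G me ot w = snd (new_run (gl me) w).
Proof.
  intros E P J. destruct (aview_All G me ot E) as (_ & X & Y & FL).
  unfold lead_l, lead_w, lead, leader_step. rewrite X, Y, J.
  apply Nat.eqb_neq in P. rewrite P. auto.
Qed.

Lemma lead_swapL me ot w : gs me = All -> lp (gl me) <> 3 ->
  judge (aview G me ot (gv me)) (gl me) = SwapL ->
  let w1 := set_nt w (Some (lm (gl me), lt (gl me))) in
  lead_l G me ot w = fst (new_run (gl me) w1) /\ lead_w G me ot w = snd (new_run (gl me) w1).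
Proof.
  intros E P J. destruct (aview_All G me ot E) as (_ & X & Y & FL).
  unfold lead_l, lead_w, lead, leader_step. rewrite X, Y, J.
  apply Nat.eqb_neq in P. rewrite P. auto.
Qed.

Lemma lead_sep me ot w : sep me -> far G me <> gv me -> lead_w G me ot w = w.
Proof.
  intros [E|E] F; unfold lead_w; rewrite ?lead_Out, ?lead_Back by assumption; reflexivity.
Qed.

End Lead.

(** * The invariant of the two groups *)

Section Joint.
Variables (G : Graph) (bh : nat).
Hypothesis wfG : wf_graph G.

(** Meanwhile the search exists only as the note at [u]. Its carrier is either separated across that
    edge with a lone scout at [u], or has arrived there whole and flagged. A lone X is in phase 2,
    since the note is written only for a scout that has published. *)
Definition pending (s : state) (W : grp) (u q : nat) (md : bool) : Prop :=
  lr (gl W) = false /\ u <> bh /\ u < gn G /\ q < deg G u /\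
  nt (wbs s u) = Some (md, q) /\ (forall z, z <> u -> nt (wbs s z) = None) /\
  ((sep W /\ (gs W = Out -> lp (gl W) = 2) /\ far G W = u /\ near G W = q /\
    (gs W = Back -> lp (gl W) = 3 -> yf W = true)) \/
   (gs W = All /\ lp (gl W) = 3 /\ gv W = u /\ ge W = Some q /\ yf W = true)).

Definition holding (s : state) (W : grp) : Prop :=
  lr (gl W) = true /\ yf W = false /\ forall z, nt (wbs s z) = None.

(* The group w carries the patient search (possibly without knowing it: [pending]); the other
   group is the runner. *)
Record joint (s : state) (w : bool) : Prop := {
  j_live : forall g, live (gr s g);
  j_ok : forall g, group_ok G bh g (gr s g);
  j_back : forall g, back_ok (gr s g);
  j_lp : forall g, lp (gl (gr s g)) <= 3;
  j_role : lr (gl (gr s (negb w))) = false;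
  j_flag : yf (gr s (negb w)) = false;
  j_mode : holding s (gr s w) \/ exists u q md, pending s (gr s w) u q md;
  (* The remaining clauses control a common edge: both groups are separated on it only by
     simultaneous launches from its two ends, and no runner is across the port of a worker whose
     attempt failed, or of a carrier about to turn back. *)
  j_sep : sep (gr s w) -> sep (gr s (negb w)) ->
    on_edge G (gr s (negb w)) (gv (gr s w)) (lt (gl (gr s w))) ->
    opposed G (gr s w) (gr s (negb w)) /\ lp (gl (gr s w)) = 1 /\
    lp (gl (gr s (negb w))) = 1 /\ lr (gl (gr s w)) = true;
  j_try : gs (gr s w) = All -> lp (gl (gr s w)) = 1 \/ lp (gl (gr s w)) = 2 ->
    sep (gr s (negb w)) -> ~ on_edge G (gr s (negb w)) (gv (gr s w)) (lt (gl (gr s w)));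
  j_arr : gs (gr s w) = All -> lr (gl (gr s w)) = false -> forall q, ge (gr s w) = Some q ->
    sep (gr s (negb w)) -> ~ on_edge G (gr s (negb w)) (gv (gr s w)) q }.

Lemma sep_far g me : group_ok G bh g me -> sep me ->
  gv me < gn G /\ lt (gl me) < deg G (gv me) /\ far G me < gn G /\ far G me <> gv me /\
  near G me < deg G (far G me) /\ nb G (far G me) (near G me) = gv me /\
  bp G (far G me) (near G me) = lt (gl me).
Proof.
  intros (_ & Hn & _ & S) H.
  assert (lt (gl me) < deg G (gv me)) as Pd by (destruct H as [H|H]; rewrite H in S; apply S).
  pose proof (far_ok G wfG _ _ Hn Pd). unfold far, near. tauto.
Qed.

Lemma on_edge_flip g me v p : group_ok G bh g me -> sep me -> v < gn G -> p < deg G v ->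
  on_edge G me (nb G v p) (bp G v p) -> on_edge G me v p.
Proof.
  intros K S Hv Hp [[E1 E2]|[E1 E2]];
    destruct (far_ok G wfG _ _ Hv Hp) as (_ & _ & _ & A & B);
    destruct (sep_far g me K S) as (_ & _ & _ & _ & _ & C & D).
  - right. unfold far, near. rewrite E1, E2. auto.
  - left. rewrite <- E1, <- E2 in A, B. split; congruence.
Qed.

Lemma joint_opposed_fresh s w : joint s w -> opposed_fresh G s.
Proof.
  intros J g O. assert (OE : opposed G (gr s w) (gr s (negb w))).
  { destruct (bool_dec g w) as [->|N]; [assumption|].
    assert (g = negb w) by (destruct g, w; congruence || reflexivity). subst g.
    rewrite negb_involutive in O. apply (opposed_sym G bh wfG (negb w)); auto.
    - apply (j_ok _ _ J).
    - rewrite negb_involutive. apply (j_ok _ _ J). }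
  assert (H := OE). destruct H as (E1 & E2 & E3 & E4).
  destruct (j_sep _ _ J) as (_ & A & B & _); [left; assumption|left; assumption| |].
  - apply (on_edge_flip (negb w)); [apply (j_ok _ _ J)|left; assumption| | |];
      destruct (sep_far w (gr s w) (j_ok _ _ J w)) as (K1 & K2 & _); try (left; assumption); auto.
    left. fold (far G (gr s w)). auto.
  - destruct (bool_dec g w) as [->|N]; [assumption|].
    assert (g = negb w) by (destruct g, w; congruence || reflexivity). subst g. assumption.
Qed.

Section Step.
Variables (pr : nat -> nat -> bool) (s : state) (w : bool).
Hypothesis pr_deg : forall v p, pr v p = true -> p < deg G v.
Hypothesis pr_sym : forall v p, v < gn G -> p < deg G v -> pr (nb G v p) (bp G v p) = pr v p.
Hypothesis J : joint s w.

Notation W := (gr s w).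
Notation R := (gr s (negb w)).
Notation s' := (next G bh pr s).
Notation W' := (gr s' w).
Notation R' := (gr s' (negb w)).
Notation jW := (judge (aview G W R (gv W)) (gl W)).
Notation jR := (judge (aview G R W (gv R)) (gl R)).

Definition swapping : Prop := gs W = All /\ lp (gl W) <> 3 /\ (jW = SwapP \/ jW = SwapL).

Lemma spec_W : match jW with
    | Wait => (idle R /\ far G R = gv W) \/ (lr (gl W) = false /\ whole R (gv W) /\ lp (gl R) = 3)
    | Give => lr (gl W) = false /\ (lp (gl W) <> 0 \/ (sep R /\ on_edge G R (gv W) (lt (gl W))) \/
              (whole R (gv W) /\ lp (gl R) <> 3 /\ lt (gl R) = lt (gl W)))
    | SwapP => lr (gl W) = true /\ sep R /\ gv R = gv W /\ lt (gl R) = lt (gl W)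
    | SwapL => lr (gl W) = true /\ posted R /\ far G R = gv W /\ near G R = lt (gl W)
    | Try => ~ (sep R /\ on_edge G R (gv W) (lt (gl W))) /\ ~ (idle R /\ far G R = gv W) /\
      (lr (gl W) = false -> lp (gl W) = 0 /\
           ~ (whole R (gv W) /\ (lp (gl R) = 3 \/ lt (gl R) = lt (gl W))))
  end.
Proof.
  apply (judge_spec G bh wfG (negb w)); [apply (j_ok _ _ J w)|apply (j_ok _ _ J)|
    apply (j_live _ _ J)|apply (j_back _ _ J)].
Qed.

Lemma spec_R : match jR with
    | Wait => (idle W /\ far G W = gv R) \/ (whole W (gv R) /\ lp (gl W) = 3)
    | Give => lp (gl R) <> 0 \/ (sep W /\ on_edge G W (gv R) (lt (gl R))) \/
              (whole W (gv R) /\ lp (gl W) <> 3 /\ lt (gl W) = lt (gl R))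
    | SwapP | SwapL => False
    | Try => ~ (sep W /\ on_edge G W (gv R) (lt (gl R))) /\ ~ (idle W /\ far G W = gv R) /\
             lp (gl R) = 0 /\
             ~ (whole W (gv R) /\ (lp (gl W) = 3 \/ lt (gl W) = lt (gl R)))
  end.
Proof.
  pose proof (judge_spec G bh wfG w R W (gv R) (gl R)) as H.
  specialize (H (proj1 (proj2 (proj2 (j_ok _ _ J (negb w)))))).
  specialize (H (j_ok _ _ J w) (j_live _ _ J w) (j_back _ _ J w)).
  pose proof (j_role _ _ J) as E. destruct jR; intuition congruence.
Qed.

Lemma lgW : lg (gl W) = w. Proof. apply (j_ok _ _ J). Qed.
Lemma lgR : lg (gl R) = negb w. Proof. apply (j_ok _ _ J). Qed.
Lemma ndW : gs W <> Done. Proof. apply (j_live _ _ J). Qed.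
Lemma ndR : gs R <> Done. Proof. apply (j_live _ _ J). Qed.

Lemma next_W : exists by_, W' = gnext G bh pr W R (wbs s (gv W)) by_ /\
  by_ = mid_wbs G s (far G W).
Proof.
  exists (mid_wbs G s (far G W)). split; [|reflexivity]. cbn [next gr].
  pose proof (j_role _ _ J). pose proof (j_flag _ _ J).
  apply gnext_cong. apply read_W; auto using ndW, ndR, lgW, lgR.
Qed.

Lemma next_R : exists by_, R' = gnext G bh pr R W (wbs s (gv R)) by_ /\
  by_ = mid_wbs G s (far G R).
Proof.
  exists (mid_wbs G s (far G R)). split; [|reflexivity]. cbn [next gr].
  rewrite negb_involutive. apply gnext_cong.
  pose proof (j_role _ _ J). pose proof (j_flag _ _ J).
  apply read_R; auto using ndW, ndR, lgW, lgR.
Qed.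

(** A pair on its port rules out every other verdict of the worker, so a runner never promotes
    itself while the worker keeps its search. *)
Lemma pair_worker_swaps : sep R -> worker_on (aview G R W (gv R)) (Some (lt (gl R))) = true ->
  swapping.
Proof.
  intros S H. apply (worker_on_spec G bh wfG w) in H; [|apply (j_ok _ _ J)|apply (j_live _ _ J)].
  destruct H as (H1 & (H2 & H3) & H4 & H5). split; [assumption|]. split; [assumption|].
  pose proof spec_W as P. destruct (sep_far _ _ (j_ok _ _ J (negb w)) S) as (_ & _ & _ & F & _).
  destruct jW; auto.
  - destruct P as [[_ P]|[P _]]; congruence.
  - destruct P; congruence.
  - destruct P as [P _]. exfalso. apply P. split; [assumption|]. left. auto.
Qed.

Lemma no_take_W : lr (gl W) = false ->
  worker_on (aview G W R (gv W)) (Some (lt (gl W))) = false.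
Proof.
  intros _. apply not_true_iff_false. intro H.
  apply (worker_on_spec G bh wfG (negb w)) in H; [|apply (j_ok _ _ J)|apply (j_live _ _ J)].
  rewrite (j_role _ _ J) in H. destruct H; discriminate.
Qed.

Lemma nt_W_stay z : ~ swapping ->
  nt (lead_w G W R (wbs s z)) = nt (wbs s z) \/
  (gs W = All /\ lp (gl W) = 3 /\ yf W = true /\ nt (lead_w G W R (wbs s z)) = None).
Proof.
  intro NS. destruct (gs W) eqn:E.
  - destruct (Nat.eq_dec (lp (gl W)) 3) as [P|P]; [destruct (yf W) eqn:F|].
    + right. repeat split; auto. destruct (lead_flagged G W R (wbs s z) E P F) as [_ H].
      rewrite H. reflexivity.
    + left. apply lead_plain; auto; congruence.
    + left. apply lead_plain; auto; try congruence; intros _ H; apply NS; unfold swapping; auto.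
  - left. rewrite lead_sep; [reflexivity|left; assumption|].
    apply (sep_far _ _ (j_ok _ _ J w)). left. assumption.
  - left. rewrite lead_sep; [reflexivity|right; assumption|].
    apply (sep_far _ _ (j_ok _ _ J w)). right. assumption.
  - destruct (j_live _ _ J w). congruence.
  - destruct (j_live _ _ J w). congruence.
Qed.

Lemma nt_mid_stay z : ~ swapping ->
  nt (mid_wbs G s z) = nt (wbs s z) \/
  (gs W = All /\ lp (gl W) = 3 /\ yf W = true /\ nt (mid_wbs G s z) = None).
Proof.
  intro NS. pose proof (j_role _ _ J). pose proof (j_flag _ _ J).
  destruct (mid_nt G s w ndW ndR lgW lgR H H0 z) as [E|[_ E]]; [auto|].
  rewrite E. apply nt_W_stay; assumption.
Qed.

Lemma nt_next z : nt (wbs s' z) = if z =? gv W then nt (lead_w G W R (wbs s z)) else nt (wbs s z).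
Proof.
  pose proof (j_role _ _ J). pose proof (j_flag _ _ J).
  destruct (board_W G bh pr s w ndW ndR lgW lgR H H0 z) as [m ->].
  rewrite nt_set. destruct (z =? gv W); reflexivity.
Qed.

(** If the carrier is still separated, the groups would be opposed, which [j_sep] allows only for a
    declared worker; if it has arrived, [j_arr] applies. *)
Lemma pending_edge u q md : pending s W u q md -> sep R -> ~ on_edge G R u q.
Proof.
  intros (E & Nu & Hu & Hq & _ & _ & [(S & P & F & N & _)|(A & P & V & Ge & Y)]) SR O.
  - destruct (sep_far _ _ (j_ok _ _ J w) S) as (K1 & K2 & _ & _ & _ & _ & _).
    subst u q. unfold far, near in O. apply (on_edge_flip (negb w)) in O; auto;
      [|apply (j_ok _ _ J)].
    destruct (j_sep _ _ J S SR O) as (_ & _ & _ & H). congruence.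
  - subst u. apply (j_arr _ _ J A E q Ge SR O).
Qed.

(** A flag needs a note naming the edge of this Y, which [pending_edge] excludes, or a worker on
    that edge, which would be swapping. *)
Lemma flag_R : ~ swapping -> gs R = Back ->
  flagged (aview G R W (far G R)) (ye R) (yn R) (mid_wbs G s (far G R)) = false.
Proof.
  intros NS B. assert (S : sep R) by (right; assumption).
  destruct (sep_far _ _ (j_ok _ _ J _) S) as (K1 & K2 & K3 & K4 & K5 & K6 & K7).
  destruct (j_ok _ _ J (negb w)) as (_ & _ & _ & O). rewrite B in O.
  destruct O as (_ & P & Nb & Y). fold (near G R) in Y.
  unfold flagged. apply orb_false_iff. split.
  - destruct (nt_mid_stay (far G R) NS) as [E|(_ & _ & _ & E)]; rewrite E; [|reflexivity].
    destruct (j_mode _ _ J) as [(_ & _ & N)|(u & q & md & Pe)]; [rewrite N; reflexivity|].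
    destruct (Nat.eq_dec (far G R) u) as [F|F].
    + assert (Pe2 := Pe). destruct Pe as (_ & _ & _ & _ & E2 & _). rewrite F, E2, Y. simpl.
      apply Nat.eqb_neq. intro Q. apply (pending_edge u q md Pe2 S). right. auto.
    + destruct Pe as (_ & _ & _ & _ & _ & E2 & _). rewrite E2 by assumption. reflexivity.
  - apply not_true_iff_false. intro H. apply andb_prop in H. destruct H as [H1 H2].
    pose proof (j_back _ _ J (negb w) B) as Hy. rewrite Hy in H1.
    assert (P3 : lp (gl R) = 3).
    { destruct P as [P|P]; [rewrite P in H1; discriminate|assumption]. }
    rewrite Y in H2. apply (worker_on_spec G bh wfG w) in H2; [|apply (j_ok _ _ J)|apply (j_live _ _ J)].
    destruct H2 as (A1 & (A2 & A3) & A4 & A5). apply NS. split; [assumption|]. split; [assumption|].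
    pose proof spec_W as Sp. destruct jW; auto; exfalso.
    + destruct Sp as [[[[C _]|[_ C]] _]|[C _]]; congruence.
    + destruct Sp. congruence.
    + destruct Sp as [Sp _]. apply Sp. split; [assumption|]. right. split; congruence.
Qed.

Lemma R_All : gs R = All ->
  gl R' = lead_l G R W (wbs s (gv R)) /\ gv R' = gv R /\ ge R' = ge R /\ yf R' = false /\
  (if lp (gl R) =? 3 then gs R' = All
   else match jR with
        | Try => gs R' = (if pr (gv R) (lt (gl R)) then Out else All) /\
                 lt (gl R') = lt (gl R) /\ lp (gl R') = 1
        | _ => gs R' = All
        end).
Proof.
  intro E. destruct next_R as (b & -> & _).
  destruct (next_All G bh pr R W (wbs s (gv R)) b E) as (A1 & A2 & A3 & A4 & A5).
  { pose proof (j_ok _ _ J (negb w)) as (_ & _ & _ & S). rewrite E in S. exact S. }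
  repeat split; auto. revert A5. unfold try_port.
  destruct (aview_All G R W E) as (_ & _ & _ & F). rewrite F, (j_flag _ _ J).
  destruct (lp (gl R) =? 3); [auto|]. destruct jR; auto.
Qed.

Lemma R_Out : ~ swapping -> gs R = Out ->
  gl R' = Ld (lg (gl R)) (lr (gl R)) (lm (gl R)) 2 (lt (gl R)) (ll (gl R)) (lc (gl R)) /\
  gv R' = gv R /\ yf R' = false /\
  gs R' = (if opposed_b G R W then All else
            if (lp (gl R) =? 2) && pr (gv R) (lt (gl R))
            then if far G R =? bh then Lost else Back else Out).
Proof.
  intros NS E. destruct next_R as (b & -> & _).
  assert (S : sep R) by (left; assumption).
  destruct (next_Out G bh pr R W (wbs s (gv R)) b E) as (A1 & A2 & A3 & A4 & A5); auto.
  - apply (sep_far _ _ (j_ok _ _ J _) S).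
  - intros _. apply not_true_iff_false. intro H. apply NS, pair_worker_swaps; assumption.
Qed.

Lemma R_Back : ~ swapping -> gs R = Back ->
  gl R' = Ld (lg (gl R)) (lr (gl R)) (lm (gl R)) 3 (lt (gl R)) (ll (gl R)) (lc (gl R)) /\
  yf R' = false /\
  if (lp (gl R) =? 3) && pr (gv R) (lt (gl R))
  then gs R' = All /\ gv R' = far G R /\ ge R' = Some (near G R)
  else gs R' = Back /\ gv R' = gv R.
Proof.
  intros NS E. destruct next_R as (b & -> & ->).
  assert (S : sep R) by (right; assumption).
  destruct (next_Back G bh pr R W (wbs s (gv R)) (mid_wbs G s (far G R)) E) as (A1 & A2 & A3 & A4); auto.
  - apply (sep_far _ _ (j_ok _ _ J _) S).
  - intros _. apply not_true_iff_false. intro H. apply NS, pair_worker_swaps; assumption.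
  - rewrite A2, flag_R by assumption. auto.
Qed.

Lemma W_All : gs W = All ->
  gl W' = lead_l G W R (wbs s (gv W)) /\ gv W' = gv W /\ ge W' = ge W /\ yf W' = false /\
  match try_port (aview G W R (gv W)) (gl W) (ge W) with
  | Some q => gs W' = (if pr (gv W) q then Out else All) /\ lt (gl W') = q /\ lp (gl W') = 1
  | None => gs W' = All
  end.
Proof.
  intro E. destruct next_W as (b & -> & _).
  apply (next_All G bh pr W R (wbs s (gv W)) b E).
  pose proof (j_ok _ _ J w) as (_ & _ & _ & S). rewrite E in S. exact S.
Qed.

Lemma W_Out : gs W = Out ->
  gl W' = Ld (lg (gl W)) (lr (gl W)) (lm (gl W)) 2 (lt (gl W)) (ll (gl W)) (lc (gl W)) /\
  gv W' = gv W /\ yf W' = false /\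
  gs W' = (if opposed_b G W R then All else
            if (lp (gl W) =? 2) && pr (gv W) (lt (gl W))
            then if far G W =? bh then Lost else Back else Out).
Proof.
  intros E. destruct next_W as (b & -> & _).
  assert (S : sep W) by (left; assumption).
  destruct (next_Out G bh pr W R (wbs s (gv W)) b E) as (A1 & A2 & A3 & A4 & A5); auto.
  - apply (sep_far _ _ (j_ok _ _ J _) S).
  - apply no_take_W.
Qed.

Lemma W_Back : gs W = Back ->
  gl W' = Ld (lg (gl W)) (lr (gl W)) (lm (gl W)) 3 (lt (gl W)) (ll (gl W)) (lc (gl W)) /\
  yf W' = flagged (aview G W R (far G W)) (ye W) (yn W) (mid_wbs G s (far G W)) /\
  if (lp (gl W) =? 3) && pr (gv W) (lt (gl W))
  then gs W' = All /\ gv W' = far G W /\ ge W' = Some (near G W)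
  else gs W' = Back /\ gv W' = gv W.
Proof.
  intros E. destruct next_W as (b & -> & ->).
  assert (S : sep W) by (right; assumption).
  destruct (next_Back G bh pr W R (wbs s (gv W)) (mid_wbs G s (far G W)) E) as (A1 & A2 & A3 & A4); auto.
  - apply (sep_far _ _ (j_ok _ _ J _) S).
  - apply no_take_W.
Qed.

Definition still (g g' : grp) : Prop := sep g /\ gv g' = gv g /\ lt (gl g') = lt (gl g).

(** The two origins of a separation, an old one on the same edge or a launch through a present edge,
    are the cases of every argument below on a common edge. *)
Lemma sep_R' : ~ swapping -> sep R' ->
  still R R' \/
  (gs R = All /\ lp (gl R) <> 3 /\ jR = Try /\ gs R' = Out /\ gv R' = gv R /\
   lt (gl R') = lt (gl R) /\ lp (gl R') = 1 /\ pr (gv R) (lt (gl R)) = true).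
Proof.
  intros NS H. destruct (gs R) eqn:E.
  - right. destruct (R_All E) as (_ & A2 & _ & _ & A5).
    destruct (Nat.eqb_spec (lp (gl R)) 3); [destruct H; congruence|].
    destruct jR eqn:Ej; try (destruct H; congruence).
    destruct A5 as (A5 & A6 & A7). destruct (pr _ _) eqn:P; [auto 10|destruct H; congruence].
  - left. destruct (R_Out NS E) as (A1 & A2 & _). split; [left; assumption|].
    rewrite A1. auto.
  - left. destruct (R_Back NS E) as (A1 & A2 & A3). split; [right; assumption|].
    destruct (_ && _); [destruct H, A3; congruence|]. rewrite A1. split; [apply A3|reflexivity].
  - destruct (j_live _ _ J (negb w)). congruence.
  - destruct (j_live _ _ J (negb w)). congruence.
Qed.

Lemma sep_W' : sep W' ->
  still W W' \/
  (gs W = All /\ try_port (aview G W R (gv W)) (gl W) (ge W) = Some (lt (gl W')) /\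
   gs W' = Out /\ gv W' = gv W /\ lp (gl W') = 1 /\ pr (gv W) (lt (gl W')) = true).
Proof.
  intros H. destruct (gs W) eqn:E.
  - right. destruct (W_All E) as (_ & A2 & _ & _ & A5).
    destruct (try_port _ _ _) as [q|]; [|destruct H; congruence].
    destruct A5 as (A5 & A6 & A7). destruct (pr _ _) eqn:P; [|destruct H; congruence].
    rewrite A6. auto 10.
  - left. destruct (W_Out E) as (A1 & A2 & _). split; [left; assumption|].
    rewrite A1. auto.
  - left. destruct (W_Back E) as (A1 & A2 & A3). split; [right; assumption|].
    destruct (_ && _); [destruct H, A3; congruence|]. rewrite A1. split; [apply A3|reflexivity].
  - destruct (j_live _ _ J w). congruence.
  - destruct (j_live _ _ J w). congruence.
Qed.

(** For a carrier turning back there is no verdict to rely on; [j_arr] stands in for it. *)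
Lemma try_W_clear q : try_port (aview G W R (gv W)) (gl W) (ge W) = Some q -> gs W = All ->
  sep R -> ~ on_edge G R (gv W) q.
Proof.
  unfold try_port. intros T E S.
  destruct (Nat.eqb_spec (lp (gl W)) 3) as [P|P].
  - destruct (aview_All G W R E) as (_ & _ & _ & F). rewrite F in T.
    destruct (j_mode _ _ J) as [(_ & Y & _)|(u & q' & md & Pe)]; [rewrite Y in T; discriminate|].
    destruct (yf W); [|discriminate]. apply (j_arr _ _ J E); [apply Pe|assumption|assumption].
  - pose proof spec_W as Sp. destruct jW; try discriminate. injection T as <-.
    destruct Sp as [Sp _]. tauto.
Qed.

End Step.
End Joint.

(** * Preservation of the invariant, with and without a swap *)

Section Step.
Variables (G : Graph) (bh : nat) (pr : nat -> nat -> bool) (s : state) (w : bool).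
Hypothesis wfG : wf_graph G.
Hypothesis pr_deg : forall v p, pr v p = true -> p < deg G v.
Hypothesis pr_sym : forall v p, v < gn G -> p < deg G v -> pr (nb G v p) (bp G v p) = pr v p.
Hypothesis J : joint G bh s w.

Notation W := (gr s w).
Notation R := (gr s (negb w)).
Notation s' := (next G bh pr s).
Notation W' := (gr s' w).
Notation R' := (gr s' (negb w)).
Notation jW := (judge (aview G W R (gv W)) (gl W)).
Notation jR := (judge (aview G R W (gv R)) (gl R)).
Notation swap := (swapping G s w).

Lemma next_ok g : group_ok G bh g (gr s' g).
Proof.
  cbn [next gr]. apply group_ok_next; auto; try apply (j_ok _ _ _ _ J).
  intro O. split.
  - apply (joint_opposed_fresh G bh wfG s w J g O).
  - apply (joint_opposed_fresh G bh wfG s w J (negb g)). rewrite negb_involutive.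
    apply (opposed_sym G bh wfG g); auto; apply (j_ok _ _ _ _ J).
Qed.

Lemma next_back g : back_ok (gr s' g).
Proof.
  cbn [next gr]. apply (back_ok_next G bh pr wfG g); [apply (j_ok _ _ _ _ J)|apply (j_live _ _ _ _ J)].
Qed.

Lemma R_stay : ~ swap -> live R' -> lr (gl R') = false /\ yf R' = false /\ lp (gl R') <= 3.
Proof.
  intros NS L. pose proof (j_role _ _ _ _ J) as Er. pose proof (j_flag _ _ _ _ J) as Ef.
  pose proof (j_lp _ _ _ _ J (negb w)) as Ep.
  destruct (gs R) eqn:E.
  - destruct (R_All G bh pr s w J E) as (A1 & _ & _ & A4 & _).
    destruct (lead_plain G R W (wbs s (gv R)) E) as (B1 & _ & B3); auto.
    + intros _ H. pose proof (spec_R G bh wfG s w J) as S. rewrite H in S. exact S.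
    + intros _ H. pose proof (spec_R G bh wfG s w J) as S. rewrite H in S. exact S.
    + rewrite A1, B1. auto.
  - destruct (R_Out G bh wfG pr s w J NS E) as (A1 & _ & A3 & _).
    rewrite A1. simpl. auto.
  - destruct (R_Back G bh wfG pr s w J NS E) as (A1 & A3 & _).
    rewrite A1. simpl. auto.
  - destruct (j_live _ _ _ _ J (negb w)). congruence.
  - destruct (j_live _ _ _ _ J (negb w)). congruence.
Qed.

Lemma W_lp : ~ swap -> lp (gl W') <= 3.
Proof.
  intros NS. pose proof (j_lp _ _ _ _ J w) as Ep.
  destruct (gs W) eqn:E.
  - destruct (W_All G bh pr s w J E) as (A1 & _).
    destruct (Nat.eq_dec (lp (gl W)) 3) as [P|P]; [destruct (yf W) eqn:F|].
    + rewrite A1, (proj1 (lead_flagged G W R _ E P F)). simpl. lia.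
    + rewrite A1. apply lead_plain; auto; congruence.
    + rewrite A1. apply lead_plain; auto; try congruence; intros _ H; apply NS; unfold swapping; auto.
  - destruct (W_Out G bh wfG pr s w J E) as (A1 & _). rewrite A1. simpl. lia.
  - destruct (W_Back G bh wfG pr s w J E) as (A1 & _). rewrite A1. simpl. lia.
  - destruct (j_live _ _ _ _ J w). congruence.
  - destruct (j_live _ _ _ _ J w). congruence.
Qed.

Lemma flag_W_holding : holding s W -> gs W = Back ->
  flagged (aview G W R (far G W)) (ye W) (yn W) (mid_wbs G s (far G W)) = false.
Proof.
  intros (Er & Ef & N) E. unfold flagged. apply orb_false_iff.
  destruct (sep_far G bh wfG _ _ (j_ok _ _ _ _ J w)) as (_ & _ & _ & F & _); [right; assumption|].
  split.
  - pose proof (j_role _ _ _ _ J) as H. pose proof (j_flag _ _ _ _ J) as H0.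
    destruct (mid_nt G s w (ndW _ _ _ _ J) (ndR _ _ _ _ J) (lgW _ _ _ _ J) (lgR _ _ _ _ J) H H0
       (far G W)) as [K|[K _]]; [|congruence]. rewrite K, N. reflexivity.
  - apply andb_false_iff. right. destruct (j_ok _ _ _ _ J w) as (_ & _ & _ & S).
    rewrite E in S. destruct S as (_ & _ & _ & Y). rewrite Y.
    apply not_true_iff_false. intro H.
    apply (worker_on_spec G bh wfG (negb w)) in H; [|apply (j_ok _ _ _ _ J)|apply (j_live _ _ _ _ J)].
    rewrite (j_role _ _ _ _ J) in H. destruct H; discriminate.
Qed.

Lemma holding_stay : ~ swap -> live W' -> holding s W -> holding s' W'.
Proof.
  intros NS L H. assert (H0 := H). destruct H as (Er & Ef & N).
  assert (N' : forall z, nt (wbs s' z) = None).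
  { intro z. rewrite (nt_next G bh pr s w J z). destruct (z =? gv W); [|apply N].
    destruct (nt_W_stay G bh wfG s w J z NS) as [K|(_ & _ & K & _)]; [|congruence].
    rewrite K. apply N. }
  unfold holding. cut (lr (gl W') = true /\ yf W' = false); [tauto|].
  destruct (gs W) eqn:E.
  - destruct (W_All G bh pr s w J E) as (A1 & _ & _ & A4 & _). rewrite A1, A4.
    split; [|reflexivity]. rewrite <- Er.
    apply lead_plain; auto; intros P K; apply NS; unfold swapping; auto.
  - destruct (W_Out G bh wfG pr s w J E) as (A1 & _ & A3 & _). rewrite A1, A3. simpl. auto.
  - destruct (W_Back G bh wfG pr s w J E) as (A1 & A3 & _). rewrite A1, A3. simpl.
    split; [assumption|]. apply flag_W_holding; assumption.
  - destruct (j_live _ _ _ _ J w). congruence.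
  - destruct (j_live _ _ _ _ J w). congruence.
Qed.

(** The second alternative is the round in which the arrived carrier reads and erases the note. *)
Lemma pending_stay u q md : live W' -> pending G bh s W u q md ->
  pending G bh s' W' u q md \/ holding s' W'.
Proof.
  intros L P. assert (P0 := P). destruct P as (Er & Nu & Hu & Hq & E1 & E2 & C).
  assert (NS : ~ swap).
  { intros (A & B & D). pose proof (spec_W G bh wfG s w J) as Sp.
    destruct D as [D|D]; rewrite D in Sp; destruct Sp; congruence. }
  pose proof (j_role _ _ _ _ J) as HR. pose proof (j_flag _ _ _ _ J) as HF.
  destruct C as [(S & C1 & C2 & C3 & C4)|(A & B & V & Ge & Y)].
  - left. destruct (sep_far G bh wfG _ _ (j_ok _ _ _ _ J w) S) as (K1 & K2 & K3 & K4 & K5 & K6 & K7).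
    assert (N' : forall z, nt (wbs s' z) = nt (wbs s z)).
    { intro z. rewrite (nt_next G bh pr s w J z). destruct (z =? gv W); [|reflexivity].
      destruct (nt_W_stay G bh wfG s w J z NS) as [K|(K & _ & _ & _)]; [assumption|].
      destruct S; congruence. }
    unfold pending. rewrite !N'.
    cut (lr (gl W') = false /\
         ((sep W' /\ (gs W' = Out -> lp (gl W') = 2) /\ far G W' = u /\ near G W' = q /\
           (gs W' = Back -> lp (gl W') = 3 -> yf W' = true)) \/
          (gs W' = All /\ lp (gl W') = 3 /\ gv W' = u /\ ge W' = Some q /\ yf W' = true))).
    { intros [X1 X2]. split; [assumption|]. repeat split; auto. intros z Hz. rewrite N'. auto. }
    assert (FL : gs W = Back ->
       flagged (aview G W R (far G W)) (ye W) (yn W) (mid_wbs G s (far G W)) = true).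
    { intro E. unfold flagged.
      destruct (mid_nt G s w (ndW _ _ _ _ J) (ndR _ _ _ _ J) (lgW _ _ _ _ J) (lgR _ _ _ _ J) HR HF
       (far G W)) as [K|[K _]]; [|congruence]. rewrite K, C2, E1.
      destruct (j_ok _ _ _ _ J w) as (_ & _ & _ & O). rewrite E in O.
      destruct O as (_ & _ & _ & Yn). fold (near G W) in Yn. rewrite Yn, C3. simpl.
      rewrite Nat.eqb_refl. reflexivity. }
    destruct S as [E|E].
    + destruct (W_Out G bh wfG pr s w J E) as (A1 & A2 & A3 & A4).
      assert (NO : opposed_b G W R = false).
      { apply not_true_iff_false. intro O.
        apply (opposed_b_iff G bh wfG w) in O; try apply (j_ok _ _ _ _ J).
        pose proof (joint_opposed_fresh G bh wfG s w J w O). specialize (C1 E). congruence. }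
      rewrite NO in A4.
      unfold sep, far, near. rewrite A1, A2, A4. cbn [lg lr lm lp lt ll lc]. fold (far G W) (near G W).
      split; [assumption|]. left.
      destruct (_ && _); [destruct (Nat.eqb_spec (far G W) bh); [congruence|]|];
        repeat split; auto; discriminate.
    + destruct (W_Back G bh wfG pr s w J E) as (A1 & A2 & A3). rewrite A2, FL by assumption.
      unfold sep, far, near. rewrite A1. cbn [lg lr lm lp lt ll lc]. split; [assumption|].
      destruct (_ && _).
      * right. destruct A3 as (A3 & A4 & A5). rewrite A4, A5, C2, C3. auto.
      * left. destruct A3 as (A3 & A4). rewrite A4. fold (far G W) (near G W).
        split; [right; assumption|]. split; [congruence|]. auto.
  - right. destruct (W_All G bh pr s w J A) as (A1 & A2 & A3 & A4 & A5).
    destruct (lead_flagged G W R (wbs s (gv W)) A B Y) as [L1 L2].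
    unfold holding. rewrite A1, A4, L1. split; [reflexivity|]. split; [reflexivity|].
    intro z. rewrite (nt_next G bh pr s w J z). destruct (Nat.eqb_spec z (gv W)) as [->|N].
    + rewrite L2. reflexivity.
    + apply E2. congruence.
Qed.

Lemma joint_stay : ~ swap -> (forall g, live (gr s' g)) -> joint G bh s' w.
Proof.
  intros NS L.
  destruct (R_stay NS (L _)) as (R1 & R2 & R3).
  assert (RP : forall q, on_edge G R' (gv W') q -> still R R' -> gv W' = gv W -> on_edge G R (gv W) q).
  { intros q H (S & E1 & E2) E3. unfold on_edge, far, near in *. rewrite E1, E2, E3 in H. exact H. }
  constructor; auto using next_ok, next_back.
  - intro g. destruct (bool_dec g w) as [->|N]; [apply W_lp; assumption|].
    assert (g = negb w) by (destruct g, w; congruence || reflexivity). subst g. assumption.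
  - destruct (j_mode _ _ _ _ J) as [H|(u & q & md & H)].
    + left. apply holding_stay; auto.
    + destruct (pending_stay u q md (L _) H); eauto.
  - intros SW SR O.
    destruct (sep_W' G bh wfG pr s w J SW) as [SW0|(A1 & A2 & A3 & A4 & A5 & A6)];
    destruct (sep_R' G bh wfG pr s w J NS SR) as [SR0|(B1 & B2 & B3 & B4 & B5 & B6 & B7 & B8)].
    (* Both were on the edge already, hence opposed; the exchange of X has just made them whole. *)
    + exfalso. destruct SW0 as (S1 & S2 & S3). destruct SR0 as (T1 & T2 & T3).
      assert (O' : on_edge G R (gv W) (lt (gl W))).
      { unfold on_edge, far, near in *. rewrite S2, S3, T2, T3 in O. exact O. }
      destruct (j_sep _ _ _ _ J S1 T1 O') as (O1 & _).
      assert (E := O1). destruct E as (E & _). destruct (W_Out G bh wfG pr s w J E) as (_ & _ & _ & K).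
      apply (opposed_b_iff G bh wfG w) in O1; try apply (j_ok _ _ _ _ J). rewrite O1 in K.
      destruct SW; congruence.
    (* The worker was there already, and then the verdict of the runner would not have been
       [Try]. *)
    + exfalso. destruct SW0 as (S1 & S2 & S3).
      pose proof (spec_R G bh wfG s w J) as Sp. rewrite B3 in Sp. destruct Sp as [Sp _]. apply Sp.
      split; [assumption|].
      destruct (j_ok _ _ _ _ J (negb w)) as (_ & Hn & _).
      destruct (sep_far G bh wfG _ _ (j_ok _ _ _ _ J w) S1) as (K1 & K2 & _).
      destruct (far_ok G wfG _ _ Hn (pr_deg _ _ B8)) as (_ & _ & _ & F4 & F5).
      destruct O as [[O1 O2]|[O1 O2]].
      * left. split; congruence.
      * right. unfold far, near in *. rewrite B5, B6 in *. rewrite S2, S3 in *.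
        rewrite <- O1, <- O2. auto.
    + exfalso. apply (try_W_clear G bh wfG s w J _ A2 A1 (proj1 SR0)).
      apply RP; assumption.
    (* Both launch in this round. From the same end the runner would have waited or given way, so
       they come from opposite ends. *)
    + split; [|split; [assumption|split; [assumption|]]].
      * destruct O as [[O1 O2]|[O1 O2]].
        -- exfalso. pose proof (spec_R G bh wfG s w J) as Sp. rewrite B3 in Sp.
           destruct Sp as (_ & _ & _ & Sp). apply Sp.
           split; [split; [assumption|congruence]|].
           unfold try_port in A2. destruct (Nat.eqb_spec (lp (gl W)) 3); [left; assumption|].
           right. destruct jW; congruence.
        -- apply (opposed_sym G bh wfG (negb w)); rewrite ?negb_involutive; try apply next_ok.
           repeat split; auto.
      * destruct (W_All G bh pr s w J A1) as (C1 & _). rewrite C1.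
        unfold try_port in A2. destruct (Nat.eqb_spec (lp (gl W)) 3) as [P|P].
        -- destruct (aview_All G W R A1) as (_ & _ & _ & F). rewrite F in A2.
           destruct (yf W) eqn:Y; [|discriminate].
           rewrite (proj1 (lead_flagged G W R _ A1 P Y)). reflexivity.
        -- pose proof (spec_W G bh wfG s w J) as Sp.
           replace (lr (lead_l G W R (wbs s (gv W)))) with (lr (gl W)).
           ++ destruct (j_mode _ _ _ _ J) as [(H & _)|(u & q & md & H)]; [assumption|].
              destruct H as (_ & _ & _ & _ & _ & _ & [(S & _)|(_ & K & _)]); [destruct S; congruence|contradiction].
           ++ symmetry. apply lead_plain; auto; try contradiction;
              intros _ K; apply NS; unfold swapping; auto.
  - intros E P SR O. destruct (gs W) eqn:E0.
    + destruct (W_All G bh pr s w J E0) as (A1 & A2 & _ & _ & A5).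
      destruct (try_port _ _ _) as [q|] eqn:T.
      * destruct A5 as (A5 & A6 & _). rewrite A6 in O.
        assert (pr (gv W) q = false) as F by (destruct (pr (gv W) q); congruence).
        destruct (sep_R' G bh wfG pr s w J NS SR) as [SR0|(B1 & B2 & B3 & B4 & B5 & B6 & B7 & B8)].
        -- apply (try_W_clear G bh wfG s w J _ T E0 (proj1 SR0)). apply RP; assumption.
        (* The attempt of the worker failed, so the edge is missing and the runner cannot have
           launched across it. *)
        -- destruct (j_ok _ _ _ _ J (negb w)) as (_ & Hn & _).
           assert (X := pr_sym _ _ Hn (pr_deg _ _ B8)).
           unfold on_edge, far, near in O. rewrite A2, B5, B6 in O.
           destruct O as [[O1 O2]|[O1 O2]]; [|rewrite O1, O2 in X]; congruence.
      * unfold try_port in T. destruct (Nat.eqb_spec (lp (gl W)) 3) as [P3|P3].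
        -- destruct (aview_All G W R E0) as (_ & _ & _ & F). rewrite F in T.
           destruct (yf W) eqn:Y.
           { destruct (j_mode _ _ _ _ J) as [(_ & K & _)|(u & q & md & K)]; [congruence|].
             destruct K as (_ & _ & _ & _ & _ & _ & [(S & _)|(_ & _ & _ & K & _)]);
               [destruct S|]; congruence. }
           destruct (lead_arrive G W R (wbs s (gv W)) E0 P3 Y) as [A _].
           rewrite A1, A in P.
           destruct (arrive_lp (deg G (gv W)) (ge W) (gl W) (wbs s (gv W)) P3) as [K|K];
             rewrite K in P; destruct P; discriminate.
        -- pose proof (spec_W G bh wfG s w J) as Sp.
           assert (H : lr (gl W) = true).
           { destruct (j_mode _ _ _ _ J) as [(H & _)|(u & q & md & H)]; [assumption|].
              destruct H as (_ & _ & _ & _ & _ & _ & [(S & _)|(_ & K & _)]);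
                [destruct S; congruence|contradiction]. }
           destruct jW eqn:Ej; try discriminate.
           ++ destruct Sp as [[Sp _]|[Sp _]]; [|congruence].
              destruct (lead_wait G W R (wbs s (gv W)) E0 P3 Ej) as [A _].
              rewrite A1, A in P, O.
              assert (S : sep R) by (unfold idle, sep in *; tauto).
              destruct (sep_R' G bh wfG pr s w J NS SR) as [SR0|(B1 & _)];
                [|destruct S; congruence].
              apply (j_try _ _ _ _ J E0 P S). apply RP; assumption.
           ++ destruct Sp. congruence.
           ++ apply NS. unfold swapping. auto.
           ++ apply NS. unfold swapping. auto.
    + destruct (W_Out G bh wfG pr s w J E0) as (_ & _ & _ & A4).
      destruct (opposed_b G W R) eqn:Op.
      * apply (opposed_b_iff G bh wfG w) in Op; try apply (j_ok _ _ _ _ J).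
        apply (opposed_sym G bh wfG w) in Op; try apply (j_ok _ _ _ _ J).
        assert (Eo := proj1 Op). destruct (R_Out G bh wfG pr s w J NS Eo) as (_ & _ & _ & K).
        replace (opposed_b G R W) with true in K; [destruct SR; congruence|].
        symmetry. apply (opposed_b_iff G bh wfG (negb w)); rewrite ?negb_involutive;
          try apply (j_ok _ _ _ _ J). assumption.
      * destruct (_ && _); [destruct (_ =? bh)|]; congruence.
    + destruct (W_Back G bh wfG pr s w J E0) as (A1 & _). rewrite A1 in P. cbn in P. lia.
    + destruct (j_live _ _ _ _ J w). congruence.
    + destruct (j_live _ _ _ _ J w). congruence.
  - intros E Er q Eq SR O.
    destruct (j_mode _ _ _ _ J) as [H|(u & q' & md & H)].
    { apply holding_stay in H; auto. destruct H. congruence. }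
    destruct (gs W) eqn:E0.
    + destruct H as (_ & _ & _ & _ & _ & _ & [(S & _)|(_ & P3 & _ & _ & Y)]);
        [destruct S; congruence|].
      destruct (W_All G bh pr s w J E0) as (A1 & _).
      rewrite A1, (proj1 (lead_flagged G W R _ E0 P3 Y)) in Er. discriminate.
    + destruct (W_Out G bh wfG pr s w J E0) as (_ & _ & _ & A4).
      destruct (opposed_b G W R) eqn:Op.
      * apply (opposed_b_iff G bh wfG w) in Op; try apply (j_ok _ _ _ _ J).
        pose proof (joint_opposed_fresh G bh wfG s w J w Op).
        destruct H as (_ & _ & _ & _ & _ & _ & [(_ & K & _)|(K & _)]); [|congruence].
        specialize (K E0). congruence.
      * destruct (_ && _); [destruct (_ =? bh)|]; congruence.
    + assert (SW : sep W) by (right; assumption).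
      destruct (W_Back G bh wfG pr s w J E0) as (_ & _ & A).
      destruct (_ && _); [|destruct A; congruence]. destruct A as (_ & A2 & A3).
      assert (q = near G W) by congruence. subst q. rewrite A2 in O.
      destruct (sep_far G bh wfG _ _ (j_ok _ _ _ _ J w) SW) as (K1 & K2 & K3 & K4 & K5 & K6 & K7).
      destruct (sep_R' G bh wfG pr s w J NS SR) as [SR0|(B1 & B2 & B3 & B4 & B5 & B6 & B7 & B8)].
      * destruct SR0 as (S & E1 & E2).
        assert (O' : on_edge G R (gv W) (lt (gl W))).
        { apply (on_edge_flip G bh wfG (negb w)); auto; [apply (j_ok _ _ _ _ J)|].
          unfold on_edge, far, near in *. rewrite E1, E2 in O. exact O. }
        destruct (j_sep _ _ _ _ J SW S O') as (_ & _ & _ & K).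
        destruct H as (K' & _). congruence.
      * pose proof (spec_R G bh wfG s w J) as Sp. rewrite B3 in Sp. destruct Sp as [Sp _].
        apply Sp. split; [assumption|].
        destruct (j_ok _ _ _ _ J (negb w)) as (_ & Hn & _).
        destruct (far_ok G wfG _ _ Hn (pr_deg _ _ B8)) as (_ & _ & _ & F4 & F5).
        unfold on_edge, far, near in *. rewrite B5, B6 in O.
        destruct O as [[O1 O2]|[O1 O2]].
        -- right. auto.
        -- left. rewrite O1, O2 in *. split; congruence.
    + destruct (j_live _ _ _ _ J w). congruence.
    + destruct (j_live _ _ _ _ J w). congruence.
Qed.

Notation V := (aview G R W (gv R)).

(** Only a declared worker swaps, so there is no note anywhere and a note left by the swap will be
    the only one. *)
Lemma swap_sep : swap -> sep R /\ lr (gl W) = true /\ holding s W /\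
  ((jW = SwapP /\ gv R = gv W /\ lt (gl R) = lt (gl W)) \/
   (jW = SwapL /\ posted R /\ far G R = gv W /\ near G R = lt (gl W))).
Proof.
  intros (A & B & C). pose proof (spec_W G bh wfG s w J) as Sp.
  assert (H : lr (gl W) = true -> holding s W).
  { intro H. destruct (j_mode _ _ _ _ J) as [K|(u & q & md & K)]; [assumption|].
    destruct K. congruence. }
  destruct C as [C|C]; rewrite C in *; destruct Sp as (S1 & S2 & S3 & S4).
  - auto 10.
  - split; [unfold posted, sep in *; tauto|]. auto 10.
Qed.

Lemma swap_W : swap -> gs W' = All /\ gv W' = gv W /\ yf W' = false /\ lr (gl W') = false /\
  lm (gl W') = true /\ lp (gl W') = 0 /\ lt (gl W') = 0 /\
  ll (gl W') = next_lab (gl W) /\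
  lc (gl W') = bump_count (mR w (wbs s (gv W))) (lc (gl W)) /\
  lead_w G W R (wbs s (gv W)) =
    set_mR w (match jW with SwapL => set_nt (wbs s (gv W)) (Some (lm (gl W), lt (gl W)))
                          | _ => wbs s (gv W) end) (Mk (next_lab (gl W)) None 0).
Proof.
  intros (A & B & C). destruct (W_All G bh pr s w J A) as (A1 & A2 & _ & A4 & A5).
  assert (gs W' = All) as A5'.
  { revert A5. unfold try_port. apply Nat.eqb_neq in B. rewrite B.
    destruct C as [C|C]; rewrite C; auto. }
  rewrite A1, A2, A4, A5'.
  destruct C as [C|C].
  - destruct (lead_swapP G W R (wbs s (gv W)) A B C) as [L1 L2]. rewrite L1, L2, C.
    unfold new_run. simpl. rewrite (lgW _ _ _ _ J). auto 12.
  - destruct (lead_swapL G W R (wbs s (gv W)) A B C) as [L1 L2]. rewrite L1, L2, C.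
    unfold new_run. simpl. rewrite (lgW _ _ _ _ J).
    replace (mR w (set_nt (wbs s (gv W)) (Some (lm (gl W), lt (gl W))))) with (mR w (wbs s (gv W)))
      by (destruct w; reflexivity). auto 12.
Qed.

Lemma swap_R_Out : swap -> gs R = Out ->
  gl R' = take_role V (gl R) 2 /\ gv R' = gv R /\ yf R' = false /\
  gs R' = (if (lp (gl R) =? 2) && pr (gv R) (lt (gl R))
           then if far G R =? bh then Lost else Back else Out).
Proof.
  intros (A & _) E. destruct (next_R G bh pr s w J) as (b & -> & _).
  destruct (sep_far G bh wfG _ _ (j_ok _ _ _ _ J (negb w))) as (_ & _ & _ & F & _); [left; assumption|].
  assert (O : opposed_b G R W = false).
  { apply not_true_iff_false. intro O.
    apply (opposed_b_iff G bh wfG (negb w)) in O; rewrite ?negb_involutive; try apply (j_ok _ _ _ _ J).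
    destruct O as (_ & O & _). congruence. }
  unfold gnext. rewrite E. unfold opposed_b in O. rewrite E in O. rewrite O.
  unfold lead_l. rewrite lead_Out by assumption. simpl fst.
  destruct (_ && _); simpl; auto.
Qed.

Lemma swap_R_Back : gs R = Back ->
  gl R' = take_role V (gl R) 3 /\
  yf R' = flagged (aview G R W (far G R)) (ye R) (yn R) (mid_wbs G s (far G R)) /\
  if (lp (gl R) =? 3) && pr (gv R) (lt (gl R))
  then gs R' = All /\ gv R' = far G R /\ ge R' = Some (near G R)
  else gs R' = Back /\ gv R' = gv R.
Proof.
  intros E. destruct (next_R G bh pr s w J) as (b & -> & ->).
  destruct (sep_far G bh wfG _ _ (j_ok _ _ _ _ J (negb w))) as (_ & _ & _ & F & _); [right; assumption|].
  unfold gnext. rewrite E.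
  unfold lead_l. rewrite lead_Back by assumption. simpl fst.
  destruct (_ && _); simpl; auto 10.
Qed.

Lemma swap_worker_on p v : swap -> v <> gv W \/ p <> lt (gl W) ->
  worker_on (aview G R W v) (Some p) = false.
Proof.
  intros (A & _) D. apply not_true_iff_false. intro H.
  apply (worker_on_spec G bh wfG w) in H; [|apply (j_ok _ _ _ _ J)|apply (j_live _ _ _ _ J)].
  destruct H as (_ & (_ & H) & _ & H2). destruct D; congruence.
Qed.

Lemma swap_worker_on_true : swap -> worker_on (aview G R W (gv W)) (Some (lt (gl W))) = true.
Proof.
  intros S. assert (A := swap_sep S). destruct S as (S1 & S2 & _). destruct A as (_ & A & _).
  apply (worker_on_spec G bh wfG w); [apply (j_ok _ _ _ _ J)|apply (j_live _ _ _ _ J)|].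
  repeat split; auto.
Qed.

Lemma swap_take p : swap -> take_role V (gl R) p =
  match jW with
  | SwapP => Ld (lg (gl R)) true (lm (gl W)) p (lt (gl R)) (ll (gl R)) (lc (gl R))
  | _ => Ld (lg (gl R)) false (lm (gl R)) p (lt (gl R)) (ll (gl R)) (lc (gl R))
  end.
Proof.
  intro S. destruct (swap_sep S) as (A & _ & _ & [(E & E1 & E2)|(E & E1 & E2 & E3)]); rewrite E.
  - unfold take_role. rewrite E2, E1. pose proof (swap_worker_on_true S) as T.
    rewrite T, (j_role _ _ _ _ J). simpl. rewrite Nat.eqb_refl. reflexivity.
  - destruct (sep_far G bh wfG _ _ (j_ok _ _ _ _ J (negb w)) A) as (_ & _ & _ & F & _).
    rewrite take_role_id; [rewrite (j_role _ _ _ _ J); reflexivity|].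
    intros _. apply swap_worker_on; [assumption|]. left. congruence.
Qed.

Lemma swap_nt z : swap -> nt (wbs s' z) =
  match jW with
  | SwapL => if z =? gv W then Some (lm (gl W), lt (gl W)) else None
  | _ => None
  end.
Proof.
  intro S. destruct (swap_sep S) as (_ & _ & (_ & _ & N) & C).
  destruct (swap_W S) as (_ & _ & _ & _ & _ & _ & _ & _ & _ & E).
  rewrite (nt_next G bh pr s w J z). destruct (Nat.eqb_spec z (gv W)) as [->|NE].
  - rewrite E, nt_set. destruct C as [(C & _)|(C & _)]; rewrite C; [apply N|reflexivity].
  - rewrite N. destruct jW; reflexivity.
Qed.

(** The former runner carries the search, openly if its leader is here and through the note if only
    a scout is. The former worker restarts whole, so the clauses about a separated runner hold
    vacuously. *)
Lemma joint_swap : swap -> (forall g, live (gr s' g)) -> joint G bh s' (negb w).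
Proof.
  intros S L. destruct (swap_W S) as (A1 & A2 & A3 & A4 & A5 & A6 & A7 & _).
  destruct (swap_sep S) as (SR & Er & (_ & Yf & N) & C).
  destruct (sep_far G bh wfG _ _ (j_ok _ _ _ _ J (negb w)) SR) as (K1 & K2 & K3 & K4 & K5 & K6 & K7).
  assert (NW : ~ sep W') by (intros [K|K]; congruence).
  constructor; rewrite ?negb_involutive; auto using next_ok, next_back; try contradiction.
  - intro g. destruct (bool_dec g w) as [->|Ng]; [lia|].
    assert (g = negb w) by (destruct g, w; congruence || reflexivity). subst g.
    destruct SR as [E|E].
    + destruct (swap_R_Out S E) as (B & _). rewrite B.
      destruct (take_role_fix V (gl R) 2) as (_ & T & _). lia.
    + destruct (swap_R_Back E) as (B & _). rewrite B.
      destruct (take_role_fix V (gl R) 3) as (_ & T & _). lia.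
  - destruct C as [(E & E1 & E2)|(E & E1 & E2 & E3)].
    + left.
      assert (lr (gl R') = true /\ yf R' = false) as [X1 X2].
      { destruct SR as [ER|ER].
        - destruct (swap_R_Out S ER) as (B1 & _ & B3 & _). rewrite B1, B3, swap_take, E by assumption.
          auto.
        - destruct (swap_R_Back ER) as (B1 & B2 & _). rewrite B1, B2, swap_take, E by assumption.
          split; [reflexivity|]. unfold flagged. apply orb_false_iff. split.
          + pose proof (j_role _ _ _ _ J) as H. pose proof (j_flag _ _ _ _ J) as H0.
            destruct (mid_nt G s w (ndW _ _ _ _ J) (ndR _ _ _ _ J) (lgW _ _ _ _ J)
                        (lgR _ _ _ _ J) H H0 (far G R)) as [K|[K _]]; [|congruence].
            rewrite K, N. reflexivity.
          + apply andb_false_iff. right.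
            destruct (j_ok _ _ _ _ J (negb w)) as (_ & _ & _ & O). rewrite ER in O.
            destruct O as (_ & _ & _ & Y). rewrite Y. apply swap_worker_on; [assumption|].
            left. congruence. }
      split; [assumption|]. split; [assumption|].
      intro z. rewrite swap_nt, E by assumption. reflexivity.
    + right. exists (gv W), (lt (gl W)), (lm (gl W)).
      assert (Sw := S). destruct Sw as (AW & PW & _).
      unfold pending. rewrite !swap_nt, E, Nat.eqb_refl by assumption.
      destruct (j_ok _ _ _ _ J w) as (_ & Hn & Nb & _).
      cut (lr (gl R') = false /\
         ((sep R' /\ (gs R' = Out -> lp (gl R') = 2) /\ far G R' = gv W /\ near G R' = lt (gl W) /\
           (gs R' = Back -> lp (gl R') = 3 -> yf R' = true)) \/
          (gs R' = All /\ lp (gl R') = 3 /\ gv R' = gv W /\ ge R' = Some (lt (gl W)) /\ yf R' = true))).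
      { intros [X1 X2]. repeat split; auto.
        - rewrite <- E2, <- E3. assumption.
        - intros z Hz. rewrite swap_nt, E by assumption. apply Nat.eqb_neq in Hz.
          rewrite Hz. reflexivity. }
      destruct E1 as [[ER P]|[ER P]].
      * destruct (swap_R_Out S ER) as (B1 & B2 & B3 & B4).
        unfold sep, far, near. rewrite B1, B2, B4, swap_take, E by assumption.
        cbn [lg lr lm lp lt ll lc]. fold (far G R) (near G R). split; [reflexivity|]. left.
        destruct (_ && _); [destruct (Nat.eqb_spec (far G R) bh); [congruence|]|];
          repeat split; auto; discriminate.
      * destruct (swap_R_Back ER) as (B1 & B2 & B3).
        assert (F : yf R' = true).
        { rewrite B2. unfold flagged. apply orb_true_iff. right.
          destruct (j_ok _ _ _ _ J (negb w)) as (_ & _ & _ & O). rewrite ER in O.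
          destruct O as (_ & _ & _ & Y). fold (near G R) in Y.
          rewrite (j_back _ _ _ _ J (negb w) ER), P, Y, E2, E3. simpl.
          apply swap_worker_on_true. assumption. }
        unfold sep, far, near. rewrite F, B1, swap_take, E by assumption.
        cbn [lg lr lm lp lt ll lc]. split; [reflexivity|].
        destruct (_ && _).
        -- right. destruct B3 as (B3 & B4 & B5). rewrite B4, B5, E2, E3. auto.
        -- left. destruct B3 as (B3 & B4). rewrite B4. fold (far G R) (near G R).
           split; [right; assumption|]. split; [congruence|]. auto.
Qed.

Lemma joint_next : (forall g, live (gr s' g)) -> exists w', joint G bh s' w'.
Proof.
  intro L.
  assert (swap \/ ~ swap) as [S|S].
  { unfold swapping. destruct (gs W); try (right; intros (? & _); discriminate).
    destruct (Nat.eq_dec (lp (gl W)) 3); [right; tauto|].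
    destruct jW; try (right; intros (_ & _ & [?|?]); discriminate); left; auto. }
  - exists (negb w). apply joint_swap; assumption.
  - exists w. apply joint_stay; assumption.
Qed.

End Step.

(** * Progress of the two searches *)

Section Walk.
Variables (G : Graph) (bh : nat).
Hypothesis wfG : wf_graph G.

Notation dfs := (dfs_inv G bh).

Definition upd_mark (mk : nat -> mark) (v : nat) (m : mark) : nat -> mark :=
  fun z => if z =? v then m else mk z.

Lemma upd_same mk v m : upd_mark mk v m v = m.
Proof. unfold upd_mark. rewrite Nat.eqb_refl. reflexivity. Qed.
Lemma upd_other mk v m z : z <> v -> upd_mark mk v m z = mk z.
Proof. unfold upd_mark. intro N. apply Nat.eqb_neq in N. rewrite N. reflexivity. Qed.

Lemma cur_set l w m : cur_mark l (set_mark l w m) = m.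
Proof. unfold cur_mark, set_mark. destruct (lr l); [reflexivity|apply mR_set_same]. Qed.

Definition pointing (v : nat) (l : ldr) : dstate := if lm l then PF v (lt l) else PB v (lt l).

Lemma dfs_ext mk mk' l full sk tr d : (forall z, mk' z = mk z) ->
  dfs mk l full sk tr d -> dfs mk' l full sk tr d.
Proof.
  intros K (s & D1 & D2). exists s. split.
  - destruct D1 as [X1 X2 X3 X4 X5 X6 X7]. constructor; auto.
    + intros z. rewrite K. auto.
    + intros z Hz. rewrite K. auto.
    + apply (stack_change G mk); auto.
    + intros F0 z. rewrite K. auto.
    + intros z p. rewrite !K. auto.
    + intros z i. rewrite K. auto.
  - destruct d; rewrite ?K; exact D2.
Qed.

(* The leader at v has settled its next port, within the same search. *)
Definition settled (mk : nat -> mark) full sk tr (v : nat) (l l' : ldr) (w' : board) : Prop :=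
  lg l' = lg l /\ lr l' = lr l /\ ll l' = ll l /\ lp l' = 0 /\
  dfs (upd_mark mk v (cur_mark l w')) (cur_lab l) full sk tr (pointing v l') /\
  mu G (upd_mark mk v (cur_mark l w')) (cur_lab l) (lm l') < mu G mk (cur_lab l) (lm l) /\
  ((lab (mk v) <> cur_lab l /\ lab (cur_mark l w') = cur_lab l /\
    lc l' = if lr l then lc l else bump_count (mk v) (lc l)) \/
   (lab (mk v) = cur_lab l /\ lab (cur_mark l w') = lab (mk v) /\ lc l' = lc l)).

(** The marks are left existential because this only serves to derive a contradiction from
    [dfs_complete]. *)
Definition exhausted (l : ldr) full sk tr (v : nat) : Prop :=
  exists mk, ready G bh mk (cur_lab l) full sk tr v /\
    (full -> forall z, lab (mk z) = cur_lab l -> ptr (mk z) = deg G z).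

Definition restarted (w : board) (l l' : ldr) (w' : board) : Prop :=
  l' = Ld (lg l) false true 0 0 (next_lab l) (bump_count (mR (lg l) w) (lc l)) /\
  w' = set_mR (lg l) w (Mk (next_lab l) None 0).

Lemma proceed_spec mk full sk tr l v w m :
  ready G bh (upd_mark mk v m) (cur_lab l) full sk tr v ->
  let p := proceed (deg G v) l w m in
  (lg (fst p) = lg l /\ lr (fst p) = lr l /\ ll (fst p) = ll l /\ lp (fst p) = 0 /\
   lc (fst p) = lc l /\ snd p = set_mark l w m /\
   dfs (upd_mark mk v m) (cur_lab l) full sk tr (pointing v (fst p))) \/
  (par m = None /\ exhausted l full sk tr v /\
   (lr l = false -> restarted (set_mark l w m) l (fst p) (snd p))).
Proof.
  intros H p. subst p. pose proof (dfs_next G bh _ _ full sk tr v H) as N.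
  rewrite upd_same in N. unfold proceed.
  destruct (nx (deg G v) m) as [[[] q]|] eqn:E.
  - left. unfold point, pointing. simpl. auto 10.
  - left. unfold point, pointing. simpl. auto 10.
  - right. split.
    + unfold nx in E. destruct (_ <? _); [discriminate|]. destruct (par m); congruence.
    + split; [exists (upd_mark mk v m); auto|]. intro R. rewrite R. unfold restarted. auto.
Qed.

(** The last alternative arises only on a return, a node just entered having a parent to go back to.
    So [v] already has the label, and restarting from [w] itself gives the right count. *)
Lemma arrive_spec mk full sk tr l w v j : v < gn G -> v <> bh -> mk v = cur_mark l w ->
  dfs mk (cur_lab l) full sk tr (if lm l then AF v j else AB v j) ->
  let p := arrive (deg G v) (Some j) false l w in
  settled mk full sk tr v l (fst p) (snd p) \/
  (exhausted l full sk tr v /\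
   (lr l = false -> lab (mk v) = cur_lab l /\ restarted w l (fst p) (snd p))).
Proof.
  intros Hv Nb Em D p. subst p. unfold arrive. destruct (lm l) eqn:M.
  - rewrite <- Em. destruct (Nat.eqb_spec (lab (mk v)) (cur_lab l)) as [L|L].
    + left. unfold settled, point, pointing. simpl.
      assert (U : forall z, upd_mark mk v (cur_mark l w) z = mk z).
      { intro z. unfold upd_mark. destruct (Nat.eqb_spec z v); congruence. }
      assert (D' : dfs mk (cur_lab l) full sk tr (PB v j)) by (apply dfs_bounce; assumption).
      repeat split; auto.
      * apply (dfs_ext mk); assumption.
      * unfold mu. rewrite (sumn_ext (rem G (upd_mark mk v (cur_mark l w)) (cur_lab l)) (rem G mk (cur_lab l))).
        -- rewrite M. simpl. lia.
        -- intros z _. unfold rem. rewrite U. reflexivity.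
      * right. rewrite <- Em. auto.
    + set (l1 := Ld (lg l) (lr l) true (lp l) (lt l) (ll l)
                    (if lr l then lc l else bump_count (mk v) (lc l))).
      assert (RD : ready G bh (upd_mark mk v (Mk (cur_lab l1) (Some j) 0)) (cur_lab l1) full sk tr v).
      { apply dfs_enter with (mk := mk) (j := j); auto using upd_same.
        intros z N. apply upd_other. assumption. }
      destruct (proceed_spec mk full sk tr l1 v w (Mk (cur_lab l1) (Some j) 0) RD)
        as [(A1 & A2 & A3 & A4 & A5 & A6 & A7)|(A & _)]; [|discriminate].
      left. change (cur_lab l) with (cur_lab l1) at 2.
      unfold settled. change (cur_mark l) with (cur_mark l1).
      rewrite A6, cur_set. repeat split; auto.
      eapply mu_enter; eauto using upd_same. intros z N. apply upd_other. assumption.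
  - rewrite <- Em.
    assert (D0 := D). destruct D0 as (s & D1 & D2 & D3 & t & -> & D5).
    assert (L : lab (mk v) = cur_lab l) by (apply (dfs_in _ _ _ _ _ _ _ _ D1); left; reflexivity).
    assert (RD : ready G bh (upd_mark mk v (advance (deg G v) (mk v))) (cur_lab l) full sk tr v).
    { apply dfs_return with (mk := mk) (j := j); auto using upd_same.
      intros z N. apply upd_other. assumption. }
    destruct (proceed_spec mk full sk tr l v w _ RD)
        as [(A1 & A2 & A3 & A4 & A5 & A6 & A7)|(_ & A & B)].
    + left. unfold settled. rewrite A6, cur_set. repeat split; auto.
      * rewrite M. subst j. eapply mu_advance; eauto using upd_same.
        intros z N. apply upd_other. assumption.
    + right. split; [assumption|]. intro R. split; [assumption|].
      destruct (B R) as [B1 B2]. unfold restarted. rewrite B1, B2.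
      unfold set_mark. rewrite R, mR_set_same, set_set. unfold cur_mark in Em. rewrite R in Em.
      rewrite <- Em. unfold bump_count. simpl. auto.
Qed.

Lemma give_spec mk full sk tr l w v : v < gn G -> v <> bh -> mk v = cur_mark l w ->
  lr l = false -> dfs mk (cur_lab l) full sk tr (pointing v l) ->
  (lm l = true -> sk v (lt l)) ->
  let p := abandon (deg G v) l w in
  settled mk full sk tr v l (fst p) (snd p) \/
  ((exhausted l full sk tr v \/ lm l = false) /\
   lab (mk v) = cur_lab l /\ restarted w l (fst p) (snd p)).
Proof.
  intros Hv Nb Em R D SK p. subst p. unfold abandon, pointing in *. destruct (lm l) eqn:M.
  - rewrite <- Em.
    assert (D0 := D). destruct D0 as (s & D1 & t & -> & D5 & D6).
    assert (L : lab (mk v) = cur_lab l) by (apply (dfs_in _ _ _ _ _ _ _ _ D1); left; reflexivity).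
    assert (RD : ready G bh (upd_mark mk v (advance (deg G v) (mk v))) (cur_lab l) full sk tr v).
    { apply dfs_skip with (mk := mk) (p := lt l); auto using upd_same.
      intros z N. apply upd_other. assumption. }
    destruct (proceed_spec mk full sk tr l v w _ RD)
        as [(A1 & A2 & A3 & A4 & A5 & A6 & A7)|(_ & A & B)].
    + left. unfold settled. rewrite A6, cur_set. repeat split; auto.
      rewrite D5 in D6. eapply mu_advance; eauto using upd_same.
      intros z N. apply upd_other. assumption.
    + right. split; [auto|]. split; [assumption|].
      destruct (B R) as [B1 B2]. unfold restarted. rewrite B1, B2.
      unfold set_mark. rewrite R, mR_set_same, set_set. unfold cur_mark in Em. rewrite R in Em.
      rewrite <- Em. unfold bump_count. simpl. auto.
  - right. split; [auto|]. split.
    + destruct D as (s & _ & D & _). exact D.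
    + unfold restarted, new_run. auto.
Qed.

End Walk.

(** * Labels in use and their potential *)

Section Labels.
Variables (G : Graph) (bh : nat).

Definition marked (mk : nat -> mark) : nat :=
  sumn (fun z => if lab (mk z) =? 0 then 0 else 1) (gn G).
Definition ahead (mk : nat -> mark) (l : nat) : nat :=
  sumn (fun z => if l <? lab (mk z) then 1 else 0) (gn G).
(** [ahead] counts the nodes on which a later label may still be found. When the next label is, the
    label grows by 1 and [ahead] loses at least 1: the weight 2 makes this a decrease. *)
Definition psi (mk : nat -> mark) (l : nat) : nat := 2 * ahead mk l + l.

Definition labels_ok (mk : nat -> mark) (l : ldr) : Prop :=
  lc l = marked mk /\ ll l <= 2 * lc l + 2 /\
  forall z, lab (mk z) <> 0 -> z < gn G /\ z <> bh /\ ptr (mk z) <= deg G z.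

Lemma labels_same mk mk' l l' v : (forall z, z <> v -> mk' z = mk z) ->
  lab (mk' v) = lab (mk v) -> (lab (mk' v) <> 0 -> ptr (mk' v) <= deg G v) ->
  ll l' = ll l -> lc l' = lc l ->
  labels_ok mk l -> labels_ok mk' l' /\ psi mk' (ll l') = psi mk (ll l).
Proof.
  intros O L P E1 E2 (H1 & H2 & H3).
  assert (A : forall z, lab (mk' z) = lab (mk z)).
  { intro z. destruct (Nat.eq_dec z v) as [->|N]; [assumption|rewrite O; auto]. }
  split.
  - unfold labels_ok. rewrite E1, E2. split; [|split; [assumption|]].
    + rewrite H1. apply sumn_ext. intros z _. rewrite A. reflexivity.
    + intros z Hz. destruct (Nat.eq_dec z v) as [->|N].
      * rewrite L in *. specialize (H3 v Hz). intuition.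
      * rewrite O in * by assumption. auto.
  - unfold psi, ahead. rewrite E1. do 2 f_equal. apply sumn_ext. intros z _. rewrite A. reflexivity.
Qed.

Lemma labels_enter mk mk' l l' v : v < gn G -> v <> bh -> (forall z, z <> v -> mk' z = mk z) ->
  1 <= ll l -> lab (mk' v) = ll l -> ptr (mk' v) <= deg G v ->
  ll l' = ll l -> lc l' = bump_count (mk v) (lc l) ->
  labels_ok mk l -> labels_ok mk' l' /\ psi mk' (ll l') <= psi mk (ll l).
Proof.
  intros Hv Nb O L1 L P E1 E2 (H1 & H2 & H3). split.
  - unfold labels_ok. rewrite E1, E2.
    assert (K : sumn (fun z => if lab (mk' z) =? 0 then 0 else 1) (gn G) +
                (if lab (mk v) =? 0 then 0 else 1) =
                sumn (fun z => if lab (mk z) =? 0 then 0 else 1) (gn G) +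
                (if lab (mk' v) =? 0 then 0 else 1)).
    { apply (sumn_upd (fun z => if lab (mk z) =? 0 then 0 else 1)
               (fun z => if lab (mk' z) =? 0 then 0 else 1)); auto.
      intros z _ N. rewrite O by assumption. reflexivity. }
    unfold marked in *. rewrite L in K. destruct (Nat.eqb_spec (ll l) 0); [lia|].
    unfold bump_count. split; [|split].
    + destruct (lab (mk v) =? 0); lia.
    + destruct (lab (mk v) =? 0); lia.
    + intros z Hz. destruct (Nat.eq_dec z v) as [->|N]; [auto|].
      rewrite O in * by assumption. auto.
  - unfold psi, ahead. rewrite E1.
    cut (sumn (fun z => if ll l <? lab (mk' z) then 1 else 0) (gn G) <=
         sumn (fun z => if ll l <? lab (mk z) then 1 else 0) (gn G)); [lia|].
    apply sumn_le. intros z _. destruct (Nat.eq_dec z v) as [->|N].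
    + rewrite L, Nat.ltb_irrefl. lia.
    + rewrite O by assumption. lia.
Qed.

Lemma next_lab_new l : next_lab l <> ll l /\ 1 <= next_lab l.
Proof. unfold next_lab. destruct (Nat.leb_spec (2 * lc l + 2) (ll l)); lia. Qed.

(* Either no other node carries the new label, or psi decreases: labels are reused only after
   psi has grown enough, the labels running up to twice the number of marked nodes. *)
Lemma labels_restart mk mk' l l' v : v < gn G -> v <> bh -> (forall z, z <> v -> mk' z = mk z) ->
  mk' v = Mk (next_lab l) None 0 -> ll l' = next_lab l -> lc l' = bump_count (mk v) (lc l) ->
  labels_ok mk l ->
  labels_ok mk' l' /\
  ((psi mk' (ll l') <= psi mk (ll l) + 1 /\ forall z, z <> v -> lab (mk' z) <> next_lab l) \/
   psi mk' (ll l') < psi mk (ll l)).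
Proof.
  intros Hv Nb O L E1 E2 (H1 & H2 & H3).
  assert (LB : lab (mk' v) = next_lab l) by (rewrite L; reflexivity).
  split.
  - unfold labels_ok. rewrite E1, E2.
    assert (K : sumn (fun z => if lab (mk' z) =? 0 then 0 else 1) (gn G) +
                (if lab (mk v) =? 0 then 0 else 1) =
                sumn (fun z => if lab (mk z) =? 0 then 0 else 1) (gn G) +
                (if lab (mk' v) =? 0 then 0 else 1)).
    { apply (sumn_upd (fun z => if lab (mk z) =? 0 then 0 else 1)
               (fun z => if lab (mk' z) =? 0 then 0 else 1)); auto.
      intros z _ N. rewrite O by assumption. reflexivity. }
    unfold marked in *. rewrite LB in K. destruct (next_lab_new l) as [_ NL].
    destruct (Nat.eqb_spec (next_lab l) 0); [lia|].
    assert (next_lab l <= 2 * lc l + 2).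
    { unfold next_lab. destruct (Nat.leb_spec (2 * lc l + 2) (ll l)); lia. }
    unfold bump_count. split; [|split].
    + destruct (lab (mk v) =? 0); lia.
    + destruct (lab (mk v) =? 0); lia.
    + intros z Hz. destruct (Nat.eq_dec z v) as [->|N].
      * rewrite L. simpl. repeat split; auto; lia.
      * rewrite O in * by assumption. auto.
  - rewrite E1. unfold next_lab in *. destruct (Nat.leb_spec (2 * lc l + 2) (ll l)) as [Wr|Wr].
    (* Wrap-around: with c marked nodes, at most c labels exceed 1, so the new [psi] is at most 2c +
       1, below the old label, which is at least 2c + 2. *)
    + right. unfold psi, ahead.
      assert (sumn (fun z => if 1 <? lab (mk' z) then 1 else 0) (gn G) <= marked mk); [|lia].
      apply sumn_le. intros z _. destruct (Nat.eq_dec z v) as [->|N].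
      * rewrite LB. simpl. lia.
      * rewrite O by assumption. destruct (Nat.ltb_spec 1 (lab (mk z))); [|lia].
        destruct (Nat.eqb_spec (lab (mk z)) 0); lia.
    + set (f := fun z => if ll l <? lab (mk z) then 1 else 0).
      set (f' := fun z => if S (ll l) <? lab (mk' z) then 1 else 0).
      assert (FF : forall z, f' z <= f z).
      { intro z. unfold f, f'. destruct (Nat.eq_dec z v) as [->|N].
        - rewrite LB, Nat.ltb_irrefl. lia.
        - rewrite O by assumption.
          destruct (Nat.ltb_spec (S (ll l)) (lab (mk z))), (Nat.ltb_spec (ll l) (lab (mk z))); lia. }
      assert (LE : sumn f' (gn G) <= sumn f (gn G)) by (apply sumn_le; auto).
      destruct (existsb (fun z => negb (z =? v) && (lab (mk' z) =? S (ll l))) (seq 0 (gn G))) eqn:X.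
      (* The node [z] carrying the new label leaves [ahead]. *)
      * right. apply existsb_exists in X. destruct X as (z & I & Hz).
        apply andb_prop in Hz. destruct Hz as [N Lz]. apply negb_true_iff, Nat.eqb_neq in N.
        apply Nat.eqb_eq in Lz. apply in_seq in I.
        assert (sumn f' (gn G) < sumn f (gn G)).
        { assert (Zl : z < gn G) by lia.
          set (h := fun y => if y =? z then f' z else f y).
          assert (sumn f' (gn G) <= sumn h (gn G)).
          { apply sumn_le. intros y _. unfold h. destruct (Nat.eqb_spec y z) as [->|]; auto. }
          assert (sumn h (gn G) + f z = sumn f (gn G) + h z).
          { apply sumn_upd; auto. intros y _ Ny. unfold h. apply Nat.eqb_neq in Ny.
            rewrite Ny. reflexivity. }
          assert (h z = 0).
          { unfold h, f'. rewrite Nat.eqb_refl, Lz, Nat.ltb_irrefl. reflexivity. }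
          assert (f z = 1); [|lia].
          unfold f. rewrite <- (O z) by assumption. rewrite Lz.
          destruct (Nat.ltb_spec (ll l) (S (ll l))); lia. }
        unfold psi, ahead. fold f f'. lia.
      * left. unfold psi, ahead. fold f f'. split; [lia|]. intros z N Lz.
        assert (Zl : z < gn G). { rewrite O in Lz by assumption. apply H3. lia. }
        rewrite <- not_true_iff_false in X. apply X. apply existsb_exists. exists z.
        split; [apply in_seq; lia|]. apply Nat.eqb_neq in N. rewrite N, Lz, Nat.eqb_refl.
        reflexivity.
Qed.

Lemma psi_bound mk l : psi mk l <= 2 * gn G + l.
Proof.
  unfold psi, ahead.
  assert (sumn (fun z => if l <? lab (mk z) then 1 else 0) (gn G) <= sumn (fun _ => 1) (gn G)).
  { apply sumn_le. intros z _. destruct (_ <? _); lia. }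
  rewrite sumn_const in H. lia.
Qed.

Lemma marked_bound mk : marked mk <= gn G.
Proof.
  unfold marked.
  assert (sumn (fun z => if lab (mk z) =? 0 then 0 else 1) (gn G) <= sumn (fun _ => 1) (gn G)).
  { apply sumn_le. intros z _. destruct (_ =? _); lia. }
  rewrite sumn_const in H. lia.
Qed.

End Labels.

Definition none2 (_ _ : nat) : Prop := False.
Definition all2 (_ _ : nat) : Prop := True.

Definition wm (s : state) (z : nat) : mark := mW (wbs s z).
Definition rm (s : state) (g : bool) (z : nat) : mark := mR g (wbs s z).

(** While the group is separated the search is still about to leave: it moves only when the leader
    crosses. *)
Definition located (me : grp) (d : dstate) : Prop :=
  match gs me with
  | All =>
      if lp (gl me) =? 3
      then exists j, ge me = Some j /\ d = if lm (gl me) then AF (gv me) j else AB (gv me) j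
      else d = pointing (gv me) (gl me)
  | _ => d = pointing (gv me) (gl me)
  end.

Definition tracks G bh (me : grp) mk l full sk tr : Prop :=
  exists d, located me d /\ dfs_inv G bh mk l full sk tr d.

(** * Descent of the patient search *)

Section Worker.
Variables (G : Graph) (bh : nat).
Hypothesis wfG : wf_graph G.
Hypothesis conn : connected_by G (fun _ _ => True).
Hypothesis bhn : bh < gn G.

(** Stages left in the crossing of an edge. The gap between 12 and 7 holds the values of
    [rank_pend], so that handing the search over is a decrease. An opposed launch ranks like a
    failed attempt, since the exchange makes the group whole again. *)
Definition rank_hold (W R : grp) : nat :=
  match gs W with
  | All => if lp (gl W) =? 3 then 2 else if lp (gl W) =? 0 then 12 else 7
  | Out => if lp (gl W) =? 1 then if opposed_b G W R then 7 else 6 else 5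
  | Back => if lp (gl W) =? 2 then 4 else 3
  | _ => 0
  end.

Definition rank_pend (W : grp) : nat :=
  match gs W with
  | Out => 11
  | Back => if lp (gl W) =? 2 then 10 else 9
  | _ => 8
  end.

(** One unit of [mu] is worth 16, more than any rank, so settling on a new port pays for the renewed
    rank. *)
Inductive work (s : state) (w : bool) : nat -> Prop :=
| work_hold : holding s (gr s w) -> tracks G bh (gr s w) (wm s) 1 True none2 all2 ->
    work s w (16 * mu G (wm s) 1 (lm (gl (gr s w))) + rank_hold (gr s w) (gr s (negb w)))
| work_pend u q md : pending G bh s (gr s w) u q md ->
    dfs_inv G bh (wm s) 1 True none2 all2 (if md then PF u q else PB u q) ->
    work s w (16 * mu G (wm s) 1 md + rank_pend (gr s w)).

Section Step.
Variables (pr : nat -> nat -> bool) (s : state) (w : bool).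
Hypothesis pr_deg : forall v p, pr v p = true -> p < deg G v.
Hypothesis pr_sym : forall v p, v < gn G -> p < deg G v -> pr (nb G v p) (bp G v p) = pr v p.
Hypothesis J : joint G bh s w.

Notation W := (gr s w).
Notation R := (gr s (negb w)).
Notation s' := (next G bh pr s).
Notation W' := (gr s' w).
Notation R' := (gr s' (negb w)).
Notation jW := (judge (aview G W R (gv W)) (gl W)).
Notation jR := (judge (aview G R W (gv R)) (gl R)).
Notation swap := (swapping G s w).
Hypothesis L : forall g, live (gr s' g).

Lemma wm_next z : wm s' z = if z =? gv W then mW (lead_w G W R (wbs s z)) else wm s z.
Proof.
  pose proof (j_role _ _ _ _ J) as H. pose proof (j_flag _ _ _ _ J) as H0.
  unfold wm. destruct (board_W G bh pr s w (ndW _ _ _ _ J) (ndR _ _ _ _ J) (lgW _ _ _ _ J)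
     (lgR _ _ _ _ J) H H0 z) as [m ->].
  rewrite mW_set. destruct (z =? gv W); reflexivity.
Qed.

Lemma wm_keep : mW (lead_w G W R (wbs s (gv W))) = mW (wbs s (gv W)) ->
  forall z, wm s' z = wm s z.
Proof.
  intros E z. rewrite wm_next. destruct (Nat.eqb_spec z (gv W)) as [->|]; [assumption|reflexivity].
Qed.

Lemma mu_ext mk mk' l md : (forall z, mk' z = mk z) -> mu G mk' l md = mu G mk l md.
Proof.
  intro E. unfold mu. do 2 f_equal. apply sumn_ext. intros z _. unfold rem. rewrite E. reflexivity.
Qed.

Lemma sep_keep : sep W -> forall z, wm s' z = wm s z.
Proof.
  intros S. apply wm_keep.
  rewrite lead_sep; [reflexivity|assumption|apply (sep_far G bh wfG _ _ (j_ok _ _ _ _ J w) S)].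
Qed.

(** What is known in the rounds without progress of the worker: its edge is missing, or it waits for
    an unpublished scout, or both X scouts are being launched onto its edge or exchanged there. *)
Definition held : Prop :=
  gv W' = gv W /\ lt (gl W') = lt (gl W) /\ lt (gl W) < deg G (gv W) /\
  ((pr (gv W) (lt (gl W)) = false /\ lt (gl W) < deg G (gv W) /\
    (gs W = All -> lp (gl W) = 1 \/ lp (gl W) = 2) /\ (sep W -> posted W)) \/
   (idle R /\ gs W = All) \/ (opposed G W' R' /\ gs R = All) \/ opposed G W R).

Lemma pointing_ok me mk l full sk tr d : located me d -> dfs_inv G bh mk l full sk tr d ->
  gs me <> All \/ lp (gl me) <> 3 ->
  d = pointing (gv me) (gl me) /\ lt (gl me) < deg G (gv me).
Proof.
  intros Ld D C. assert (d = pointing (gv me) (gl me)) as ->.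
  { unfold located in Ld. destruct (gs me); auto.
    destruct (Nat.eqb_spec (lp (gl me)) 3); [destruct C; congruence|assumption]. }
  split; [reflexivity|]. unfold pointing in D. destruct D as (st & D1 & D2).
  destruct (lm (gl me)).
  - destruct D2 as (t & _ & _ & D2). assumption.
  - apply D2.
Qed.

Lemma cross_tracks me me' mk mk' l full sk tr : (forall z, mk' z = mk z) ->
  tracks G bh me mk l full sk tr -> gs me <> All ->
  gs me' = All -> lp (gl me') = 3 -> lm (gl me') = lm (gl me) ->
  gv me' = far G me -> ge me' = Some (near G me) -> tr (far G me) (near G me) ->
  tracks G bh me' mk' l full sk tr.
Proof.
  intros E (d & Ld & D) N A1 A2 A3 A4 A5 T.
  destruct (pointing_ok me mk l full sk tr d Ld D) as [-> _]; [left; assumption|].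
  exists (if lm (gl me) then AF (far G me) (near G me) else AB (far G me) (near G me)). split.
  - unfold located. rewrite A1, A2, A3, A4. simpl. eauto.
  - apply (dfs_ext G bh mk); [assumption|]. unfold pointing in D. unfold far, near in *.
    destruct (lm (gl me)); [apply dfs_crossF|apply dfs_crossB]; assumption.
Qed.

Lemma keep_tracks me me' mk mk' l full sk tr : (forall z, mk' z = mk z) ->
  tracks G bh me mk l full sk tr -> gs me <> All \/ lp (gl me) <> 3 ->
  gs me' <> All \/ lp (gl me') <> 3 -> lm (gl me') = lm (gl me) ->
  gv me' = gv me -> lt (gl me') = lt (gl me) -> tracks G bh me' mk' l full sk tr.
Proof.
  intros E (d & Ld & D) N N' A3 A4 A5.
  destruct (pointing_ok me mk l full sk tr d Ld D N) as [-> _].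
  exists (pointing (gv me) (gl me)). split.
  - unfold located, pointing. rewrite A3, A4, A5. destruct (gs me'); auto.
    destruct (Nat.eqb_spec (lp (gl me')) 3); [destruct N'; congruence|reflexivity].
  - apply (dfs_ext G bh mk); assumption.
Qed.

Lemma hold_All : ~ swap -> holding s W -> tracks G bh W (wm s) 1 True none2 all2 -> gs W = All ->
  exists N, work s' w N /\
  (N < 16 * mu G (wm s) 1 (lm (gl W)) + rank_hold W R \/
   (N = 16 * mu G (wm s) 1 (lm (gl W)) + rank_hold W R /\ held)).
Proof.
  intros NS H T E.
  assert (H' : holding s' W') by (apply holding_stay; auto).
  destruct (W_All G bh pr s w J E) as (A1 & A2 & A3 & A4 & A5).
  destruct H as (Er & Ef & Nn).
  assert (CL : cur_lab (gl W) = 1) by (unfold cur_lab; rewrite Er; reflexivity).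
  assert (CM : forall b, cur_mark (gl W) b = mW b) by (intro b; unfold cur_mark; rewrite Er; reflexivity).
  destruct (j_ok _ _ _ _ J w) as (_ & Hn & Nb & _).
  destruct (Nat.eq_dec (lp (gl W)) 3) as [P|P].
  - destruct T as (d & Ld & D). unfold located in Ld. rewrite E, P in Ld. simpl in Ld.
    destruct Ld as (j & Ge & ->). rewrite <- CL in D.
    destruct (lead_arrive G W R (wbs s (gv W)) E P Ef) as [L1 L2].
    rewrite Ge in L1, L2.
    assert (Em : wm s (gv W) = cur_mark (gl W) (wbs s (gv W))) by (rewrite CM; reflexivity).
    destruct (arrive_spec G bh (wm s) True none2 all2 (gl W) (wbs s (gv W)) (gv W) j Hn Nb Em D)
      as [S|(X & _)].
    + rewrite <- L1, <- L2 in S. destruct S as (S1 & S2 & S3 & S4 & S5 & S6 & _).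
      rewrite <- A1 in *. rewrite CL, CM in *.
      assert (K : forall z, wm s' z = upd_mark (wm s) (gv W) (mW (lead_w G W R (wbs s (gv W)))) z).
      { intro z. rewrite wm_next. unfold upd_mark.
        destruct (Nat.eqb_spec z (gv W)) as [->|]; reflexivity. }
      assert (T' : try_port (aview G W R (gv W)) (gl W) (ge W) = None).
      { unfold try_port. rewrite P. simpl. rewrite Ef, andb_false_r. reflexivity. }
      rewrite T' in A5.
      eexists. split.
      * apply work_hold; [assumption|]. exists (pointing (gv W') (gl W')). split.
        -- unfold located. rewrite A5, S4. reflexivity.
        -- rewrite A2. apply (dfs_ext G bh _ _ _ _ _ _ _ K). assumption.
      * left. rewrite (mu_ext _ _ _ _ K). unfold rank_hold. rewrite A5, S4, E, P. cbn [Nat.eqb]. lia.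
    (* The patient search skips no port, so it cannot be exhausted in a connected graph. *)
    + exfalso. destruct X as (mk & X1 & X2).
      apply (dfs_complete G bh mk _ _ _ _ _ _ X1 (X2 I) conn bhn). intros z p [].
  - assert (NoSw : jW <> SwapP /\ jW <> SwapL).
    { split; intro K; apply NS; unfold swapping; auto. }
    pose proof (spec_W G bh wfG s w J) as Sp.
    assert (K : forall z, wm s' z = wm s z).
    { apply wm_keep. destruct (aview_All G W R E) as (_ & X & Y & FL).
      unfold lead_w, lead, leader_step. rewrite X, Y.
      destruct (Nat.eqb_spec (lp (gl W)) 3); [contradiction|].
      destruct jW; try reflexivity; destruct Sp; destruct NoSw; congruence. }
    destruct jW eqn:Ej.
    + destruct (lead_wait G W R (wbs s (gv W)) E P Ej) as [L1 _].
      destruct Sp as [[Sp _]|[Sp _]]; [|congruence].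
      assert (gs W' = All).
      { revert A5. unfold try_port. rewrite Ej. destruct (Nat.eqb_spec (lp (gl W)) 3); [contradiction|auto]. }
      rewrite L1 in A1. eexists. split.
      * apply work_hold; [assumption|].
        apply (keep_tracks W W' (wm s)); auto; rewrite ?A1; auto.
      * right. rewrite A1, (mu_ext _ _ _ _ K). unfold rank_hold. rewrite A1, E, H. split; [reflexivity|].
        split; [assumption|]. rewrite A1. split; [reflexivity|]. split.
        -- destruct T as (d & Ld & D). apply (pointing_ok W (wm s) 1 True none2 all2 d Ld D); auto.
        -- right. left. auto.
    + destruct Sp. congruence.
    + destruct NoSw. congruence.
    + destruct NoSw. congruence.
    + assert (T' : try_port (aview G W R (gv W)) (gl W) (ge W) = Some (lt (gl W))).
      { unfold try_port. rewrite Ej. destruct (Nat.eqb_spec (lp (gl W)) 3); [contradiction|auto]. }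
      assert (TC := try_W_clear G bh wfG s w J _ T' E).
      rewrite T' in A5. destruct A5 as (A5 & A6 & A7).
      assert (LM : lm (gl W') = lm (gl W)).
      { rewrite A1. destruct (aview_All G W R E) as (_ & X & Y & FL).
        unfold lead_l, lead, leader_step. rewrite X, Y, Ej.
        destruct (Nat.eqb_spec (lp (gl W)) 3); [contradiction|]. reflexivity. }
      assert (PD : lt (gl W) < deg G (gv W)).
      { destruct T as (d & Ld & D). apply (pointing_ok W (wm s) 1 True none2 all2 d Ld D); auto. }
      eexists. split.
      * apply work_hold; [assumption|].
        apply (keep_tracks W W' (wm s)); auto. right. lia.
      * rewrite LM, (mu_ext _ _ _ _ K). unfold rank_hold at 1 3. rewrite A5, A7.
        assert (RK : rank_hold W R = if lp (gl W) =? 0 then 12 else 7).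
        { unfold rank_hold. rewrite E. destruct (Nat.eqb_spec (lp (gl W)) 3); [contradiction|reflexivity]. }
        rewrite RK. destruct (pr (gv W) (lt (gl W))) eqn:Pr; cbn [Nat.eqb].
        -- destruct (opposed_b G W' R') eqn:Op.
           ++ destruct (lp (gl W) =? 0); [left; lia|]. right. split; [reflexivity|].
              split; [assumption|]. split; [assumption|]. split; [assumption|]. right. right. left.
              apply (opposed_b_iff G bh wfG w) in Op; try (apply next_ok with (w := w); assumption).
              split; [assumption|]. destruct Op as (O1 & O2 & O3 & O4).
              destruct (sep_R' G bh wfG pr s w J NS) as [(B1 & B2 & B3)|(B1 & _)]; [left; assumption| |assumption].
              exfalso. apply (TC B1). apply (on_edge_flip G bh wfG (negb w)); auto;
                [apply (j_ok _ _ _ _ J)|]. left. unfold far in O3. rewrite A2, A6 in *.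
              split; congruence.
           ++ left. destruct (lp (gl W) =? 0); lia.
        -- destruct (Nat.eqb_spec (lp (gl W)) 0) as [P0|P0]; [left; lia|]. right.
           split; [reflexivity|]. split; [assumption|]. split; [assumption|].
           split; [assumption|]. left. repeat split; auto.
           ++ intros _. pose proof (j_lp _ _ _ _ J w). lia.
           ++ intros [S|S]; congruence.
Qed.

Lemma hold_sep : holding s W -> tracks G bh W (wm s) 1 True none2 all2 -> sep W -> ~ swap ->
  exists N, work s' w N /\
  (N < 16 * mu G (wm s) 1 (lm (gl W)) + rank_hold W R \/
   (N = 16 * mu G (wm s) 1 (lm (gl W)) + rank_hold W R /\ held)).
Proof.
  intros H T S NS.
  assert (H' : holding s' W') by (apply holding_stay; auto).
  assert (K := sep_keep S).
  destruct (sep_far G bh wfG _ _ (j_ok _ _ _ _ J w) S) as (K1 & K2 & K3 & K4 & K5 & K6 & K7).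
  destruct (j_ok _ _ _ _ J w) as (_ & _ & _ & O).
  destruct S as [E|E]; rewrite E in O.
  - destruct (W_Out G bh wfG pr s w J E) as (A1 & A2 & A3 & A4).
    eexists. split.
    + apply work_hold; [assumption|]. apply (keep_tracks W W' (wm s)); auto; rewrite ?A1; simpl; auto.
      left. congruence.
    + rewrite (mu_ext _ _ _ _ K), A1. cbn [lm]. unfold rank_hold. rewrite A4, E, A1. cbn [lp].
      destruct (opposed_b G W R) eqn:Op.
      * apply (opposed_b_iff G bh wfG w) in Op; try apply (j_ok _ _ _ _ J).
        rewrite (joint_opposed_fresh G bh wfG s w J w Op). simpl.
        right. split; [reflexivity|]. unfold held. rewrite A1. split; [assumption|]. split; [reflexivity|]. auto.
      * destruct O as (_ & [P|P] & _); rewrite P in *; cbn [Nat.eqb andb] in *.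
        -- left. lia.
        -- destruct (pr (gv W) (lt (gl W))) eqn:Pr.
           ++ left. destruct (Nat.eqb_spec (far G W) bh); [|lia].
              destruct (L w) as [L1 _]. congruence.
           ++ right. split; [reflexivity|]. unfold held. rewrite A1, A2.
              split; [reflexivity|]. split; [reflexivity|]. split; [assumption|]. left. unfold posted.
              repeat split; auto; congruence.
  - destruct (W_Back G bh wfG pr s w J E) as (A1 & _ & A3).
    destruct O as (_ & P & _).
    destruct ((lp (gl W) =? 3) && pr (gv W) (lt (gl W))) eqn:C.
    + destruct A3 as (A3 & A4 & A5). eexists. split.
      * apply work_hold; [assumption|].
        apply (cross_tracks W W' (wm s)); auto; rewrite ?A1; auto; try congruence. exact I.
      * rewrite (mu_ext _ _ _ _ K), A1. unfold rank_hold. rewrite A3, E, A1. cbn [lp lm Nat.eqb].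
        left. destruct (lp (gl W) =? 2); lia.
    + destruct A3 as (A3 & A4). eexists. split.
      * apply work_hold; [assumption|].
        apply (keep_tracks W W' (wm s)); auto; rewrite ?A1; auto; left; congruence.
      * rewrite (mu_ext _ _ _ _ K), A1. unfold rank_hold. rewrite A3, E, A1. cbn [lp lm Nat.eqb].
        destruct P as [P|P]; rewrite P in *; cbn [Nat.eqb andb] in *; [left; lia|].
        right. split; [reflexivity|]. unfold held. rewrite A1, A4.
        split; [reflexivity|]. split; [reflexivity|]. split; [assumption|]. left. unfold posted.
        repeat split; auto; congruence.
Qed.

Lemma pend_step u q md : pending G bh s W u q md ->
  dfs_inv G bh (wm s) 1 True none2 all2 (if md then PF u q else PB u q) ->
  exists N, work s' w N /\
  (N < 16 * mu G (wm s) 1 md + rank_pend W \/ (N = 16 * mu G (wm s) 1 md + rank_pend W /\ held)).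
Proof.
  intros P D. destruct (pending_stay G bh pr s w wfG J u q md (L w) P) as [P'|H'].
  - assert (C : sep W).
    { destruct P as (_ & _ & _ & _ & _ & _ & [(S & _)|(A & B & V & Ge & Y)]); [assumption|].
      exfalso. destruct (W_All G bh pr s w J A) as (A1 & _).
      destruct P' as (P' & _). rewrite A1, (proj1 (lead_flagged G W R _ A B Y)) in P'. discriminate. }
    assert (K := sep_keep C).
    eexists. split; [apply (work_pend s' w u q md P'); apply (dfs_ext G bh _ _ _ _ _ _ _ K D)|].
    rewrite (mu_ext _ _ _ _ K).
    destruct (sep_far G bh wfG _ _ (j_ok _ _ _ _ J w) C) as (K1 & K2 & _).
    destruct (j_ok _ _ _ _ J w) as (_ & _ & _ & O).
    destruct C as [E|E]; rewrite E in O; unfold rank_pend; rewrite E.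
    + destruct (W_Out G bh wfG pr s w J E) as (A1 & A2 & A3 & A4). rewrite A4.
      assert (Lp : lp (gl W) = 2).
      { destruct P as (_ & _ & _ & _ & _ & _ & [(_ & S & _)|(A & _)]); [auto|congruence]. }
      destruct (opposed_b G W R) eqn:Op; [left; lia|].
      rewrite Lp. cbn [Nat.eqb andb]. destruct (pr (gv W) (lt (gl W))) eqn:Pr.
      * destruct (Nat.eqb_spec (far G W) bh) as [F|F].
        -- destruct (L w) as [L1 _]. rewrite Lp in A4. simpl in A4. contradiction.
        -- rewrite A1. cbn [lp Nat.eqb]. left. lia.
      * right. split; [reflexivity|]. unfold held. rewrite A1, A2.
        split; [reflexivity|]. split; [reflexivity|]. split; [assumption|]. left. unfold posted.
        repeat split; auto; congruence.
    + destruct (W_Back G bh wfG pr s w J E) as (A1 & _ & A3).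
      destruct O as (_ & Lp & _).
      destruct ((lp (gl W) =? 3) && pr (gv W) (lt (gl W))) eqn:C.
      * destruct A3 as (A3 & A4 & A5). rewrite A3. left. destruct (lp (gl W) =? 2); lia.
      * destruct A3 as (A3 & A4). rewrite A3, A1. cbn [lp lm Nat.eqb].
        destruct Lp as [Lp|Lp]; rewrite Lp in *; cbn [Nat.eqb andb] in *; [left; lia|].
        right. split; [reflexivity|]. unfold held. rewrite A1, A4.
        split; [reflexivity|]. split; [reflexivity|]. split; [assumption|]. left. unfold posted.
        repeat split; auto; congruence.
  - assert (P0 := P). destruct P as (Er & Nu & Hu & Hq & E1 & E2 & [(S & C1 & C2 & C3 & C4)|(A & B & V & Ge & Y)]).
    { exfalso. destruct H' as (H' & _). destruct S as [E|E].
      - destruct (W_Out G bh wfG pr s w J E) as (A1 & _). rewrite A1 in H'. simpl in H'. congruence.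
      - destruct (W_Back G bh wfG pr s w J E) as (A1 & _). rewrite A1 in H'. simpl in H'. congruence. }
    destruct (lead_flagged G W R (wbs s (gv W)) A B Y) as [L1 L2].
    assert (K : forall z, wm s' z = wm s z).
    { apply wm_keep. rewrite L2. reflexivity. }
    destruct (W_All G bh pr s w J A) as (A1 & A2 & A3 & A4 & A5).
    rewrite V, E1, Ge in L1. rewrite V in A1. rewrite L1 in A1.
    assert (T' : try_port (aview G W R (gv W)) (gl W) (ge W) = Some q).
    { unfold try_port. rewrite B. simpl. unfold yat. rewrite A, Nat.eqb_refl, Y. assumption. }
    rewrite T' in A5. destruct A5 as (A5 & A6 & A7).
    eexists. split.
    + apply work_hold; [assumption|]. exists (if md then PF u q else PB u q). split.
      * unfold located. rewrite A7. unfold pointing. rewrite A1, A2, V. cbn [lm lt].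
        destruct (gs W'); reflexivity.
      * apply (dfs_ext G bh _ _ _ _ _ _ _ K D).
    + left. rewrite (mu_ext _ _ _ _ K), A1. cbn [lm]. unfold rank_hold, rank_pend.
      rewrite A5, A7, A. destruct (pr _ _); simpl; [destruct (opposed_b _ _ _)|]; lia.
Qed.

Lemma work_step N : ~ swap -> work s w N ->
  exists N', work s' w N' /\ (N' < N \/ (N' = N /\ held)).
Proof.
  intros NS [H T|u q md P D].
  - destruct (gs W) eqn:E.
    + apply hold_All; assumption.
    + apply hold_sep; auto. left. assumption.
    + apply hold_sep; auto. right. assumption.
    + destruct (j_live _ _ _ _ J w). congruence.
    + destruct (j_live _ _ _ _ J w). congruence.
  - apply (pend_step u q md); assumption.
Qed.

End Step.
End Worker.

Lemma live_cases g : live g -> gs g = All \/ sep g.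
Proof. unfold live, sep. destruct (gs g); intuition congruence. Qed.

(** * Descent of the current run of the runner *)

Section Runner.
Variables (G : Graph) (bh : nat).
Hypothesis wfG : wf_graph G.

(** A whole runner outside phase 0 ranks below all stages of a crossing: a failed attempt counts as
    progress, because the port is given up next. *)
Definition rank_run (R : grp) : nat :=
  match gs R with
  | All => if lp (gl R) =? 0 then 8 else 3
  | Out => if lp (gl R) =? 1 then 7 else 6
  | Back => if lp (gl R) =? 2 then 5 else 4
  | _ => 0
  end.

Definition run_pot (s : state) (g : bool) : nat :=
  16 * mu G (rm s g) (ll (gl (gr s g))) (lm (gl (gr s g))) + rank_run (gr s g).

Section Step.
Variables (pr : nat -> nat -> bool) (s : state) (w : bool).
Hypothesis pr_deg : forall v p, pr v p = true -> p < deg G v.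
Hypothesis pr_sym : forall v p, v < gn G -> p < deg G v -> pr (nb G v p) (bp G v p) = pr v p.
Hypothesis J : joint G bh s w.

Notation W := (gr s w).
Notation R := (gr s (negb w)).
Notation s' := (next G bh pr s).
Notation W' := (gr s' w).
Notation R' := (gr s' (negb w)).
Notation jW := (judge (aview G W R (gv W)) (gl W)).
Notation jR := (judge (aview G R W (gv R)) (gl R)).
Notation swap := (swapping G s w).
Hypothesis L : forall g, live (gr s' g).

Lemma rm_next z : rm s' (negb w) z =
  if z =? gv R then mR (negb w) (lead_w G R W (wbs s z)) else rm s (negb w) z.
Proof.
  pose proof (j_role _ _ _ _ J) as H. pose proof (j_flag _ _ _ _ J) as H0.
  apply (board_R G bh pr s w (ndW _ _ _ _ J) (ndR _ _ _ _ J) (lgW _ _ _ _ J) (lgR _ _ _ _ J) H H0).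
Qed.

Lemma rm_worker z : rm s' w z =
  mR w (if z =? gv W then lead_w G W R (wbs s z) else wbs s z).
Proof.
  pose proof (j_role _ _ _ _ J) as H. pose proof (j_flag _ _ _ _ J) as H0.
  unfold rm. destruct (board_W G bh pr s w (ndW _ _ _ _ J) (ndR _ _ _ _ J) (lgW _ _ _ _ J)
     (lgR _ _ _ _ J) H H0 z) as [m ->].
  apply mR_set_other'.
Qed.

Lemma worker_labels : ~ swap -> ll (gl W') = ll (gl W) /\ lc (gl W') = lc (gl W) /\
  forall z, rm s' w z = rm s w z.
Proof.
  intro NS.
  cut (ll (gl W') = ll (gl W) /\ lc (gl W') = lc (gl W) /\
       mR w (lead_w G W R (wbs s (gv W))) = mR w (wbs s (gv W))).
  { intros (A & B & C). split; [assumption|]. split; [assumption|]. intro z. rewrite rm_worker.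
    destruct (Nat.eqb_spec z (gv W)) as [->|]; [assumption|reflexivity]. }
  destruct (gs W) eqn:E.
  - destruct (W_All G bh pr s w J E) as (A1 & _). rewrite A1.
    destruct (Nat.eq_dec (lp (gl W)) 3) as [P|P].
    + destruct (j_mode _ _ _ _ J) as [(Er & Ef & _)|(u & q & md & Pe)].
      * destruct (lead_arrive G W R (wbs s (gv W)) E P Ef) as [L1 L2]. rewrite L1, L2.
        unfold arrive, proceed, set_mark, nx, point. cbn [lr]. rewrite Er.
        destruct (lm (gl W)).
        -- destruct (_ =? _); [simpl; auto|]. cbn [ptr par].
           destruct (_ <? _); [simpl; destruct w; auto|].
           destruct (ge W); simpl; destruct w; auto.
        -- destruct (ptr _ <? _); [simpl; destruct w; auto|].
           destruct (par _); simpl; destruct w; auto.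
      * destruct Pe as (_ & _ & _ & _ & _ & _ & [(S & _)|(_ & _ & _ & _ & Y)]);
          [destruct S; congruence|].
        destruct (lead_flagged G W R (wbs s (gv W)) E P Y) as [L1 L2]. rewrite L1, L2.
        simpl. destruct w; auto.
    + assert (Er : lr (gl W) = true).
      { destruct (j_mode _ _ _ _ J) as [(Er & _)|(u & q & md & Pe)]; [assumption|].
        destruct Pe as (_ & _ & _ & _ & _ & _ & [(S & _)|(_ & K & _)]);
          [destruct S; congruence|contradiction]. }
      pose proof (spec_W G bh wfG s w J) as Sp.
      destruct (aview_All G W R E) as (_ & X & Y & FL).
      unfold lead_l, lead_w, lead, leader_step. rewrite X, Y.
      destruct (Nat.eqb_spec (lp (gl W)) 3); [contradiction|].
      destruct jW eqn:Ej; simpl; auto.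
      * destruct Sp. congruence.
      * destruct NS. unfold swapping. auto.
      * destruct NS. unfold swapping. auto.
  - destruct (W_Out G bh wfG pr s w J E) as (A1 & _). rewrite A1.
    rewrite lead_sep; [auto|left; assumption|].
    apply (sep_far G bh wfG _ _ (j_ok _ _ _ _ J w)). left. assumption.
  - destruct (W_Back G bh wfG pr s w J E) as (A1 & _). rewrite A1.
    rewrite lead_sep; [auto|right; assumption|].
    apply (sep_far G bh wfG _ _ (j_ok _ _ _ _ J w)). right. assumption.
  - destruct (j_live _ _ _ _ J w). congruence.
  - destruct (j_live _ _ _ _ J w). congruence.
Qed.

Section Run.
Variables (full : Prop) (sk tr : nat -> nat -> Prop).
Notation r := (negb w).
Hypothesis T : tracks G bh R (rm s r) (ll (gl R)) full sk tr.
Hypothesis LO : labels_ok G bh (rm s r) (gl R).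
Hypothesis L1 : 1 <= ll (gl R).
Hypothesis HB : gs R = Back -> pr (gv R) (lt (gl R)) = true -> tr (far G R) (near G R).
Hypothesis HG : gs R = All -> lp (gl R) <> 3 -> jR = Give -> lm (gl R) = true ->
  sk (gv R) (lt (gl R)).

(** The last clause lists the only excuses for a round without progress: waiting for the group of
    the worker, or being separated, with the scout posted, across a missing edge. *)
Definition same_run : Prop :=
  ll (gl R') = ll (gl R) /\ tracks G bh R' (rm s' r) (ll (gl R)) full sk tr /\
  labels_ok G bh (rm s' r) (gl R') /\ psi G (rm s' r) (ll (gl R')) <= psi G (rm s r) (ll (gl R)) /\
  run_pot s' r <= run_pot s r /\
  (run_pot s' r < run_pot s r \/
   (gs R = All /\ gs R' = All /\ (idle W \/ (gs W = All /\ lp (gl W) = 3))) \/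
   (posted R /\ pr (gv R) (lt (gl R)) = false)).

Definition new_label : Prop :=
  gs R = All /\ gs R' = All /\ lp (gl R') = 0 /\ lt (gl R') = 0 /\ lm (gl R') = true /\
  gv R' = gv R /\ ll (gl R') = next_lab (gl R) /\
  lc (gl R') = bump_count (rm s r (gv R)) (lc (gl R)) /\
  (forall z, z <> gv R -> rm s' r z = rm s r z) /\
  rm s' r (gv R) = Mk (next_lab (gl R)) None 0 /\
  (exhausted G bh (gl R) full sk tr (gv R) \/
   (lm (gl R) = false /\ jR = Give /\ lp (gl R) <> 3)).

Lemma settled_same : settled G bh (rm s r) full sk tr (gv R) (gl R)
    (lead_l G R W (wbs s (gv R))) (lead_w G R W (wbs s (gv R))) ->
  gs R = All -> gs R' = All -> same_run.
Proof.
  intros (S1 & S2 & S3 & S4 & S5 & S6 & S7) E E'.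
  destruct (R_All G bh pr s w J E) as (A1 & A2 & _). rewrite <- A1 in *.
  pose proof (j_role _ _ _ _ J) as Er.
  assert (CL : cur_lab (gl R) = ll (gl R)) by (unfold cur_lab; rewrite Er; reflexivity).
  assert (CM : forall b, cur_mark (gl R) b = mR r b).
  { intro b. unfold cur_mark. rewrite Er, (lgR _ _ _ _ J). reflexivity. }
  rewrite CL, CM in *.
  assert (K : forall z, rm s' r z = upd_mark (rm s r) (gv R) (mR r (lead_w G R W (wbs s (gv R)))) z).
  { intro z. rewrite rm_next. unfold upd_mark. destruct (Nat.eqb_spec z (gv R)) as [->|]; reflexivity. }
  assert (TR : tracks G bh R' (rm s' r) (ll (gl R)) full sk tr).
  { exists (pointing (gv R') (gl R')). split.
    - unfold located. rewrite E', S4. reflexivity.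
    - rewrite A2. apply (dfs_ext G bh _ _ _ _ _ _ _ K). assumption. }
  assert (KO : forall z, z <> gv R -> rm s' r z = rm s r z).
  { intros z N. rewrite K. apply upd_other. assumption. }
  assert (KV : rm s' r (gv R) = mR r (lead_w G R W (wbs s (gv R)))) by (rewrite K; apply upd_same).
  destruct (j_ok _ _ _ _ J r) as (_ & Hn & Nb & _).
  assert (PD : lab (rm s' r (gv R)) = ll (gl R) -> ptr (rm s' r (gv R)) <= deg G (gv R)).
  { intro Q. destruct TR as (d & _ & st & D & _). apply (dfs_dom _ _ _ _ _ _ _ _ D). assumption. }
  assert (LS : labels_ok G bh (rm s' r) (gl R') /\
               psi G (rm s' r) (ll (gl R')) <= psi G (rm s r) (ll (gl R))).
  { rewrite <- KV in S7. destruct S7 as [(S7 & S8 & S9)|(S7 & S9)].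
    - rewrite Er in S9. apply (labels_enter G bh _ _ _ _ (gv R)); auto.
    - destruct S9 as [S8 S9].
      destruct (labels_same G bh (rm s r) (rm s' r) (gl R) (gl R') (gv R)) as [X1 X2]; auto.
      + intros _. apply PD. congruence.
      + split; [assumption|]. lia. }
  assert (MU : run_pot s' r < run_pot s r).
  { unfold run_pot. rewrite S3, (mu_ext G _ _ _ _ K).
    assert (rank_run R' <= 8) by (unfold rank_run; rewrite E'; destruct (_ =? 0); lia).
    match goal with |- 16 * ?a + ?x < 16 * ?b + ?y =>
      change (a < b) in S6; change (x <= 8) in H; revert S6 H; generalize a b x y; intros; lia end. }
  unfold same_run. destruct LS as [LS1 LS2].
  do 4 (split; [assumption|]). split; [apply Nat.lt_le_incl|left]; assumption.
Qed.

Lemma mark_keep : mR r (lead_w G R W (wbs s (gv R))) = mR r (wbs s (gv R)) ->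
  forall z, rm s' r z = rm s r z.
Proof.
  intros E z. rewrite rm_next. destruct (Nat.eqb_spec z (gv R)) as [->|]; [assumption|reflexivity].
Qed.

Lemma moved_same : (forall z, rm s' r z = rm s r z) -> ll (gl R') = ll (gl R) ->
  lc (gl R') = lc (gl R) -> lm (gl R') = lm (gl R) ->
  tracks G bh R' (rm s' r) (ll (gl R)) full sk tr ->
  rank_run R' <= rank_run R ->
  (rank_run R' < rank_run R \/
   (gs R = All /\ gs R' = All /\ (idle W \/ (gs W = All /\ lp (gl W) = 3))) \/
   (posted R /\ pr (gv R) (lt (gl R)) = false)) -> same_run.
Proof.
  intros K E1 E2 E3 TR Rk D.
  assert (EQ : run_pot s' r = 16 * mu G (rm s r) (ll (gl R)) (lm (gl R)) + rank_run R').
  { unfold run_pot. rewrite E1, E3, (mu_ext G _ _ _ _ K). reflexivity. }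
  unfold same_run. rewrite EQ. unfold run_pot.
  split; [assumption|]. split; [assumption|].
  destruct (labels_same G bh (rm s r) (rm s' r) (gl R) (gl R') (gv R)) as [X1 X2]; auto.
  - rewrite K. reflexivity.
  - rewrite K. apply LO.
  - split; [assumption|]. split; [lia|]. split; [lia|]. destruct D as [D|D]; [left; lia|right; assumption].
Qed.

Lemma restarted_new : restarted (wbs s (gv R)) (gl R)
    (lead_l G R W (wbs s (gv R))) (lead_w G R W (wbs s (gv R))) ->
  gs R = All -> gs R' = All ->
  (exhausted G bh (gl R) full sk tr (gv R) \/
   (lm (gl R) = false /\ jR = Give /\ lp (gl R) <> 3)) -> new_label.
Proof.
  intros (S1 & S2) E E' X. destruct (R_All G bh pr s w J E) as (A1 & A2 & _).
  rewrite <- A1, (lgR _ _ _ _ J) in *.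
  unfold new_label. rewrite S1. cbn [lp lt lm ll lc]. do 8 (split; [auto|]).
  split; [|split; [|assumption]].
  - intros z N. rewrite rm_next. apply Nat.eqb_neq in N. rewrite N. reflexivity.
  - rewrite rm_next, Nat.eqb_refl, S2. apply mR_set_same.
Qed.

Lemma run_All : ~ swap -> gs R = All -> same_run \/ new_label.
Proof.
  intros NS E. destruct (R_All G bh pr s w J E) as (A1 & A2 & A3 & A4 & A5).
  pose proof (j_role _ _ _ _ J) as Er. pose proof (j_flag _ _ _ _ J) as Ef.
  assert (CL : cur_lab (gl R) = ll (gl R)) by (unfold cur_lab; rewrite Er; reflexivity).
  assert (Em : rm s r (gv R) = cur_mark (gl R) (wbs s (gv R))).
  { unfold cur_mark. rewrite Er, (lgR _ _ _ _ J). reflexivity. }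
  destruct (j_ok _ _ _ _ J r) as (_ & Hn & Nb & _).
  destruct (aview_All G R W E) as (_ & X & Y & FL).
  destruct T as (d & Lo & D).
  destruct (Nat.eqb_spec (lp (gl R)) 3) as [P|P].
  - unfold located in Lo. rewrite E, P in Lo. simpl in Lo. destruct Lo as (j & Ge & ->).
    destruct (lead_arrive G R W (wbs s (gv R)) E P Ef) as [B1 B2]. rewrite Ge in B1, B2.
    rewrite <- CL in D.
    destruct (arrive_spec G bh (rm s r) full sk tr (gl R) (wbs s (gv R)) (gv R) j Hn Nb Em D)
      as [S|(X1 & X2)]; rewrite <- B1, <- B2 in *.
    + left. apply settled_same; assumption.
    + right. apply restarted_new; auto. apply X2. assumption.
  - destruct (pointing_ok G bh R (rm s r) _ _ _ _ d Lo D) as [-> PD]; [right; assumption|].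
    assert (KT : gs R' <> All \/ lp (gl R') <> 3 -> (forall z, rm s' r z = rm s r z) ->
       lm (gl R') = lm (gl R) -> lt (gl R') = lt (gl R) ->
       tracks G bh R' (rm s' r) (ll (gl R)) full sk tr).
    { intros Q1 Q2 Q3 Q4. apply (keep_tracks G bh R R' (rm s r)); auto. }
    pose proof (spec_R G bh wfG s w J) as Sp.
    assert (JC : jR = Wait \/ jR = Give \/ jR = Try).
    { clear - Sp. destruct jR; auto; contradiction. }
    destruct JC as [Ej|[Ej|Ej]]; rewrite Ej in Sp, A5.
    + left. destruct (lead_wait G R W (wbs s (gv R)) E P Ej) as [B1 B2]. rewrite B1 in A1.
      assert (K : forall z, rm s' r z = rm s r z) by (apply mark_keep; rewrite B2; reflexivity).
      apply moved_same; rewrite ?A1; auto.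
      * apply KT; rewrite ?A1; auto.
      * unfold rank_run. rewrite A1, A5, E. lia.
      * right. left. split; [assumption|]. split; [assumption|].
        destruct Sp as [[Sp _]|[[Sp _] Sp2]]; auto.
    + assert (GE : lead_l G R W (wbs s (gv R)) = fst (abandon (deg G (gv R)) (gl R) (wbs s (gv R))) /\
                   lead_w G R W (wbs s (gv R)) = snd (abandon (deg G (gv R)) (gl R) (wbs s (gv R)))).
      { unfold lead_l, lead_w, lead, leader_step. rewrite X, Y, Ej.
        destruct (Nat.eqb_spec (lp (gl R)) 3); [contradiction|].
        destruct (abandon _ _ _). auto. }
      destruct GE as [B1 B2]. rewrite <- CL in D.
      destruct (give_spec G bh (rm s r) full sk tr (gl R) (wbs s (gv R)) (gv R) Hn Nb Em Er D (HG E P Ej))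
        as [S|(X1 & X2 & X3)]; rewrite <- B1, <- B2 in *.
      * left. apply settled_same; assumption.
      * right. apply restarted_new; auto. destruct X1; auto.
    + left. destruct A5 as (A5 & A6 & A7).
      assert (GE : lead_l G R W (wbs s (gv R)) =
         Ld (lg (gl R)) (lr (gl R)) (lm (gl R)) 1 (lt (gl R)) (ll (gl R)) (lc (gl R)) /\
         lead_w G R W (wbs s (gv R)) = wbs s (gv R)).
      { unfold lead_l, lead_w, lead, leader_step. rewrite X, Y, Ej.
        destruct (Nat.eqb_spec (lp (gl R)) 3); [contradiction|]. auto. }
      destruct GE as [B1 B2]. rewrite B1 in A1.
      assert (K : forall z, rm s' r z = rm s r z) by (apply mark_keep; rewrite B2; reflexivity).
      assert (RK : rank_run R' < rank_run R).
      { unfold rank_run. rewrite E, A7. replace (lp (gl R)) with 0 by (symmetry; apply Sp).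
        destruct (pr _ _); rewrite A5; simpl; lia. }
      apply moved_same; rewrite ?A1; auto with arith.
      apply KT; rewrite ?A1; auto. right. discriminate.
Qed.

Lemma run_sep : ~ swap -> sep R -> same_run.
Proof.
  intros NS S. destruct (sep_far G bh wfG _ _ (j_ok _ _ _ _ J r) S) as (K1 & K2 & K3 & K4 & K5 & K6 & K7).
  assert (K : forall z, rm s' r z = rm s r z).
  { apply mark_keep. rewrite lead_sep; auto. }
  destruct (j_ok _ _ _ _ J r) as (_ & _ & _ & O).
  destruct S as [E|E]; rewrite E in O.
  - destruct (R_Out G bh wfG pr s w J NS E) as (A1 & A2 & A3 & A4).
    apply moved_same; rewrite ?A1; auto.
    + apply (keep_tracks G bh R R' (rm s r)); auto; rewrite ?A1; auto.
      left. congruence.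
    + unfold rank_run. rewrite E, A4, A1. cbn [lp].
      destruct (opposed_b G R W); [cbn [Nat.eqb]; destruct (_ =? 1); lia|].
      destruct O as (_ & [P|P] & _); rewrite P; cbn [Nat.eqb andb]; [lia|].
      destruct (pr _ _); [destruct (_ =? bh)|]; lia.
    + unfold rank_run. rewrite E, A4, A1. cbn [lp].
      destruct (opposed_b G R W); [left; cbn [Nat.eqb]; destruct (_ =? 1); lia|].
      destruct O as (_ & [P|P] & _); rewrite P; cbn [Nat.eqb andb]; [left; lia|].
      destruct (pr _ _); [left; destruct (_ =? bh); lia|].
      right. right. unfold posted. auto.
  - destruct (R_Back G bh wfG pr s w J NS E) as (A1 & A2 & A3).
    destruct O as (_ & P & _).
    destruct ((lp (gl R) =? 3) && pr (gv R) (lt (gl R))) eqn:C.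
    + destruct A3 as (A3 & A4 & A5). apply andb_prop in C. destruct C as [C1 C2].
      apply moved_same; rewrite ?A1; auto.
      * apply (cross_tracks G bh wfG R R' (rm s r)); auto; rewrite ?A1; auto. congruence.
      * unfold rank_run. rewrite E, A3, A1. cbn [lp Nat.eqb]. destruct (_ =? 2); lia.
      * left. unfold rank_run. rewrite E, A3, A1. cbn [lp Nat.eqb]. destruct (_ =? 2); lia.
    + destruct A3 as (A3 & A4).
      apply moved_same; rewrite ?A1; auto.
      * apply (keep_tracks G bh R R' (rm s r)); auto; rewrite ?A1; auto; left; congruence.
      * unfold rank_run. rewrite E, A3, A1. cbn [lp Nat.eqb]. destruct (_ =? 2); lia.
      * unfold rank_run. rewrite E, A3, A1. cbn [lp].
        destruct P as [P|P]; rewrite P in *; cbn [Nat.eqb andb] in *; [left; lia|].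
        right. right. unfold posted. auto.
Qed.

Lemma run_step : ~ swap -> same_run \/ new_label.
Proof.
  intro NS. destruct (live_cases R (j_live _ _ _ _ J r)) as [E|S].
  - apply run_All; assumption.
  - left. apply run_sep; assumption.
Qed.

End Run.
End Step.
End Runner.

(** * The potential *)

Section Potential.
Variables (G : Graph) (bh : nat).
Hypothesis wfG : wf_graph G.
Hypothesis bhn : bh < gn G.
Hypothesis conn : connected_by G (fun _ _ => True).

Definition wedge (W : grp) (z p : nat) : Prop :=
  (z = gv W /\ p = lt (gl W)) \/ (z = far G W /\ p = near G W).

(* The current run of the runner started afresh, and the worker's edge is the only one that the
   runner has ever given up in it: such a run must find the black hole. *)
Definition clean (s : state) (w : bool) : Prop :=
  let W := gr s w in let R := gr s (negb w) in
  tracks G bh R (rm s (negb w)) (ll (gl R)) True (wedge W) (fun z p => ~ wedge W z p) /\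
  (gs R = All -> lp (gl R) = 1 \/ lp (gl R) = 2 -> wedge W (gv R) (lt (gl R))) /\
  (sep R -> ~ wedge W (gv R) (lt (gl R)) \/ opposed G W R).

Section Step.
Variables (pr : nat -> nat -> bool) (s : state) (w : bool).
Hypothesis pr_deg : forall v p, pr v p = true -> p < deg G v.
Hypothesis pr_sym : forall v p, v < gn G -> p < deg G v -> pr (nb G v p) (bp G v p) = pr v p.
Hypothesis pr_one : forall v p v' p', v < gn G -> p < deg G v -> v' < gn G -> p' < deg G v' ->
  pr v p = false -> pr v' p' = false ->
  (v' = v /\ p' = p) \/ (v' = nb G v p /\ p' = bp G v p).
Hypothesis pr_conn : connected_by G (fun v p => pr v p = true).
Hypothesis J : joint G bh s w.

Notation W := (gr s w).
Notation r := (negb w).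
Notation R := (gr s r).
Notation s' := (next G bh pr s).
Notation W' := (gr s' w).
Notation R' := (gr s' r).
Notation jW := (judge (aview G W R (gv W)) (gl W)).
Notation jR := (judge (aview G R W (gv R)) (gl R)).
Notation swap := (swapping G s w).
Hypothesis L : forall g, live (gr s' g).

Notation held := (held G bh pr s w).

(** In every other case of [held] the runner is separated before or after the round. *)
Lemma held_blocked : held -> gs R = All -> gs R' = All ->
  pr (gv W) (lt (gl W)) = false /\ lt (gl W) < deg G (gv W).
Proof.
  intros (_ & _ & _ & [(A & B & _)|[(A & _)|[(A & _)|A]]]) E E'; auto; exfalso.
  - destruct A as [[A _]|[A _]]; congruence.
  - destruct A as (_ & A & _). congruence.
  - destruct A as (_ & A & _). congruence.
Qed.

Lemma wedge_blocked z p : pr (gv W) (lt (gl W)) = false -> lt (gl W) < deg G (gv W) ->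
  wedge W z p -> pr z p = false.
Proof.
  intros P D [[-> ->]|[-> ->]]; [assumption|].
  destruct (j_ok _ _ _ _ J w) as (_ & Hn & _). unfold far, near. rewrite pr_sym; assumption.
Qed.

Lemma wedge_flip : sep R -> lt (gl W) < deg G (gv W) ->
  wedge W (far G R) (near G R) -> wedge W (gv R) (lt (gl R)).
Proof.
  intros S D H. destruct (sep_far G bh wfG _ _ (j_ok _ _ _ _ J r) S) as (K1 & K2 & K3 & K4 & K5 & K6 & K7).
  destruct (j_ok _ _ _ _ J w) as (_ & Hn & _).
  destruct (far_ok G wfG _ _ Hn D) as (_ & _ & _ & F4 & F5).
  destruct H as [[H1 H2]|[H1 H2]].
  - right. unfold far at 1. unfold near at 1. rewrite <- H1, <- H2. auto.
  - left. rewrite H1, H2 in K6, K7. unfold far, near in K6, K7. split; congruence.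
Qed.

(** All reasons to give way point to the edge of the worker: a failed attempt in a clean run was
    made on it, and otherwise the worker itself stands on that port. *)
Lemma give_wedge : clean s w -> gs R = All -> lp (gl R) <> 3 -> jR = Give ->
  wedge W (gv R) (lt (gl R)).
Proof.
  intros (_ & C2 & _) E P Ej. pose proof (spec_R G bh wfG s w J) as Sp. rewrite Ej in Sp.
  destruct Sp as [Sp|[(S & Sp)|((_ & Sp1) & _ & Sp2)]].
  - apply C2; [assumption|]. pose proof (j_lp _ _ _ _ J r). lia.
  - destruct Sp as [[H1 H2]|[H1 H2]]; [left|right]; auto.
  - left. auto.
Qed.

Lemma give_lp l d b : lr l = false -> lp (fst (abandon d l b)) = 0.
Proof.
  intro E. unfold abandon, proceed. destruct (lm l); [|reflexivity].
  destruct (nx _ _); [reflexivity|]. rewrite E. reflexivity.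
Qed.

(** If the run ended while the worker is held, the edge of the worker would be missing. An exhausted
    search would then have skipped only a missing edge of a connected network; and a way back is
    never on that edge, so it is never refused. *)
Lemma clean_step : ~ swap -> clean s w -> held -> labels_ok G bh (rm s r) (gl R) ->
  1 <= ll (gl R) ->
  ll (gl R') = ll (gl R) /\ clean s' w.
Proof.
  intros NS C H LO L1. assert (DW := proj1 (proj2 (proj2 H))). assert (C0 := C). destruct C as (C1 & C2 & C3).
  assert (CR : same_run G bh pr s w True (wedge W) (fun z p => ~ wedge W z p) \/
               new_label G bh pr s w True (wedge W) (fun z p => ~ wedge W z p)).
  { apply run_step; auto.
    - intros E _ X. destruct C3 as [C3|C3]; [right; assumption| |destruct C3 as (_ & C3 & _); congruence].
      apply C3, wedge_flip; auto. right. assumption.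
    - intros E P Ej _. apply give_wedge; assumption. }
  destruct CR as [(S1 & S2 & _)|N].
  - split; [assumption|].
    assert (H0 := H). destruct H as (H1 & H2 & _).
    assert (WE : forall z p, wedge W' z p <-> wedge W z p).
    { intros z p. unfold wedge, far, near. rewrite H1, H2. tauto. }
    pose proof (j_role _ _ _ _ J) as Er. pose proof (j_flag _ _ _ _ J) as Ef.
    split; [|split].
    + rewrite S1. destruct S2 as (d & D1 & D2). exists d. split; [assumption|].
      destruct D2 as (st & D2 & D3). exists st. split.
      * destruct D2 as [X1 X2 X3 X4 X5 X6 X7]. constructor; auto.
        -- intros z p Lz Hp. rewrite WE. auto.
        -- intros z i Lz Hi. rewrite WE. auto.
      * destruct d; auto; rewrite WE; assumption.
    + intros E' P'. rewrite WE.
      destruct (live_cases R (j_live _ _ _ _ J r)) as [E|[E|E]].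
      * destruct (R_All G bh pr s w J E) as (A1 & A2 & _ & _ & A5). rewrite A2.
        destruct (held_blocked H0 E E') as [HB1 HB2].
        destruct (Nat.eqb_spec (lp (gl R)) 3) as [P|P].
        -- destruct (lead_arrive G R W (wbs s (gv R)) E P Ef) as [B1 _].
           rewrite A1, B1 in P'.
           destruct (arrive_lp (deg G (gv R)) (ge R) (gl R) (wbs s (gv R)) P) as [K|K];
             rewrite K in P'; destruct P'; discriminate.
        -- pose proof (spec_R G bh wfG s w J) as Sp.
           destruct jR eqn:Ej; try contradiction.
           ++ destruct (lead_wait G R W (wbs s (gv R)) E P Ej) as [B1 _]. rewrite A1, B1 in *. auto.
           ++ exfalso. rewrite A1 in P'. destruct (aview_All G R W E) as (_ & X & Y & FL).
              revert P'. unfold lead_l, lead, leader_step. rewrite X, Y, Ej.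
              destruct (Nat.eqb_spec (lp (gl R)) 3); [contradiction|]. cbn [fst].
              rewrite give_lp by assumption. lia.
           ++ destruct A5 as (A5 & A6 & A7). rewrite A6.
              destruct (j_ok _ _ _ _ J r) as (_ & Hn & _).
              destruct (j_ok _ _ _ _ J w) as (_ & Hn' & _).
              destruct C1 as (d & D1 & D2).
              destruct (pointing_ok G bh R _ _ _ _ _ d D1 D2) as [_ PD]; [right; assumption|].
              destruct (pr (gv R) (lt (gl R))) eqn:Pr; [congruence|].
              (* The attempt failed on a missing edge, the edge of the worker is missing too, and at
                 most one is. *)
              exact (pr_one _ _ _ _ Hn' HB2 Hn PD HB1 Pr).
      * destruct (R_Out G bh wfG pr s w J NS E) as (A1 & A2 & _ & A4).
        destruct (opposed_b G R W) eqn:Op.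
        -- apply (opposed_b_iff G bh wfG r) in Op; rewrite ?negb_involutive; try apply (j_ok _ _ _ _ J).
           apply (opposed_sym G bh wfG r) in Op; rewrite ?negb_involutive; try apply (j_ok _ _ _ _ J).
           destruct Op as (_ & _ & O3 & O4). right. rewrite A1, A2. auto.
        -- destruct (_ && _); [destruct (_ =? bh)|]; congruence.
      * destruct (R_Back G bh wfG pr s w J NS E) as (A1 & _). rewrite A1 in P'. simpl in P'. lia.
    + intros SR. rewrite WE.
      destruct (sep_R' G bh wfG pr s w J NS SR) as [(B1 & B2 & B3)|(B1 & B2 & B3 & B4 & B5 & B6 & B7 & B8)].
      * rewrite B2, B3. destruct (C3 B1) as [K|K]; [auto|]. exfalso.
        destruct (R_Out G bh wfG pr s w J NS (proj1 (proj2 K))) as (_ & _ & _ & A4).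
        assert (O : opposed_b G R W = true).
        { apply (opposed_b_iff G bh wfG r); rewrite ?negb_involutive; try apply (j_ok _ _ _ _ J).
          apply (opposed_sym G bh wfG w); auto; apply (j_ok _ _ _ _ J). }
        rewrite O in A4. destruct SR; congruence.
      * rewrite B5, B6. destruct H0 as (_ & _ & _ & [(K1 & K2 & _)|[(K & _)|[(K & _)|K]]]).
        -- left. intro X. pose proof (wedge_blocked _ _ K1 K2 X). congruence.
        -- exfalso. destruct K as [[K _]|[K _]]; congruence.
        -- right. exact K.
        -- exfalso. destruct K as (_ & K & _). congruence.
  - exfalso. destruct N as (E & E' & _ & _ & _ & _ & _ & _ & _ & _ & N).
    destruct (held_blocked H E E') as [HB1 HB2].
    destruct N as [(mk & X1 & X2)|(N1 & N2 & N3)].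
    + apply (dfs_complete G bh mk _ _ _ _ _ _ X1 (X2 I) pr_conn bhn).
      intros z p X. pose proof (wedge_blocked _ _ HB1 HB2 X). congruence.
    + destruct C1 as (d & D1 & D2).
      destruct (pointing_ok G bh R _ _ _ _ _ d D1 D2) as [-> PD]; [right; assumption|].
      unfold pointing in D2. rewrite N1 in D2. destruct D2 as (st & _ & _ & _ & D2 & _).
      apply D2. apply give_wedge; assumption.
Qed.

(** A held worker is not in a state the runner waits for; and a runner stuck on a missing edge would
    be on the edge of the worker, which the joint invariant forbids. *)
Lemma held_runs sk full tr : ~ swap -> held -> same_run G bh pr s w full sk tr ->
  run_pot G s' r < run_pot G s r.
Proof.
  intros NS H (_ & _ & _ & _ & _ & [D|[(E & E' & D)|(D & P)]]); [assumption| |]; exfalso.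
  - destruct H as (_ & _ & _ & [(A & B & C1 & C2)|[(A & _)|[(A & _)|A]]]).
    + destruct D as [D|[D1 D2]].
      * assert (S : sep W) by (unfold idle, sep in *; tauto).
        destruct (C2 S) as [[X1 X2]|[X1 X2]], D as [[Y1 Y2]|[Y1 Y2]]; congruence.
      * destruct (C1 D1); congruence.
    + destruct A as [[A _]|[A _]]; congruence.
    + destruct A as (_ & A & _). congruence.
    + destruct A as (_ & A & _). congruence.
  - assert (S : sep R) by (unfold posted, sep in *; tauto).
    destruct (sep_far G bh wfG _ _ (j_ok _ _ _ _ J r) S) as (K1 & K2 & _).
    destruct (j_ok _ _ _ _ J w) as (_ & Hn & _).
    destruct H as (_ & _ & _ & [(A & B & C1 & C2)|[(A & _)|[(_ & A)|A]]]).
    + assert (O : on_edge G R (gv W) (lt (gl W))).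
      { destruct (pr_one _ _ _ _ Hn B K1 K2 A P) as [[X1 X2]|[X1 X2]]; [left; auto|].
        apply (on_edge_flip G bh wfG r); auto; [apply (j_ok _ _ _ _ J)|]. left. auto. }
      destruct (live_cases W (j_live _ _ _ _ J w)) as [E|SW].
      * apply (j_try _ _ _ _ J E (C1 E) S O).
      * destruct (j_sep _ _ _ _ J SW S O) as ((Q1 & Q2 & _) & _ & Q & _).
        destruct D as [[_ D]|[D _]]; congruence.
    + destruct A as [[A1 A2]|[A1 A2]], D as [[D1 D2]|[D1 D2]]; congruence.
    + destruct S; congruence.
    + assert (Q := A). apply (opposed_sym G bh wfG w) in Q; try apply (j_ok _ _ _ _ J).
      pose proof (joint_opposed_fresh G bh wfG s w J r) as OF. rewrite negb_involutive in OF.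
      specialize (OF Q). destruct D as [[_ D]|[D _]]; [congruence|]. destruct Q. congruence.
Qed.

End Step.
End Potential.

(** * The combined potential and its descent *)

Section Descent.
Variables (G : Graph) (bh : nat).

(** A strict bound on [run_pot], which serves as the base of a lexicographic pairing. *)
Definition big : nat := 16 * (4 * (sumn (deg G) (gn G) + gn G) + 1) + 9.

Lemma run_pot_big s g : run_pot G s g < big.
Proof.
  unfold run_pot, big. pose proof (mu_bound G (rm s g) (ll (gl (gr s g))) (lm (gl (gr s g)))).
  assert (rank_run (gr s g) <= 8).
  { unfold rank_run. destruct (gs (gr s g)); try destruct (_ =? _); lia. }
  lia.
Qed.

Hypothesis deg_pos : forall v, v < gn G -> 0 < deg G v.

(** A new run aims at port 0 without looking; this is sound because every node has a port. *)
Lemma new_run_tracks me mk l full sk tr : gs me = All -> lp (gl me) = 0 -> lt (gl me) = 0 ->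
  lm (gl me) = true -> gv me < gn G -> mk (gv me) = Mk l None 0 ->
  ready G bh mk l full sk tr (gv me) ->
  tracks G bh me mk l full sk tr.
Proof.
  intros E P T M Hn Em RD. exists (PF (gv me) 0). split.
  - unfold located, pointing. rewrite E, P, T, M. reflexivity.
  - pose proof (dfs_next G bh _ _ _ _ _ _ RD) as H. rewrite Em in H. unfold nx in H.
    specialize (deg_pos _ Hn). cbn [ptr] in H.
    destruct (Nat.ltb_spec 0 (deg G (gv me))); [assumption|lia].
Qed.

Hypothesis wfG : wf_graph G.
Hypothesis bhn : bh < gn G.
Hypothesis conn : connected_by G (fun _ _ => True).

Definition psum (s : state) (w : bool) : nat :=
  psi G (rm s w) (ll (gl (gr s w))) + psi G (rm s (negb w)) (ll (gl (gr s (negb w)))).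

(** A run that is not clean costs 2, and starting one costs at most 1 in [psi]: replacing it by a
    clean run is a gain, while spoiling the new run makes [psi] drop. A step of the worker, worth 4,
    pays for a new label or for the loss of cleanness. *)
Inductive pot (s : state) : nat -> Prop :=
| pot_intro w n fl :
    joint G bh s w -> work G bh s w n ->
    tracks G bh (gr s (negb w)) (rm s (negb w)) (ll (gl (gr s (negb w)))) False all2 all2 ->
    1 <= ll (gl (gr s (negb w))) ->
    (forall g, labels_ok G bh (rm s g) (gl (gr s g))) ->
    fl = 2 \/ (fl = 0 /\ clean G bh s w) ->
    pot s (big * (4 * n + psum s w + fl) + run_pot G s (negb w)).

Section Step.
Variables (pr : nat -> nat -> bool) (s : state) (w : bool).
Hypothesis pr_deg : forall v p, pr v p = true -> p < deg G v.
Hypothesis pr_sym : forall v p, v < gn G -> p < deg G v -> pr (nb G v p) (bp G v p) = pr v p.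
Hypothesis pr_one : forall v p v' p', v < gn G -> p < deg G v -> v' < gn G -> p' < deg G v' ->
  pr v p = false -> pr v' p' = false ->
  (v' = v /\ p' = p) \/ (v' = nb G v p /\ p' = bp G v p).
Hypothesis pr_conn : connected_by G (fun v p => pr v p = true).
Hypothesis J : joint G bh s w.

Notation W := (gr s w).
Notation r := (negb w).
Notation R := (gr s r).
Notation s' := (next G bh pr s).
Notation W' := (gr s' w).
Notation R' := (gr s' r).
Notation jW := (judge (aview G W R (gv W)) (gl W)).
Notation jR := (judge (aview G R W (gv R)) (gl R)).
Notation swap := (swapping G s w).
Hypothesis L : forall g, live (gr s' g).

Lemma swap_work n : swap -> work G bh s w n -> exists n', work G bh s' r n' /\ n' < n.
Proof.
  intros S K. assert (J' := joint_swap G bh pr s w wfG pr_deg J S L).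
  destruct (swap_sep G bh s w wfG J S) as (SR & Er & Hd & Cs).
  assert (S0 := S). destruct S0 as (EW & PW & _).
  destruct K as [_ T|u q md P _]; [|destruct P; congruence].
  assert (OE : on_edge G R (gv W) (lt (gl W))).
  { destruct Cs as [(_ & C1 & C2)|(_ & _ & C1 & C2)]; [left|right]; auto. }
  (* A swap happens only in phase 0, since [j_try] keeps the runner off the edge after a failed
     attempt. Hence the top rank 12, above every rank that the search can have once handed over. *)
  assert (RH : rank_hold G W R = 12).
  { unfold rank_hold. rewrite EW. destruct (Nat.eqb_spec (lp (gl W)) 3); [contradiction|].
    destruct (Nat.eqb_spec (lp (gl W)) 0); [reflexivity|]. exfalso.
    pose proof (j_lp _ _ _ _ J w). apply (j_try _ _ _ _ J EW); auto. lia. }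
  rewrite RH. destruct T as (d & Lo & D).
  destruct (pointing_ok G bh W _ _ _ _ _ d Lo D) as [-> PD]; [right; assumption|].
  assert (KM : forall z, wm s' z = wm s z).
  { apply (wm_keep G bh pr s w J).
    destruct (swap_W G bh pr s w J S) as (_ & _ & _ & _ & _ & _ & _ & _ & _ & E).
    rewrite E, mW_set. destruct jW; reflexivity. }
  destruct (sep_far G bh wfG _ _ (j_ok _ _ _ _ J r) SR) as (K1 & K2 & K3 & K4 & K5 & K6 & K7).
  destruct Cs as [(Ej & C1 & C2)|(Ej & C0 & C1 & C2)].
  - assert (H' : holding s' R').
    { destruct (j_mode _ _ _ _ J') as [H|(u & q & md & P)]; [assumption|]. exfalso.
      destruct P as (P & _).
      destruct SR as [E|E].
      - destruct (swap_R_Out G bh pr s w wfG J S E) as (A1 & _).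
        rewrite A1, (swap_take G bh s w wfG J _ S), Ej in P. discriminate.
      - destruct (swap_R_Back G bh pr s w wfG J E) as (A1 & _).
        rewrite A1, (swap_take G bh s w wfG J _ S), Ej in P. discriminate. }
    assert (X : lm (gl R') = lm (gl W) /\ tracks G bh R' (wm s') 1 True none2 all2 /\
                rank_hold G R' W' <= 7).
    { destruct SR as [E|E].
      - destruct (swap_R_Out G bh pr s w wfG J S E) as (A1 & A2 & _ & A4).
        rewrite (swap_take G bh s w wfG J _ S), Ej in A1. split; [rewrite A1; reflexivity|].
        assert (NA : gs R' <> All).
        { rewrite A4. destruct (_ && _); [destruct (_ =? bh)|]; discriminate. }
        split.
        + exists (pointing (gv W) (gl W)). split.
          * unfold located, pointing. rewrite A1, A2, C1. cbn [lm lt]. rewrite C2.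
            destruct (gs R'); auto. congruence.
          * apply (dfs_ext G bh (wm s)); assumption.
        + unfold rank_hold. destruct (gs R') eqn:EG; try lia; try congruence.
          * destruct (lp (gl R') =? 1); [destruct (opposed_b G R' W')|]; lia.
          * destruct (lp (gl R') =? 2); lia.
      - destruct (swap_R_Back G bh pr s w wfG J E) as (A1 & _ & A3).
        rewrite (swap_take G bh s w wfG J _ S), Ej in A1. split; [rewrite A1; reflexivity|].
        destruct (_ && _).
        + destruct A3 as (A3 & A4 & A5). split.
          * exists (if lm (gl W) then AF (far G R) (near G R) else AB (far G R) (near G R)). split.
            -- unfold located. rewrite A3, A1, A4. cbn [lm lp Nat.eqb]. eauto.
            -- apply (dfs_ext G bh (wm s)); [assumption|].
               unfold pointing in D. rewrite <- C1, <- C2 in D. unfold far, near.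
               destruct (lm (gl W)); [apply dfs_crossF|apply dfs_crossB]; auto. exact I.
          * unfold rank_hold. rewrite A3, A1. cbn [lp Nat.eqb]. lia.
        + destruct A3 as (A3 & A4). split.
          * exists (pointing (gv W) (gl W)). split.
            -- unfold located, pointing. rewrite A1, A4, A3, C1. cbn [lm lt]. rewrite C2. reflexivity.
            -- apply (dfs_ext G bh (wm s)); assumption.
          * unfold rank_hold. rewrite A3. destruct (lp (gl R') =? 2); lia. }
    destruct X as (X1 & X2 & X3).
    eexists. split; [apply work_hold; assumption|].
    rewrite negb_involutive, X1, (mu_ext G _ _ _ _ KM). lia.
  - assert (H' : pending G bh s' R' (gv W) (lt (gl W)) (lm (gl W))).
    { assert (LR : lr (gl R') = false).
      { destruct SR as [E|E].
        - destruct (swap_R_Out G bh pr s w wfG J S E) as (A1 & _).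
          rewrite A1, (swap_take G bh s w wfG J _ S), Ej. reflexivity.
        - destruct (swap_R_Back G bh pr s w wfG J E) as (A1 & _).
          rewrite A1, (swap_take G bh s w wfG J _ S), Ej. reflexivity. }
      destruct (j_mode _ _ _ _ J') as [(H & _)|(u & q & md & P)]; [congruence|].
      assert (P0 := P). destruct P0 as (_ & _ & _ & _ & E1 & _).
      rewrite (swap_nt G bh pr s w wfG J u S), Ej in E1.
      destruct (Nat.eqb_spec u (gv W)) as [->|]; [|discriminate].
      injection E1 as <- <-. assumption. }
    eexists. split.
    + apply (work_pend G bh s' r _ _ _ H').
      apply (dfs_ext G bh (wm s)); [assumption|]. unfold pointing in D.
      destruct (lm (gl W)); assumption.
    + rewrite (mu_ext G _ _ _ _ KM).
      assert (rank_pend R' <= 11).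
      { unfold rank_pend. destruct (gs R'); try lia; destruct (lp (gl R') =? 2); lia. }
      lia.
Qed.

(* Reusing a label already present on another node spoils the run, but then psi drops. *)
Lemma fresh_run (w' : bool) (v : nat) (l : ldr) : joint G bh s' w' ->
  let g := negb w' in
  gs (gr s' g) = All -> lp (gl (gr s' g)) = 0 -> lt (gl (gr s' g)) = 0 ->
  lm (gl (gr s' g)) = true -> gv (gr s' g) = v ->
  ll (gl (gr s' g)) = next_lab l -> lc (gl (gr s' g)) = bump_count (rm s g v) (lc l) ->
  (forall z, z <> v -> rm s' g z = rm s g z) -> rm s' g v = Mk (next_lab l) None 0 ->
  labels_ok G bh (rm s g) l ->
  tracks G bh (gr s' g) (rm s' g) (ll (gl (gr s' g))) False all2 all2 /\
  1 <= ll (gl (gr s' g)) /\ labels_ok G bh (rm s' g) (gl (gr s' g)) /\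
  exists fl, (fl = 2 \/ (fl = 0 /\ clean G bh s' w')) /\
    psi G (rm s' g) (ll (gl (gr s' g))) + fl <= psi G (rm s g) (ll l) + 1.
Proof.
  intros J' g E P T M V EL EC O Em LO. subst g. set (g := negb w') in *.
  destruct (j_ok _ _ _ _ J' g) as (_ & Hn & Nb & _). rewrite V in Hn, Nb.
  destruct (labels_restart G bh (rm s g) (rm s' g) l (gl (gr s' g)) v Hn Nb O Em EL EC LO)
    as [LO' D].
  assert (NT : forall full sk tr, ready G bh (rm s' g) (ll (gl (gr s' g))) full sk tr v ->
     tracks G bh (gr s' g) (rm s' g) (ll (gl (gr s' g))) full sk tr).
  { intros full sk tr RD. apply new_run_tracks; auto; rewrite ?V; auto. rewrite EL. assumption. }
  split; [|split; [|split; [assumption|]]].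
  - apply NT. apply ready_new_weak; auto; [rewrite EL; assumption|].
    intros z Lz. apply LO'. rewrite Lz, EL. pose proof (next_lab_new l). lia.
  - rewrite EL. apply next_lab_new.
  - destruct D as [[D1 D2]|D].
    + exists 0. split; [right; split; [reflexivity|]|lia].
      split; [|split].
      * apply NT. rewrite EL. apply ready_new; auto.
      * fold g. intros _ [Q|Q]; lia.
      * fold g. intros [Q|Q]; congruence.
    + exists 2. split; [auto|lia].
Qed.

Lemma pot_descend n fl :
  work G bh s w n ->
  tracks G bh R (rm s r) (ll (gl R)) False all2 all2 -> 1 <= ll (gl R) ->
  (forall g, labels_ok G bh (rm s g) (gl (gr s g))) ->
  fl = 2 \/ (fl = 0 /\ clean G bh s w) ->
  exists N', pot s' N' /\ N' < big * (4 * n + psum s w + fl) + run_pot G s r.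
Proof.
  intros Wk T L1 LO F.
  (* Any drop of the leading component outweighs a rise of [run_pot]. *)
  assert (Bg : forall a a' x x', x' < big -> a' < a -> big * a' + x' < big * a + x) by (intros; nia).
  assert (swap \/ ~ swap) as [S|NS].
  { unfold swapping. destruct (gs W); try (right; intros (? & _); discriminate).
    destruct (Nat.eq_dec (lp (gl W)) 3); [right; tauto|].
    destruct jW; try (right; intros (_ & _ & [?|?]); discriminate); left; auto. }
  - assert (J' := joint_swap G bh pr s w wfG pr_deg J S L).
    destruct (swap_work n S Wk) as (n' & Wk' & Hn').
    destruct (swap_W G bh pr s w J S) as (A1 & A2 & _ & _ & A5 & A6 & A7 & A8 & A9 & A10).
    destruct (swap_sep G bh s w wfG J S) as (SR & _).
    destruct (sep_far G bh wfG _ _ (j_ok _ _ _ _ J r) SR) as (_ & _ & _ & K4 & _).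
    assert (KR : forall z, rm s' r z = rm s r z).
    { intro z. rewrite (rm_next G bh pr s w J). rewrite lead_sep by assumption.
      destruct (z =? gv R); reflexivity. }
    assert (RL : ll (gl R') = ll (gl R) /\ lc (gl R') = lc (gl R)).
    { destruct SR as [E|E].
      - destruct (swap_R_Out G bh pr s w wfG J S E) as (B1 & _). rewrite B1.
        split; apply take_role_fix.
      - destruct (swap_R_Back G bh pr s w wfG J E) as (B1 & _). rewrite B1.
        split; apply take_role_fix. }
    assert (KW : forall z, z <> gv W -> rm s' w z = rm s w z).
    { intros z N. rewrite (rm_worker G bh pr s w J). apply Nat.eqb_neq in N. rewrite N. reflexivity. }
    assert (KV : rm s' w (gv W) = Mk (next_lab (gl W)) None 0).
    { rewrite (rm_worker G bh pr s w J), Nat.eqb_refl, A10. apply mR_set_same. }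
    destruct (labels_same G bh (rm s r) (rm s' r) (gl R) (gl R') (gv R)) as [X1 X2]; auto;
      try (apply RL); [rewrite KR; reflexivity|rewrite KR; apply LO|].
    pose proof (fresh_run r (gv W) (gl W) J') as FR. rewrite negb_involutive in FR.
    destruct (FR A1 A6 A7 A5 A2 A8 A9 KW KV (LO w)) as (T' & L1' & LO' & fl' & F' & P').
    eexists. split.
    + apply (pot_intro s' r n' fl'); rewrite ?negb_involutive; auto.
      intro g. destruct (bool_dec g w) as [->|Ng]; [assumption|].
      assert (g = r) by (destruct g, w; congruence || reflexivity). subst g. assumption.
    + rewrite negb_involutive. apply Bg; [apply run_pot_big|].
      unfold psum. rewrite negb_involutive. lia.
  - assert (J' := joint_stay G bh pr s w wfG pr_deg pr_sym J NS L).
    destruct (work_step G bh wfG conn bhn pr s w pr_deg J L n NS Wk) as (n' & Wk' & Hn').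
    destruct (worker_labels G bh wfG pr s w J NS) as (Y1 & Y2 & Y3).
    destruct (j_ok _ _ _ _ J w) as (_ & HnW & NbW & _).
    destruct (labels_same G bh (rm s w) (rm s' w) (gl W) (gl W') (gv W)) as [X1 X2]; auto;
      [rewrite Y3; reflexivity|rewrite Y3; apply LO|].
    destruct (run_step G bh wfG pr s w J False all2 all2 T (LO r) L1) as [SR|NR];
      try (intros; exact I); auto.
    + assert (SR0 := SR). destruct SR as (S1 & S2 & S3 & S4 & S5 & S6).
      assert (LO' : forall g, labels_ok G bh (rm s' g) (gl (gr s' g))).
      { intro g. destruct (bool_dec g w) as [->|Ng]; [assumption|].
        assert (g = r) by (destruct g, w; congruence || reflexivity). subst g. assumption. }
      assert (PS : psum s' w <= psum s w) by (unfold psum; lia).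
      destruct Hn' as [Hn'|[-> H]].
      (* The edge of the worker may have changed, so cleanness is given up: 2 against the 4
         gained. *)
      * eexists. split; [apply (pot_intro s' w n' 2); auto; rewrite S1; assumption|].
        apply Bg; [apply run_pot_big|]. lia.
      * assert (RP : run_pot G s' r < run_pot G s r).
        { apply (held_runs G bh wfG pr s w pr_one J) with (sk := all2) (full := False) (tr := all2); auto. }
        assert (F' : fl = 2 \/ (fl = 0 /\ clean G bh s' w)).
        { destruct F as [F|[F C]]; [auto|right]. split; [assumption|].
          eapply clean_step; eauto. }
        eexists. split; [apply (pot_intro s' w n fl); auto; rewrite S1; assumption|].
        assert (big * (4 * n + psum s' w + fl) <= big * (4 * n + psum s w + fl)); [|lia].
        apply Nat.mul_le_mono_l. lia.
    + destruct NR as (N1 & N2 & N3 & N4 & N5 & N6 & N7 & N8 & N9 & N10 & _).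
      destruct (fresh_run w (gv R) (gl R) J' N2 N3 N4 N5 N6 N7 N8 N9 N10 (LO r))
        as (T' & L1' & LO' & fl' & F' & P').
      assert (fl' <= 2) by (destruct F' as [->|[-> _]]; lia).
      assert (LOA : forall g, labels_ok G bh (rm s' g) (gl (gr s' g))).
      { intro g. destruct (bool_dec g w) as [->|Ng]; [assumption|].
        assert (g = r) by (destruct g, w; congruence || reflexivity). subst g. assumption. }
      eexists. split; [apply (pot_intro s' w n' fl'); auto|].
      apply Bg; [apply run_pot_big|]. unfold psum.
      destruct Hn' as [Hn'|[-> H']].
      * destruct F as [->|[-> _]]; lia.
      (* With the worker held, only a run that is not clean can end, and ending it is a gain. *)
      * destruct F as [->|[-> C]]; [lia|]. exfalso.
        destruct (clean_step G bh wfG bhn pr s w pr_sym pr_one pr_conn J NS C H' (LO r) L1)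
          as [Q _].
        pose proof (next_lab_new (gl R)). lia.
Qed.

End Step.

Lemma pot_next pr s N :
  (forall v p, pr v p = true -> p < deg G v) ->
  (forall v p, v < gn G -> p < deg G v -> pr (nb G v p) (bp G v p) = pr v p) ->
  (forall v p v' p', v < gn G -> p < deg G v -> v' < gn G -> p' < deg G v' ->
    pr v p = false -> pr v' p' = false ->
    (v' = v /\ p' = p) \/ (v' = nb G v p /\ p' = bp G v p)) ->
  connected_by G (fun v p => pr v p = true) ->
  pot s N -> (forall g, live (gr (next G bh pr s) g)) ->
  exists N', pot (next G bh pr s) N' /\ N' < N.
Proof.
  intros H1 H2 H3 H4 [w n fl J Wk T L1 LO F] L. eapply pot_descend; eauto.
Qed.

End Descent.

(** * Storage *)

Definition mark_le (b : nat) (m : mark) : Prop := lab m <= b /\ opt_nat (par m) <= b /\ ptr m <= b.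
Definition board_le (b : nat) (w : board) : Prop :=
  mark_le b (mW w) /\ (forall g, mark_le b (mR g w)) /\
  match nt w with Some (_, q) => q <= b | None => True end.
Definition ldr_le (b : nat) (l : ldr) : Prop := lp l <= b /\ lt l <= b /\ ll l <= b /\ lc l <= b.

Definition ind (m : mark) : nat := if lab m =? 0 then 0 else 1.
Definition counted (l : ldr) : Prop := ll l <= 2 * lc l + 2 /\ (lr l = false -> 1 <= ll l).

(* [lc] never exceeds the number of nodes marked by the group; since labels are at most
   [2 * lc + 2], this bounds every number that is ever stored. *)
Definition counts (l : ldr) (w : board) (l' : ldr) (w' : board) : Prop :=
  counted l -> counted l' /\ lg l' = lg l /\
  lc l' + ind (mR (lg l) w) <= lc l + ind (mR (lg l) w').

Lemma counts_trans l w l1 w1 l2 w2 : counts l w l1 w1 -> counts l1 w1 l2 w2 -> counts l w l2 w2.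
Proof.
  intros H H' C. destruct (H C) as (C1 & E1 & K1). destruct (H' C1) as (C2 & E2 & K2).
  rewrite E1 in *. split; [assumption|]. split; [assumption|lia].
Qed.

Lemma mR_set_mark l w m : mR (lg l) (set_mark l w m) = if lr l then mR (lg l) w else m.
Proof.
  unfold set_mark. destruct (lr l); [destruct (lg l); reflexivity|apply mR_set_same].
Qed.

Lemma counts_run l w : counts l w (fst (new_run l w)) (snd (new_run l w)).
Proof.
  intros [C1 C2]. unfold new_run. cbn [fst snd lg lc]. rewrite mR_set_same.
  destruct (next_lab_new l) as [_ N]. unfold counted. cbn [ll lc lr].
  assert (next_lab l <= 2 * lc l + 2).
  { unfold next_lab. destruct (Nat.leb_spec (2 * lc l + 2) (ll l)); lia. }
  unfold bump_count, ind. cbn [lab]. destruct (Nat.eqb_spec (next_lab l) 0); [lia|].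
  destruct (_ =? 0); repeat split; lia.
Qed.

Lemma counts_keep l w l' w' : ll l' = ll l -> lc l' = lc l -> lg l' = lg l ->
  (lr l' = false -> lr l = false) -> ind (mR (lg l) w) <= ind (mR (lg l) w') -> counts l w l' w'.
Proof.
  intros E1 E2 E3 E4 E5 [C1 C2]. unfold counted. rewrite E1, E2, E3. repeat split; auto. lia.
Qed.

Lemma counts_proceed d l w m :
  counts l (set_mark l w m) (fst (proceed d l w m)) (snd (proceed d l w m)) \/
  (lr l = true /\ proceed d l w m = (l, w)).
Proof.
  unfold proceed. destruct (nx d m).
  - left. apply counts_keep; auto.
  - destruct (lr l); [right; auto|left]. apply counts_run.
Qed.

Lemma counts_set d l w m : ind (cur_mark l w) <= ind m ->
  counts l w (fst (proceed d l w m)) (snd (proceed d l w m)).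
Proof.
  intro H. destruct (counts_proceed d l w m) as [K|[R ->]].
  - apply counts_trans with (2 := K). apply counts_keep; auto. rewrite mR_set_mark.
    unfold cur_mark in H. destruct (lr l); auto.
  - apply counts_keep; auto.
Qed.

Lemma counts_arrive d en fl l w : counts l w (fst (arrive d en fl l w)) (snd (arrive d en fl l w)).
Proof.
  unfold arrive. destruct fl.
  { apply counts_keep; auto; discriminate. }
  destruct (lm l).
  - destruct (_ =? _) eqn:E; [apply counts_keep; auto|].
    set (l1 := Ld _ _ _ _ _ _ _).
    assert (H : counts l w l1 (set_mark l1 w (Mk (cur_lab l) en 0))).
    { intros [C1 C2]. change (lg l) with (lg l1). rewrite mR_set_mark. subst l1. cbn [lg lr lc].
      unfold counted, cur_mark, cur_lab, bump_count, ind. cbn [ll lc lr lab].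
      destruct (lr l); [repeat split; lia || discriminate|].
      cbn [lab]. specialize (C2 eq_refl). destruct (Nat.eqb_spec (ll l) 0); [lia|].
      destruct (lab (mR (lg l) w) =? 0); repeat split; auto; lia. }
    destruct (counts_proceed d l1 w (Mk (cur_lab l) en 0)) as [K|[R ->]].
    + exact (counts_trans _ _ _ _ _ _ H K).
    + apply counts_keep; auto. subst l1. cbn [lr lc] in *. rewrite R. reflexivity.
  - apply counts_set. auto.
Qed.

Lemma counts_give d l w : counts l w (fst (abandon d l w)) (snd (abandon d l w)).
Proof.
  unfold abandon. destruct (lm l); [apply counts_set; auto|apply counts_run].
Qed.

Lemma take_role_role V l p : lr (take_role V l p) = false -> lr l = false.
Proof.
  unfold take_role. destruct (oL V); [destruct (negb (lr l) && _)|]; simpl; auto; discriminate.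
Qed.

Lemma counts_leader V d en l w :
  let '(l', w', _) := leader_step V d en l w in counts l w l' w'.
Proof.
  assert (T : forall p, counts l w (take_role V l p) w).
  { intro p. destruct (take_role_fix V l p) as (A & _ & _ & B & C).
    apply counts_keep; auto. apply take_role_role. }
  unfold leader_step. destruct (mX V), (mY V); auto.
  - destruct (lp l =? 3).
    + pose proof (counts_arrive d en (mF V) l w). destruct (arrive _ _ _ _ _). assumption.
    + destruct (judge V l).
      * apply counts_keep; auto.
      * pose proof (counts_give d l w). destruct (abandon _ _ _). assumption.
      * apply (counts_run l w).
      * apply counts_trans with l (set_nt w (Some (lm l, lt l))); [|apply counts_run].
        apply counts_keep; auto.
      * apply counts_keep; auto.
  - apply counts_keep; auto.
Qed.

(** * Bounds on the stored numbers *)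

Section Sizes.
Variable b : nat.
Hypothesis b3 : 3 <= b.

(** Conditional on the new label, whose bound comes separately from the count of marked nodes. *)
Definition fits (p : ldr * board) : Prop :=
  ll (fst p) <= b -> lp (fst p) <= b /\ lt (fst p) <= b /\ board_le b (snd p).

Lemma set_mR_le g w m : board_le b w -> mark_le b m -> board_le b (set_mR g w m).
Proof.
  intros (A & B & C) M. repeat split; destruct g; try apply A; try apply M; try exact C;
    try (destruct g0; try apply M; apply (B false) || apply (B true)).
Qed.

Lemma set_mark_le l w m : board_le b w -> mark_le b m -> board_le b (set_mark l w m).
Proof.
  intros W M. unfold set_mark. destruct (lr l); [|apply set_mR_le; assumption].
  destruct W as (A & B & C). repeat split; try apply M; try exact C;
  destruct g; try apply (B true); apply (B false).
Qed.

Lemma cur_mark_le l w : board_le b w -> mark_le b (cur_mark l w).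
Proof. intros (A & B & _). unfold cur_mark. destruct (lr l); auto. Qed.

Lemma fits_run l w : board_le b w -> fits (new_run l w).
Proof.
  intros W H. unfold new_run in *. cbn [fst snd lp lt ll] in *. repeat split; try lia.
  all: apply set_mR_le; [assumption|]; repeat split; simpl; lia.
Qed.

Lemma fits_proceed d l w m : d <= b -> lp l <= b -> lt l <= b -> board_le b w -> mark_le b m ->
  fits (proceed d l w m).
Proof.
  intros D P T W M. unfold proceed. destruct (nx d m) as [[f i]|] eqn:E.
  - intro H. cbn [fst snd point lp lt]. split; [lia|]. split; [|apply set_mark_le; assumption].
    unfold nx in E. destruct (Nat.ltb_spec (ptr m) d).
    + injection E as <- <-. simpl. lia.
    + destruct M as (_ & M & _). destruct (par m); [|discriminate]. injection E as <- <-.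
      simpl in *. lia.
  - destruct (lr l).
    + intro H. auto.
    + apply fits_run. apply set_mark_le; assumption.
Qed.

Lemma advance_le d m : d <= b -> mark_le b m -> mark_le b (advance d m).
Proof.
  intros D (A & B & C). repeat split; try assumption. simpl.
  destruct (Nat.ltb_spec (ptr m) d); lia.
Qed.

Lemma fits_arrive d en fl l w : d <= b -> opt_nat en <= b -> ldr_le b l -> board_le b w ->
  fits (arrive d en fl l w).
Proof.
  intros D En (P & T & L & _) W. unfold arrive.
  assert (I : match en with Some i => i | None => 0 end <= b) by (destruct en; simpl in *; lia).
  destruct fl.
  { intro H. cbn [fst snd lp lt]. destruct W as (A & B & C). repeat split; try lia; try apply A;
    destruct g; try apply (B true); apply (B false). }
  destruct (lm l).
  - destruct (_ =? _); [intro H; simpl; repeat split; try lia; apply W|].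
    apply fits_proceed; auto. repeat split; simpl; try lia. unfold cur_lab. destruct (lr l); lia.
  - apply fits_proceed; auto. apply advance_le; auto. apply cur_mark_le. assumption.
Qed.

Lemma fits_leader V d en l w : d <= b -> opt_nat en <= b -> ldr_le b l -> board_le b w ->
  fits (fst (leader_step V d en l w)).
Proof.
  intros D En K W. assert (K0 := K). destruct K as (P & T & L & _).
  assert (TR : forall p, p <= 3 -> fits (take_role V l p, w)).
  { intros p Hp H. destruct (take_role_fix V l p) as (_ & A & B & _). cbn [fst snd].
    rewrite A, B. repeat split; try lia; apply W. }
  unfold leader_step. destruct (mX V), (mY V); cbn [fst]; auto.
  - destruct (lp l =? 3); cbn [fst]; [apply fits_arrive; assumption|].
    destruct (judge V l); cbn [fst].
    + intro. auto.
    + unfold abandon. destruct (lm l); [|apply fits_run; assumption].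
      apply fits_proceed; auto. apply advance_le; auto. apply cur_mark_le. assumption.
    + apply fits_run; assumption.
    + apply fits_run. destruct W as (A & B & C). repeat split; try apply A; simpl; try assumption;
      destruct g; try apply (B true); apply (B false).
    + intro H. simpl. repeat split; try lia; apply W.
  - intro. auto.
Qed.

End Sizes.

Section Sized.
Variables (G : Graph) (bh : nat).
Hypothesis wfG : wf_graph G.

(** Distinct ports of a node lead to distinct nodes. *)
Lemma deg_le v : v < gn G -> deg G v <= gn G.
Proof.
  intro Hv. rewrite <- (length_seq (deg G v) 0), <- (length_map (nb G v)), <- (length_seq (gn G) 0).
  apply NoDup_incl_length.
  - apply NoDup_map_NoDup_ForallPairs; [|apply seq_NoDup].
    intros p q Hp Hq. apply in_seq in Hp, Hq. apply (proj2 wfG); lia.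
  - intros z Hz. apply in_map_iff in Hz. destruct Hz as (p & <- & Hp).
    apply in_seq in Hp. apply in_seq. split; [lia|]. apply (proj1 wfG); lia.
Qed.

Lemma bp_le v p : v < gn G -> p < deg G v -> bp G v p < gn G.
Proof.
  intros Hv Hp. destruct (far_ok G wfG v p Hv Hp) as (A & _ & B & _).
  apply deg_le in A. lia.
Qed.

(** Labels reach 2n + 2 on n nodes; the phase 3 and optional ports, stored with an offset of one,
    also stay below this. *)
Definition top : nat := 2 * gn G + 3.

Definition grp_le (me : grp) : Prop :=
  ldr_le top (gl me) /\ opt_nat (ge me) <= top /\ opt_nat (xe me) <= top /\
  opt_nat (xn me) <= top /\ opt_nat (ye me) <= top /\ opt_nat (yn me) <= top.

Definition sized (s : state) : Prop :=
  (forall g, grp_le (gr s g) /\ counted (gl (gr s g)) /\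
             lc (gl (gr s g)) <= marked G (rm s g)) /\
  forall v, board_le top (wbs s v).

Lemma lead_w_other me ot w : let g := negb (lg (gl me)) in
  mR g (lead_w G me ot w) = mR g w.
Proof.
  cbv zeta. set (g := negb (lg (gl me))).
  assert (E : w = set_mR g w (mR g w)) by (destruct w, g; reflexivity).
  rewrite E at 1. unfold g. rewrite (proj2 (lead_other G me ot w _)). apply mR_set_same.
Qed.

Lemma lead_sized g me ot W : lg (gl me) = g -> gv me < gn G -> gs me <> Done ->
  grp_le me -> counted (gl me) -> lc (gl me) <= marked G (fun z => mR g (W z)) ->
  (forall v, board_le top (W v)) ->
  let l' := lead_l G me ot (W (gv me)) in let W' := lead_upd G me ot W in
  ldr_le top l' /\ counted l' /\ lc l' <= marked G (fun z => mR g (W' z)) /\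
  (forall v, board_le top (W' v)) /\ forall z, mR (negb g) (W' z) = mR (negb g) (W z).
Proof.
  intros Eg Hv Nd (Kl & Ke & _) C M B l' W'.
  assert (EW : forall z, W' z = if z =? gv me then lead_w G me ot (W (gv me)) else W z).
  { intro z. unfold W', lead_upd, upd. destruct (gs me); congruence || reflexivity. }
  pose proof (counts_leader (aview G me ot (gv me)) (deg G (gv me)) (ge me) (gl me) (W (gv me))) as K.
  assert (F : fits top (fst (leader_step (aview G me ot (gv me)) (deg G (gv me)) (ge me) (gl me)
                           (W (gv me))))).
  { apply fits_leader; auto; unfold top; [lia|]. apply deg_le in Hv. lia. }
  pose proof (lead_w_other me ot (W (gv me))) as O. rewrite Eg in O. cbv zeta in O.
  unfold l', lead_l, lead_w, lead in *. clear l'.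
  destruct (leader_step _ _ _ _ _) as [[l1 w1] a]. cbn [fst snd] in *.
  destruct (K C) as (C' & _ & N). rewrite Eg in N.
  assert (M' : lc l1 <= marked G (fun z => mR g (W' z))).
  { assert (S : marked G (fun z => mR g (W' z)) + ind (mR g (W (gv me))) =
                marked G (fun z => mR g (W z)) + ind (mR g w1)).
    { pose proof (sumn_upd (fun z => ind (mR g (W z))) (fun z => ind (mR g (W' z))) (gn G) (gv me) Hv)
        as S. cbv beta in S. rewrite (EW (gv me)), Nat.eqb_refl in S. apply S.
      intros z _ Nz. rewrite EW. apply Nat.eqb_neq in Nz. rewrite Nz. reflexivity. }
    lia. }
  pose proof (marked_bound G (fun z => mR g (W' z))).
  assert (LL : ll l1 <= top) by (destruct C'; unfold top; lia).
  destruct (F LL) as (F1 & F2 & F3). cbn [fst snd] in *.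
  split; [repeat split; auto; unfold top; lia|]. split; [assumption|]. split; [assumption|].
  split; intro z; rewrite EW; destruct (Nat.eqb_spec z (gv me)) as [->|]; auto.
Qed.

Variable pr : nat -> nat -> bool.
Hypothesis pr_deg : forall v p, pr v p = true -> p < deg G v.

Lemma gnext_le me ot w wy : gv me < gn G -> grp_le me -> grp_le ot ->
  (gs me <> Done -> ldr_le top (lead_l G me ot w)) -> grp_le (gnext G bh pr me ot w wy).
Proof.
  intros Hv K (_ & _ & _ & X & _) Lw. assert (K0 := K).
  destruct K as (K1 & K2 & K3 & K4 & K5 & K6).
  assert (P : forall p, pr (gv me) p = true -> S p <= top /\ S (bp G (gv me) p) <= top).
  { intros p Hp. apply pr_deg in Hp. pose proof (bp_le _ _ Hv Hp). apply deg_le in Hv.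
    unfold top. lia. }
  unfold gnext. destruct (gs me) eqn:E; [| | | |assumption];
    try (assert (L' := Lw ltac:(discriminate))).
  - destruct (try_port _ _ _) as [q|]; [destruct (pr (gv me) q) eqn:Q|];
      repeat split; cbn [gl ge xe xn ye yn opt_nat]; auto; try apply L'; try lia.
    apply P. assumption.
  - destruct (opposite _ _); [|destruct (_ && _) eqn:Q];
      repeat split; cbn [gl ge xe xn ye yn opt_nat]; auto; try apply L'; try lia.
    + apply andb_prop in Q. apply (P (lt (gl me))), Q.
    + apply andb_prop in Q. apply (P (lt (gl me))), Q.
    + destruct (xe me); assumption.
  - destruct (_ && _) eqn:Q;
      repeat split; cbn [gl ge xe xn ye yn opt_nat]; auto; try apply L'; try lia;
      apply andb_prop in Q; apply (P (lt (gl me))), Q.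
  - repeat split; auto; apply K1.
Qed.

Lemma gnext_gl me ot w wy : gs me <> Done -> gl (gnext G bh pr me ot w wy) = lead_l G me ot w.
Proof.
  intro N. unfold gnext. destruct (gs me) eqn:E; try congruence.
  - destruct (try_port _ _ _); [destruct (pr _ _)|]; reflexivity.
  - destruct (opposite _ _); [|destruct (_ && _)]; reflexivity.
  - destruct (_ && _); reflexivity.
  - unfold lead_l. rewrite lead_Lost by assumption. reflexivity.
Qed.

Lemma turn_sized g me ot W wy : group_ok G bh g me -> grp_le me -> grp_le ot ->
  counted (gl me) -> lc (gl me) <= marked G (fun z => mR g (W z)) ->
  (forall v, board_le top (W v)) ->
  let me' := gnext G bh pr me ot (W (gv me)) wy in let W' := lead_upd G me ot W in
  grp_le me' /\ counted (gl me') /\ lc (gl me') <= marked G (fun z => mR g (W' z)) /\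
  (forall v, board_le top (W' v)) /\ forall z, mR (negb g) (W' z) = mR (negb g) (W z).
Proof.
  intros (Eg & Hv & _) K Ko C M B me' W'.
  assert (gs me = Done \/ gs me <> Done) as [D|D] by (destruct (gs me); auto; right; discriminate).
  - unfold me', W', gnext, lead_upd. rewrite D. auto 10.
  - destruct (lead_sized g me ot W Eg Hv D K C M B) as (A1 & A2 & A3 & A4 & A5).
    assert (E : gl me' = lead_l G me ot (W (gv me))) by (apply gnext_gl; assumption).
    rewrite E. split; [apply gnext_le; auto|]. auto.
Qed.

Lemma marked_ext mk mk' : (forall z, mk z = mk' z) -> marked G mk = marked G mk'.
Proof. intro E. apply sumn_ext. intros z _. rewrite E. reflexivity. Qed.

Lemma sized_next s : (forall g, group_ok G bh g (gr s g)) -> sized s -> sized (next G bh pr s).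
Proof.
  intros OK (Sg & Sb).
  destruct (turn_sized false (gr s false) (gr s true) (wbs s) (mid_wbs G s (far G (gr s false))))
    as (A1 & A2 & A3 & A4 & A5); auto; try apply Sg.
  fold (mid_wbs G s) in *.
  destruct (turn_sized true (gr s true) (gr s false) (mid_wbs G s) (mid_wbs G s (far G (gr s true))))
    as (B1 & B2 & B3 & B4 & B5); auto; try apply Sg.
  { rewrite (marked_ext _ (rm s true)); [apply Sg|]. intro z. apply (A5 z). }
  split; [|exact B4]. intros []; (split; [assumption|]); (split; [assumption|]).
  - exact B3.
  - rewrite (marked_ext _ (fun z => mR false (mid_wbs G s z))); [exact A3|].
    intro z. apply (B5 z).
Qed.

End Sized.

Section Storage.
Variables (G : Graph) (bh : nat).
Hypothesis wfG : wf_graph G.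

(** [rel] forgets the memory of destroyed scouts, while the storage bound concerns all six agents;
    so scouts have an invariant of their own, dead or alive. *)
Definition drone_fine (a : agent) : Prop :=
  halted a = None /\ exists d, mem a = enc_mem (MD d) /\ opt_nat (de d) <= top G.

Definition drones_fine (c : config) : Prop :=
  forall sw g, drone_fine (ag c (iX sw g)) /\ drone_fine (ag c (iY g)).

Lemma drone_step_le V en d w b : opt_nat en <= b -> opt_nat (de d) <= b ->
  opt_nat (de (fst (drone_step V en d w))) <= b /\
  forall o, snd (drone_step V en d w) <> Halt o.
Proof.
  intros H1 H2. unfold drone_step. destruct (mL V) as [l|].
  - cbn [fst snd de opt_nat]. split; [lia|]. intro o.
    destruct (dy d); [destruct (mX V); [|destruct (_ =? _)]|
      destruct (mY V); [destruct (try_port V l en)|destruct (_ =? _)]]; discriminate.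
  - destruct (dy d); [|destruct (opposite V en); [|destruct (de d) eqn:E]];
      cbn [fst snd de opt_nat]; (split; [rewrite ?E; simpl in *; lia|discriminate]).
Qed.

Lemma move_fine m t a d act : halted a = None -> mem a = enc_mem (MD d) ->
  opt_nat (de d) <= top G -> (forall o, act <> Halt o) ->
  drone_fine (move_one G bh m t a (Some act)).
Proof.
  intros H M D N. destruct act; simpl.
  - split; eauto.
  - destruct (_ && _); split; eauto.
  - destruct (N answer). reflexivity.
Qed.

Lemma drones_next m ids t c s : valid_schedule G m -> rel G bh c s ->
  (forall g, group_ok G bh g (gr s g)) -> sized G s -> drones_fine c ->
  drones_fine (round bhs G bh m ids t c).
Proof.
  intros vm (sw & R & RW & _) OK (Sz & _) F.
  assert (FX : forall g, drone_fine (ag (round bhs G bh m ids t c) (iX sw g))).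
  { intro g. destruct (active (ag c (iX sw g))) eqn:A.
    - destruct (drone_X_cases G bh c s sw R g A) as (u & ok & Nu & Eu & E).
      destruct (step_X G bh m ids t c s sw R OK g u Eu Nu) as (w & ok' & ->).
      1,2: intro Q; destruct (R g) as [_ H]; rewrite Q in H; unfold active in A;
           destruct H as [H _]; rewrite H in A; discriminate.
      cbv zeta. destruct (Sz g) as [(_ & _ & K1 & K2 & _) _].
      destruct (drone_step_le (aview G (gr s g) (gr s (negb g)) u) (xn (gr s g))
        (Dr g false (xe (gr s g)) false) w _ K2 K1) as [D1 D2].
      eapply move_fine; simpl; eauto.
    - rewrite step_dead; auto using iX_lt. apply (F sw g). }
  intros sw' g. split.
  - destruct (bool_dec sw' sw) as [->|N]; [apply FX|].
    replace (iX sw' g) with (iX sw (negb g)); [apply FX|].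
    destruct sw, sw', g; congruence || reflexivity.
  - destruct (active (ag c (iY g))) eqn:A.
    + destruct (drone_Y_cases G bh ids c s sw R OK g A) as (u & ok & Nu & Eu & E).
      destruct (step_Y G bh m ids t c s sw R RW OK g u Eu) as (w & ok' & _ & ->).
      1,2: intro Q; destruct (R g) as [_ H]; rewrite Q in H; unfold active in A;
           destruct H as [_ H]; rewrite H in A; discriminate.
      cbv zeta. destruct (Sz g) as [(_ & _ & _ & _ & K1 & K2) _].
      destruct (drone_step_le (aview G (gr s g) (gr s (negb g)) u) (yn (gr s g))
        (Dr g true (ye (gr s g)) (yf (gr s g))) w _ K2 K1) as [D1 D2].
      eapply move_fine; simpl; eauto.
    + rewrite step_dead; auto using iY_lt. apply (F sw g).
Qed.

(** Since 2n + 4 is at most 4n, each of the twelve numbers takes at most 2 log n + 5 bits; as log n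
    is at least 1, the additive 60 is absorbed: 24 + 60 = 84. *)
Lemma top_log : 2 <= gn G -> 12 * (2 * Nat.log2 (S (top G)) + 1) <= 84 * Nat.log2 (gn G).
Proof.
  intro H. assert (1 <= Nat.log2 (gn G)) by (apply (Nat.log2_le_mono 2); assumption).
  assert (Nat.log2 (S (top G)) <= 2 + Nat.log2 (gn G)); [|lia].
  rewrite <- Nat.log2_mul_pow2 by lia. apply Nat.log2_le_mono. unfold top. simpl. lia.
Qed.

Lemma b2n_le (b : bool) n : 1 <= n -> Nat.b2n b <= n.
Proof. destruct b; simpl; lia. Qed.

Lemma board_length w : board_le (top G) w ->
  length (enc_board w) <= 12 * (2 * Nat.log2 (S (top G)) + 1).
Proof.
  intros (A & B & C). unfold enc_board.
  eapply Nat.le_trans; [apply (nats_bits_length _ (top G))|].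
  - assert (1 <= top G) by (unfold top; lia).
    destruct A as (A1 & A2 & A3). destruct (B false) as (B1 & B2 & B3).
    destruct (B true) as (C1 & C2 & C3). simpl mR in *.
    unfold board_nats, mark_nats. intros x Hx.
    destruct (nt w) as [[md q]|]; simpl in Hx;
      repeat (destruct Hx as [<-|Hx]; [auto using b2n_le; lia|]); contradiction.
  - assert (length (board_nats w) = 12) as -> by (destruct w as [? ? ? [[? ?]|]]; reflexivity).
    lia.
Qed.

Lemma mem_length a :
  match a with ML l => ldr_le (top G) l | MD d => opt_nat (de d) <= top G end ->
  length (enc_mem a) <= 12 * (2 * Nat.log2 (S (top G)) + 1).
Proof.
  intro H. unfold enc_mem. eapply Nat.le_trans; [apply (nats_bits_length _ (top G))|].
  - assert (1 <= top G) by (unfold top; lia). intros x Hx.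
    destruct a as [l|d]; [destruct H as (H1 & H2 & H3 & H4)|]; simpl in Hx;
      repeat (destruct Hx as [<-|Hx]; [auto using b2n_le; lia|]); contradiction.
  - assert (length (amem_nats a) = 8) as -> by (destruct a; reflexivity). lia.
Qed.

Definition fine (c : config) : Prop :=
  (forall k, k < nagents -> length (mem (ag c k)) <= 84 * Nat.log2 (gn G)) /\
  (forall v, length (wb c v) <= 84 * Nat.log2 (gn G)) /\
  (forall k p, k < nagents -> halted (ag c k) = Some (Some p) -> correct_claim G bh (ag c k) p).

Lemma rel_fine c s : 2 <= gn G -> rel G bh c s -> (forall g, group_ok G bh g (gr s g)) ->
  sized G s -> drones_fine c -> fine c.
Proof.
  intros Hn (sw & R & RW & RE) OK (Sz & Sb) F. pose proof (top_log Hn) as T.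
  assert (D : forall a, drone_fine a -> length (mem a) <= 84 * Nat.log2 (gn G)).
  { intros a (_ & d & -> & Hd). eapply Nat.le_trans; [apply mem_length; assumption|assumption]. }
  split; [|split].
  - intros k Hk. destruct (member_cases sw k Hk) as [g [-> | [-> | ->] ] ].
    + destruct (R g) as [[ok E] _]. rewrite E. cbn [mem].
      eapply Nat.le_trans; [apply mem_length; apply (Sz g)|assumption].
    + apply D, F.
    + apply D. apply (F sw g).
  - intro v. destruct (RE v) as [->|[w E]]; [simpl; lia|]. rewrite E.
    eapply Nat.le_trans; [apply board_length|exact T].
    specialize (RW v). rewrite E, dec_enc_board in RW. subst w. apply Sb.
  - intros k p Hk H. destruct (member_cases sw k Hk) as [g [-> | [-> | ->] ] ].
    + destruct (R g) as [[ok E] _]. rewrite E in *. cbn [halted] in H.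
      destruct (OK g) as (_ & _ & _ & O). destruct (gs (gr s g)); try discriminate.
      injection H as <-. unfold correct_claim. simpl. exact O.
    + destruct (F sw g) as [[A _] _]. congruence.
    + destruct (F sw g) as [_ [A _]]. congruence.
Qed.

End Storage.

(** * The configuration after the opening round *)

Section Start.
Variables (G : Graph) (bh s : nat) (m : schedule) (ids : nat -> nat).
Hypothesis ids_lt : forall k, k < nagents - 1 -> ids k < ids (S k).

Definition start : state :=
  St (fun g => Gp (Ld g (negb g) true 0 0 (Nat.b2n g) (Nat.b2n g)) s None All
                  None None None None false)
     (upd (fun _ => empty_board) s (Bd (Mk 1 None 0) no_mark (Mk 1 None 0) None)).

Notation c0 := (init_config s).

(** All agents are together and IDs increase with the index, so counting the smaller IDs recovers
    the index. *)
Lemma start_rank k : k < nagents ->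
  length (filter (fun x => fst x <? ids k) (colocated ids (ag c0) k)) = k.
Proof.
  intro Hk. unfold nagents in *.
  pose proof (ids_lt 0). pose proof (ids_lt 1). pose proof (ids_lt 2). pose proof (ids_lt 3).
  pose proof (ids_lt 4).
  assert (B : forall i j, i < 6 -> j < 6 -> (ids i <? ids j) = (i <? j)).
  { intros i j Hi Hj. apply eq_iff_eq_true. rewrite !Nat.ltb_lt.
    do 6 (destruct i as [|i]; [do 6 (destruct j as [|j]; [lia|]); lia|]). lia. }
  unfold colocated. do 6 (destruct k as [|k];
    [cbn -[Nat.ltb]; rewrite !Nat.eqb_refl; cbn -[Nat.ltb]; rewrite !B by lia; reflexivity|]). lia.
Qed.

Lemma start_out k w : k < nagents -> out bhs G ids c0 w k =
  (enc_mem (fst (setup k (dec_board w))), enc_board (snd (setup k (dec_board w))), Stay).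
Proof.
  intro Hk. unfold out. cbn [mem c0 init_config ag pos entry succ].
  change (step bhs) with bhs_step. unfold bhs_step.
  change (fun _ : nat => mkAgent s true [] None true None) with (ag c0).
  rewrite start_rank by assumption. destruct (setup _ _). reflexivity.
Qed.

Lemma start_boards k v : k < nagents -> boards bhs G ids c0 (S k) v =
  if v =? s then enc_board (snd (setup k (dec_board (boards bhs G ids c0 k s))))
  else boards bhs G ids c0 k v.
Proof.
  intro Hk. cbn [boards]. change (active (ag c0 k)) with true. cbv iota.
  rewrite start_out by assumption. reflexivity.
Qed.

Lemma start_agent k : k < nagents -> exists w, ag (exec bhs G bh m ids s 1) k =
  mkAgent s true (enc_mem (fst (setup k w))) None true None.
Proof.
  intros Hk. exists (dec_board (boards bhs G ids c0 k s)). cbn [exec].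
  rewrite round_agent by assumption.
  unfold computed, chosen, out_at. change (active (ag c0 k)) with true. cbv iota.
  rewrite start_out by assumption. reflexivity.
Qed.

Lemma start_rel : s <> bh -> rel G bh (exec bhs G bh m ids s 1) start.
Proof.
  intro Nb. exists false.
  pose proof start_agent as A.
  assert (B : forall v, wb (exec bhs G bh m ids s 1) v = boards bhs G ids c0 6 v).
  { intro v. cbn [exec]. apply round_board. }
  assert (N : (s =? bh) = false) by (apply Nat.eqb_neq; assumption).
  split; [|split].
  - intro g. unfold rel_grp. cbn [gr start gs gv]. rewrite N.
    unfold nagents in A. destruct g; cbn [iL iX iY xorb].
    + destruct (A 3) as [w3 E3]; [lia|]. destruct (A 4) as [w4 E4]; [lia|].
      destruct (A 5) as [w5 E5]; [lia|]. rewrite E3, E4, E5. simpl. eauto 10.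
    + destruct (A 0) as [w3 E3]; [lia|]. destruct (A 1) as [w4 E4]; [lia|].
      destruct (A 2) as [w5 E5]; [lia|]. rewrite E3, E4, E5. simpl. eauto 10.
  - intro v. rewrite B. unfold start, upd. cbn [wbs].
    rewrite !start_boards by (unfold nagents; lia). cbn [boards]. rewrite !Nat.eqb_refl.
    destruct (v =? s); [|reflexivity]. rewrite !dec_enc_board. reflexivity.
  - intro v. rewrite B. rewrite !start_boards by (unfold nagents; lia).
    destruct (v =? s); [right; eauto|left; reflexivity].
Qed.

Hypothesis sn : s < gn G.

Lemma start_marked : marked G (rm start true) = 1.
Proof.
  unfold marked. pose proof (sumn_upd (fun _ => 0) (fun z => if lab (rm start true z) =? 0 then 0 else 1)
    (gn G) s sn) as H. cbv beta in H.
  rewrite sumn_const, Nat.mul_0_r, Nat.add_0_r, Nat.add_0_l in H. rewrite H.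
  - unfold rm, start, upd. cbn [wbs]. rewrite Nat.eqb_refl. reflexivity.
  - intros z _ Nz. unfold rm, start, upd. cbn [wbs]. apply Nat.eqb_neq in Nz. rewrite Nz. reflexivity.
Qed.

Lemma start_sized : sized G start.
Proof.
  split.
  - intro g. split; [|split].
    + repeat split; simpl; unfold top; destruct g; simpl; lia.
    + destruct g; split; simpl; auto; discriminate.
    + destruct g; [rewrite start_marked; simpl; lia|simpl; lia].
  - intro v. unfold start, upd. cbn [wbs]. destruct (v =? s); repeat split; simpl;
      try destruct g; simpl; unfold top; lia.
Qed.

Lemma start_ok g : s <> bh -> group_ok G bh g (gr start g).
Proof. intro. repeat split; auto. Qed.

Lemma start_drones : drones_fine G (exec bhs G bh m ids s 1).
Proof.
  assert (D : forall k, k = 1 \/ k = 2 \/ k = 4 \/ k = 5 ->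
              drone_fine G (ag (exec bhs G bh m ids s 1) k)).
  { intros k Hk. destruct (start_agent k) as [w E]; [unfold nagents; lia|]. rewrite E.
    split; [reflexivity|]. unfold mem.
    destruct Hk as [-> | [-> | [-> | ->] ] ]; eexists; (split; [reflexivity|simpl; lia]). }
  intros sw g. split; apply D; destruct sw, g; simpl; auto.
Qed.

End Start.

(** * The execution *)

Section Network.
Variables (G : Graph) (m : schedule).
Hypothesis wfG : wf_graph G.
Hypothesis vm : valid_schedule G m.

Lemma avail_deg t v p : avail G m t v p = true -> p < deg G v.
Proof. intro H. apply andb_prop in H. apply Nat.ltb_lt, H. Qed.

Lemma avail_one t v p v' p' : v < gn G -> p < deg G v -> v' < gn G -> p' < deg G v' ->
  avail G m t v p = false -> avail G m t v' p' = false ->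
  (v' = v /\ p' = p) \/ (v' = nb G v p /\ p' = bp G v p).
Proof.
  intros Hv Hp Hv' Hp' A A'.
  assert (P : forall z q, q < deg G z -> avail G m t z q = false ->
            exists w i, m t = Some (w, i) /\ ((z = w /\ q = i) \/ (z = nb G w i /\ q = bp G w i))).
  { intros z q Hq H. unfold avail, present in H. apply Nat.ltb_lt in Hq. rewrite Hq in H.
    destruct (m t) as [[w i]|]; [|discriminate]. exists w, i. split; [reflexivity|].
    simpl in H. apply negb_false_iff, orb_prop in H.
    destruct H as [H|H]; apply andb_prop in H; destruct H as [H1 H2];
      apply Nat.eqb_eq in H1, H2; auto. }
  destruct (P _ _ Hp A) as (w & i & E & C). destruct (P _ _ Hp' A') as (w' & i' & E' & C').
  rewrite E in E'. injection E' as <- <-.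
  destruct C as [[-> ->]|[C1 C2]], C' as [[C1' C2']|[C1' C2']]; subst; auto.
  right. destruct (far_ok G wfG _ _ Hv' Hp') as (_ & _ & _ & -> & ->). auto.
Qed.

Lemma avail_conn t : connected_by G (fun v p => avail G m t v p = true).
Proof.
  intros u w Hu Hw. pose proof (proj2 (vm t) u w Hu Hw) as R.
  induction R as [|z p R IH Hp Ok]; [constructor|].
  apply reach_step; auto.
  - apply IH. clear - wfG R Hu. induction R; [assumption|]. apply (proj1 wfG); auto.
  - unfold avail. apply Nat.ltb_lt in Hp. rewrite Hp. assumption.
Qed.

Lemma reach_deg u v : u < gn G -> reach G (fun _ _ => True) u v ->
  v < gn G /\ (v = u \/ 0 < deg G v).
Proof.
  intros Hu R. induction R as [|w p R [Hw IH] Hp _]; [auto|].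
  destruct (far_ok G wfG _ _ Hw Hp) as (A & _ & B & _). split; [assumption|right; lia].
Qed.

Lemma degrees_sum n : list_sum (map (deg G) (seq 0 n)) = sumn (deg G) n.
Proof.
  induction n as [|n IH]; [reflexivity|].
  rewrite seq_S, map_app, list_sum_app, IH. simpl. lia.
Qed.

End Network.

Section Execution.
Variables (G : Graph) (bh s : nat) (m : schedule) (ids : nat -> nat).
Hypothesis wfG : wf_graph G.
Hypothesis conn : connected_by G (fun _ _ => True).
Hypothesis bhn : bh < gn G.
Hypothesis sn : s < gn G.
Hypothesis sbh : s <> bh.
Hypothesis vm : valid_schedule G m.
Hypothesis ids_lt : forall k, k < nagents - 1 -> ids k < ids (S k).

Notation run := (exec bhs G bh m ids s).

Lemma deg_pos v : v < gn G -> 0 < deg G v.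
Proof.
  intro Hv. destruct (Nat.eq_dec v s) as [->|N].
  - destruct (reach_deg G wfG bh s bhn (conn bh s bhn sn)) as [_ [E|E]]; [congruence|assumption].
  - destruct (reach_deg G wfG s v sn (conn s v sn Hv)) as [_ [E|E]]; [congruence|assumption].
Qed.

Lemma two_nodes : 2 <= gn G.
Proof. lia. Qed.

Lemma start_joint : joint G bh (start s) false.
Proof.
  constructor; try (simpl; discriminate).
  - intro g. split; discriminate.
  - intro g. apply start_ok; assumption.
  - intro g. simpl. lia.
  - reflexivity.
  - reflexivity.
  - left. split; [reflexivity|]. split; [reflexivity|]. intro z. unfold start, upd. cbn [wbs].
    destruct (z =? s); reflexivity.
  - intros [E|E]; discriminate.
  - simpl. intros _ [E|E]; discriminate.
Qed.

Lemma start_wm z : z <> s -> lab (wm (start s) z) <> 1.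
Proof.
  intro N. unfold wm, start, upd. cbn [wbs]. apply Nat.eqb_neq in N. rewrite N. discriminate.
Qed.

Lemma start_rm g z : z <> s -> lab (rm (start s) g z) = 0.
Proof.
  intro N. unfold rm, start, upd. cbn [wbs]. apply Nat.eqb_neq in N. rewrite N.
  destruct g; reflexivity.
Qed.

(** The initial potential: rank 12 for the worker, [psi] at most 2n and 2n + 1 for the labels 0 and
    1, flag 2, and [big] for the run. *)
Definition time_bound : nat :=
  big G * (4 * (16 * (4 * (sumn (deg G) (gn G) + gn G) + 1) + 12) + (4 * gn G + 1) + 2) + big G.

Lemma start_pot : exists N, pot G bh (start s) N /\ N <= time_bound.
Proof.
  assert (RW : forall z, wm (start s) z = if z =? s then Mk 1 None 0 else no_mark).
  { intro z. unfold wm, start, upd. cbn [wbs]. destruct (z =? s); reflexivity. }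
  assert (RR : forall g z, rm (start s) g z = if (z =? s) && g then Mk 1 None 0 else no_mark).
  { intros g z. unfold rm, start, upd. cbn [wbs]. destruct (z =? s), g; reflexivity. }
  eexists. split.
  - eapply (pot_intro G bh (start s) false) with (fl := 2).
    + apply start_joint.
    + apply work_hold.
      * split; [reflexivity|]. split; [reflexivity|]. intro z. unfold start, upd. cbn [wbs].
        destruct (z =? s); reflexivity.
      * apply new_run_tracks; try reflexivity; try exact sn; try exact deg_pos.
        -- rewrite RW. cbn. rewrite Nat.eqb_refl. reflexivity.
        -- apply ready_new; auto.
           ++ rewrite RW. cbn. rewrite Nat.eqb_refl. reflexivity.
           ++ exact start_wm.
    + apply new_run_tracks; try reflexivity; try exact sn; try exact deg_pos.
      * rewrite RR. cbn. rewrite Nat.eqb_refl. reflexivity.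
      * apply ready_new; auto.
        -- rewrite RR. cbn. rewrite Nat.eqb_refl. reflexivity.
        -- intros z Nz. rewrite start_rm by assumption. discriminate.
    + simpl. lia.
    + intro g. split; [|split].
      * destruct g; [symmetry; apply start_marked; assumption|].
        simpl. unfold marked. rewrite (sumn_ext _ (fun _ => 0)).
        -- rewrite sumn_const. lia.
        -- intros z _. rewrite RR, andb_false_r. reflexivity.
      * simpl. lia.
      * intros z Hz. destruct (Nat.eq_dec z s) as [->|N].
        -- rewrite RR. destruct (_ && _); simpl; repeat split; auto; lia.
        -- rewrite start_rm in Hz by assumption. congruence.
    + auto.
  - unfold time_bound. pose proof (run_pot_big G (start s) (negb false)).
    pose proof (mu_bound G (wm (start s)) 1 (lm (gl (gr (start s) false)))).
    assert (psum G (start s) false <= 4 * gn G + 1).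
    { unfold psum. pose proof (psi_bound G (rm (start s) false) 0).
      pose proof (psi_bound G (rm (start s) true) 1). simpl in *. lia. }
    assert (rank_hold G (gr (start s) false) (gr (start s) (negb false)) = 12) as -> by reflexivity.
    apply Nat.add_le_mono; [|lia]. apply Nat.mul_le_mono_l. lia.
Qed.

Definition alive_all (st : state) : Prop := forall g, live (gr st g).

(** The joint invariant is kept only while both groups are alive. After a loss the other group may
    go on, but correctness of claims and storage need only the invariants of single groups. *)
Record reached (t : nat) (st : state) : Prop := {
  re_rel : rel G bh (run t) st;
  re_ok : forall g, group_ok G bh g (gr st g);
  re_sized : sized G st;
  re_drones : drones_fine G (run t);
  re_joint : alive_all st -> exists w, joint G bh st w }.

Lemma alive_dec st : alive_all st \/ exists g, gs (gr st g) = Lost \/ gs (gr st g) = Done.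
Proof.
  assert (D : forall g, live (gr st g) \/ (gs (gr st g) = Lost \/ gs (gr st g) = Done)).
  { intro g. unfold live. destruct (gs (gr st g)); intuition discriminate. }
  destruct (D false), (D true); eauto. left. intros []; assumption.
Qed.

Lemma alive_before pr st : alive_all (next G bh pr st) -> alive_all st.
Proof.
  intros L g. destruct (L g) as [L1 L2]. unfold next, gnext in L1, L2. cbn [gr] in L1, L2.
  split; intro E; rewrite E in L1, L2; cbn [gs] in L1, L2; congruence.
Qed.

Lemma reached_next t st : reached t st -> reached (S t) (next G bh (avail G m t) st).
Proof.
  intros [R OK Sz F J].
  assert (OP : forall g, opposed G (gr st g) (gr st (negb g)) ->
             lp (gl (gr st g)) = 1 /\ lp (gl (gr st (negb g))) = 1).
  { intros g O. destruct (alive_dec st) as [L|[h H]].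
    - destruct (J L) as [w Jw]. pose proof (joint_opposed_fresh G bh wfG _ _ Jw) as OF.
      split; [apply OF; assumption|]. apply OF. rewrite negb_involutive.
      apply (opposed_sym G bh wfG g); auto.
    - exfalso. destruct O as (O1 & O2 & _).
      destruct g, h; simpl in *; destruct H; congruence. }
  constructor.
  - cbn [exec]. apply rel_next; auto. intros g O. apply OP. assumption.
  - intro g. unfold next. cbn [gr]. apply group_ok_next; auto. apply avail_deg.
  - apply sized_next; auto. apply avail_deg.
  - cbn [exec]. eapply drones_next; eauto.
  - intro L. destruct (J (alive_before _ _ L)) as [w Jw].
    apply joint_next with (w := w); auto; [apply avail_deg|].
    intros. apply avail_sym; assumption.
Qed.

Lemma reached_start : reached 1 (start s).
Proof.
  constructor.
  - apply start_rel; auto.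
  - intro g. apply start_ok; auto.
  - apply start_sized; auto.
  - apply start_drones; auto.
  - intros _. exists false. apply start_joint.
Qed.

Lemma reached_all t : exists st, reached (S t) st.
Proof.
  induction t as [|t [st IH]]; [eauto using reached_start|]. eauto using reached_next.
Qed.

Lemma run_fine t : fine G bh (run t).
Proof.
  destruct t as [|t].
  - repeat split; simpl; intros; try lia; discriminate.
  - destruct (reached_all t) as [st [R OK Sz F _]]. eapply rel_fine; eauto using two_nodes.
Qed.

Lemma descent N : forall t st, reached t st -> pot G bh st N ->
  exists T st', T <= t + N + 1 /\ reached T st' /\ ~ alive_all st'.
Proof.
  induction N as [N IH] using (well_founded_induction lt_wf). intros t st R P.
  pose proof (reached_next t st R) as R'.
  destruct (alive_dec (next G bh (avail G m t) st)) as [L|[g H]].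
  - destruct (pot_next G bh deg_pos wfG bhn conn (avail G m t) st N (avail_deg G m t)
      (avail_sym G m wfG vm t) (avail_one G m wfG t) (avail_conn G m wfG vm t) P L) as (N' & P' & Hn).
    destruct (IH N' Hn (S t) _ R' P') as (T & st' & A & B). exists T, st'. split; [lia|assumption].
  - eexists (S t), _. split; [lia|]. split; [exact R'|]. intro L. destruct (L g). destruct H; congruence.
Qed.

Lemma done_solved t st g : reached t st -> gs (gr st g) = Done -> solved G bh (run t).
Proof.
  intros [(sw & R & _) OK _ _ _] E. destruct (R g) as [[ok A] _]. rewrite E in A.
  exists (iL g), (lt (gl (gr st g))). rewrite A. split; [apply iL_lt|]. split; [reflexivity|].
  split; [reflexivity|]. destruct (OK g) as (_ & _ & _ & O). rewrite E in O. exact O.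
Qed.

(** One round of setup, at most one more than the potential until a group is lost, and one for the
    leader left alone to stop. *)
Lemma eventually_solved : exists T, T <= time_bound + 3 /\ solved G bh (run T).
Proof.
  destruct start_pot as (N & P & B).
  destruct (descent N 1 _ reached_start P) as (T & st & HT & R & D).
  destruct (alive_dec st) as [L|[g [E|E]]]; [contradiction| |].
  - exists (S T). split; [lia|]. apply (done_solved _ _ g (reached_next T st R)).
    unfold next, gnext. cbn [gr]. rewrite E. reflexivity.
  - exists T. split; [lia|]. exact (done_solved _ _ g R E).
Qed.

(** No node is isolated, so n is at most the degree sum d, and both factors of the potential are
    linear in the number e of edges: with d and n at most 3e they are below 409e and 1664e. *)
Lemma time_quadratic : time_bound + 3 <= 500 * 1700 * num_edges G ^ 2.
Proof.
  unfold num_edges. rewrite degrees_sum. unfold time_bound, big.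
  assert (N : gn G <= sumn (deg G) (gn G)).
  { assert (forall n, n <= gn G -> n <= sumn (deg G) n) as H; [|apply H; lia].
    induction n as [|n IH]; intro Hn; simpl; [lia|]. pose proof (deg_pos n). lia. }
  pose proof two_nodes. set (d := sumn (deg G) (gn G)) in *. set (n := gn G) in *.
  (* Halving loses at most one, and e is at least 1, so d is at most 2e + 1, hence at most 3e. *)
  pose proof (Nat.div_mod_eq d 2). pose proof (Nat.mod_upper_bound d 2).
  set (e := d / 2) in *. assert (1 <= e) by lia. assert (d <= 3 * e) by lia.
  assert (n <= 3 * e) by lia.
  rewrite Nat.pow_2_r.
  set (a := 16 * (4 * (d + n) + 1) + 9). assert (a <= 409 * e) by (unfold a; lia).
  set (b := 4 * _ + _ + 2). assert (b <= 1664 * e) by (unfold b; lia).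
  nia.
Qed.

End Execution.

Theorem theorem12 :
  exists alg : algorithm,
  forall c : nat, 2 <= c ->
  exists K : nat,
  forall (G : Graph) (bh s : nat) (m : schedule) (ids : nat -> nat),
    wf_graph G ->
    connected_by G (fun _ _ => True) ->
    bh < gn G -> s < gn G -> s <> bh ->
    valid_schedule G m ->
    (forall k, k < nagents - 1 -> ids k < ids (S k)) ->
    1 <= ids 0 -> ids (nagents - 1) <= gn G ^ c ->
    (exists T, T <= K * num_edges G ^ 2 /\ solved G bh (exec alg G bh m ids s T)) /\
    (forall t k p, k < nagents ->
       halted (ag (exec alg G bh m ids s t) k) = Some (Some p) ->
       correct_claim G bh (ag (exec alg G bh m ids s t) k) p) /\
    (forall t k, k < nagents ->
       length (mem (ag (exec alg G bh m ids s t) k)) <= K * Nat.log2 (gn G)) /\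
    (forall t v, v < gn G ->
       length (wb (exec alg G bh m ids s t) v) <= K * Nat.log2 (gn G)).
Proof.
  (* IDs are compared in the opening round and never stored, so one constant serves every [c], for
     time and storage alike. *)
  exists bhs. intros c _. exists (500 * 1700).
  intros G bh s m ids wfG conn bhn sn sbh vm ids_lt _ _.
  assert (F := run_fine G bh s m ids wfG bhn sn sbh vm ids_lt).
  assert (K : forall x, 84 * x <= 500 * 1700 * x) by (intro; lia).
  split; [|split; [|split]].
  - destruct (eventually_solved G bh s m ids wfG conn bhn sn sbh vm ids_lt) as (T & A & B).
    exists T. split; [|assumption]. eapply Nat.le_trans; [exact A|].
    apply (time_quadratic G bh s); assumption.
  - intros t. apply F.
  - intros t k Hk. eapply Nat.le_trans; [apply F; assumption|apply K].
  - intros t v _. eapply Nat.le_trans; [apply F|apply K].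
Qed.
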